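(* Let $n\ge 4$, let $Q=D_n$, let $k\in\{1,n-1,n\}$ be a minuscule vertex, let $\mathsf w=\delta_k$ (so $\mathsf w_k=1$ and $\mathsf w_j=0$ for $j\neq k$), and let $\mathsf v\in\mathbb N^n$ be such that the Nakajima quiver variety $\mathcal M(\mathsf v,\mathsf w)$ is nonempty. Put $\mu=\omega_k-\sum_{i=1}^n \mathsf v_i\alpha_i$ and $\Phi^+_\mu=\{\alpha\in\Phi^+ \mid (\mu,\alpha)<0\}$. Then the (shifted, trivial-descendant) vertex function $\mathsf V(\boldsymbol z)\in\mathbb Q(q,\hbar)[[z_1,\dots,z_n]]$ of $\mathcal M(\mathsf v,\mathsf w)$ factorizes as $$\mathsf V(\boldsymbol z)=\prod_{\alpha\in\Phi^+_\mu}F(e^\alpha),\qquad F(z)=\prod_{m=0}^\infty\frac{1-\hbar z q^m}{1-zq^m},$$ where for $\alpha=\sum_i m_i\alpha_i$ one sets $e^\alpha=\prod_i (e^{\alpha_i})^{m_i}$ with $e^{\alpha_i}=(q/\hbar)^{a_i}z_i$ and $a_i=\mathsf v_i-\sum_{e\in Q_1:\,o(e)=i}\mathsf v_{i(e)}$.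
   Context: **Quiver.** $\mathbb N=\{0,1,2,\dots\}$. The quiver $D_n$ has vertices $Q_0=\{1,\dots,n\}$ and arrows $Q_1$: $i\to i+1$ for $1\le i\le n-2$, and $n-2\to n$. An arrow $e$ goes from $o(e)$ to $i(e)$. $\delta_k\in\mathbb N^n$ is the $k$-th standard basis vector. **Root system.** $\epsilon_1,\dots,\epsilon_n$ is an orthonormal basis, $\alpha_i=\epsilon_i-\epsilon_{i+1}$ for $i\le n-1$, $\alpha_n=\epsilon_{n-1}+\epsilon_n$; $\Phi^+=\{\epsilon_i\pm\epsilon_j: i<j\}$; $\omega_i$ are the fundamental weights, $(\omega_i,\alpha_j)=\delta_{ij}$. **Quiver variety.** Let $\dim V_i=\mathsf v_i$, $\dim W_i=\mathsf w_i$. Points of $T^*\mathrm{Rep}_Q(\mathsf v,\mathsf w)$ are tuples $(X_e,Y_e,A_i,B_i)$, $X_e\in\mathrm{Hom}(V_{o(e)},V_{i(e)})$, $Y_e\in\mathrm{Hom}(V_{i(e)},V_{o(e)})$, $A_i\in\mathrm{Hom}(W_i,V_i)$, $B_i\in\mathrm{Hom}(V_i,W_i)$, with moment map $\mu_i=\sum_{i(e)=i}X_eY_e-\sum_{o(e)=i}Y_eX_e+A_iB_i$. A tuple is stable if the only collection of subspaces $S_i\subset V_i$ with $\mathrm{Im}(A_i)\subset S_i$ and stable under all $X_e,Y_e$ is $S_i=V_i$. With $G_{\mathsf v}=\prod_i GL(V_i)$, $\mathcal M(\mathsf v,\mathsf w)=\mu^{-1}(0)^{s}/G_{\mathsf v}$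 (the GIT quotient for the stability parameter $(1,\dots,1)$). For $\mathsf w=\delta_k$ with $k\in\{1,n-1,n\}$ it is either empty or a single point. The torus $\mathsf T=\mathbb C^\times_\hbar$ acts by scaling $(Y,B)$ with weight $\hbar^{-1}$. **Vertex function (geometric definition).** A stable quasimap $\mathbb P^1\dashrightarrow\mathcal M(\mathsf v,\mathsf w)$ is a morphism $\mathbb P^1\to[\mu^{-1}(0)/G_{\mathsf v}]$ landing in the stable locus away from finitely many points; its degree is $\boldsymbol d=(\deg\mathcal V_i)_i$, $\mathcal V_i$ being the induced vector bundles on $\mathbb P^1$. Let $\mathsf{QM}^{\boldsymbol d}_{ns,\infty}$ be the moduli space of degree $\boldsymbol d$ stable quasimaps nonsingular (i.e. stable) at $\infty$, with its canonical perfect obstruction theory, $\mathsf T\times\mathbb C^\times_q$-action, and symmetrized virtual structure sheaf $\hat{\mathcal O}_{vir}^{\boldsymbol d}$ (Okounkov), formed with the polarization $T^{1/2}=\sum_e\mathrm{Hom}(\mathscr V_{o(e)},\mathscr V_{i(e)})+\sum_i\mathrm{Hom}(\mathscr W_i,\mathscr V_i)-\sum_i\mathrm{Hom}(\mathscr V_i,\mathscr V_i)$. Then $V(\boldsymbol z)=\sum_{\boldsymbol d}\mathrm{ev}_{\infty,*}(\hat{\mathcal O}^{\boldsymbol d}_{vir})\boldsymbol z^{\boldsymbol d}$. Put $b_j=\sum_{i(e)=j}\mathsf v_{o(e)}-\sum_{o(e)=j}\mathsf v_{i(e)}+\mathsf w_j$; the shifted vertex function is $\mathsf V(\boldsymbol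 z)=V(\boldsymbol z)|_{z_i\mapsto(-\hbar^{-1/2})^{b_i}z_i}$. **Explicit form (which fixes all normalizations and may be used as the definition of $\mathsf V$).** Let $(x)_d=\varphi(x)/\varphi(xq^d)$, $\varphi(x)=\prod_{m\ge0}(1-xq^m)$, $d\in\mathbb Z$; i.e. $(x)_d=\prod_{m=0}^{d-1}(1-xq^m)$ for $d\ge 0$ and $(x)_d=\prod_{m=1}^{-d}(1-xq^{-m})^{-1}$ for $d<0$. Define colored weighted posets (partial orders generated by the listed relations, imposed whenever both elements exist; $d_{i,j}$ has color $i$): (i) $\mathcal P^{(n)}$: elements $d_{i,j}$ ($1\le i\le n-2$, $1\le j\le i$), $d_{n-1,j}$ ($1\le j\le\lfloor (n-1)/2\rfloor$), $d_{n,j}$ ($1\le j\le\lfloor n/2\rfloor$); relations $d_{i+1,j}\le d_{i,j}\le d_{i+1,j+1}$ for $1\le i\le n-3$; $d_{n-2,2j-1}\le d_{n-1,j}\le d_{n-2,2j}$; $d_{n-2,2j-2}\le d_{n,j}\le d_{n-2,2j-1}$; weights $\mathrm{wt}(d_{i,j})=\hbar^{n-i+j-2}$ for $i\le n-2$, $\mathrm{wt}(d_{n-1,j})=\hbar^{2j-1}$, $\mathrm{wt}(d_{n,j})=\hbar^{2j-2}$. (ii) $\mathcal P^{(n-1)}$: the same weighted poset with the colors $n-1$ and $n$ exchanged. (iii) $\mathcal P^{(1)}$: elements $d_{i,1},d_{i,2}$ ($1\le i\le n-2$), $d_{n-1,1},d_{n,1}$; relations $d_{i,1}\le d_{i+1,1}$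 ($1\le i\le n-2$), $d_{i,2}\ge d_{i+1,2}$ ($1\le i\le n-3$), $d_{n-2,1}\le d_{n,1}\le d_{n-2,2}$, $d_{n-1,1}\le d_{n-2,2}$; weights $\mathrm{wt}(d_{i,1})=1$, $\mathrm{wt}(d_{i,2})=\hbar^{n-i-1}$. For $\mathsf w=\delta_k$ and $\mathcal M(\mathsf v,\mathsf w)\ne\emptyset$ there is a unique order ideal (down-set) $\mathcal P\subset\mathcal P^{(k)}$ with exactly $\mathsf v_i$ elements of color $i$ for all $i$; let $c$ be its coloring. Let $\mathrm{rpp}(\mathcal P)$ be the set of $\pi:\mathcal P\to\mathbb N$ with $x\le y\Rightarrow\pi(x)\le\pi(y)$, $\deg(\pi)_i=\sum_{c(x)=i}\pi(x)$, and $N(\pi)=\sum_j b_j\deg(\pi)_j$. Then $$\mathsf V(\boldsymbol z)=\sum_{\pi\in\mathrm{rpp}(\mathcal P)}\Big(\frac q\hbar\Big)^{N(\pi)}\boldsymbol z^{\deg\pi}\prod_{x\in c^{-1}(k)}\frac{(\hbar\,\mathrm{wt}(x))_{\pi(x)}}{(q\,\mathrm{wt}(x))_{\pi(x)}}\prod_{e\in Q_1}\prod_{\substack{x\in c^{-1}(o(e))\\ y\in c^{-1}(i(e))}}\frac{\big(\hbar\frac{\mathrm{wt}(y)}{\mathrm{wt}(x)}\big)_{\pi(y)-\pi(x)}}{\big(q\frac{\mathrm{wt}(y)}{\mathrm{wt}(x)}\big)_{\pi(y)-\pi(x)}}\prod_{i\in Q_0}\prod_{x,y\in c^{-1}(i)}\frac{\big(q\frac{\mathrm{wt}(y)}{\mathrm{wt}(x)}\big)_{\pi(y)-\pi(x)}}{\big(\hbar\frac{\mathrm{wt}(y)}{\mathrm{wt}(x)}\big)_{\pi(y)-\pi(x)}}.$$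 *)

(* Defs.v *)
From HB Require Import structures.
From mathcomp Require Import all_boot all_order all_algebra all_fingroup.
From mathcomp Require Import boolp reals complex mpoly ring zify.
From mathcomp Require classical_sets.

Set Implicit Arguments.
Unset Strict Implicit.
Unset Printing Implicit Defensive.

Import Order.TTheory GRing.Theory Num.Theory.
Local Open Scope ring_scope.

Local Notation "x %:F" := (tofrac x).

Definition fps (n : nat) (K : comNzRingType) : Type := 'X_{1..n} -> K.

Section FpsRing.
Variables (n : nat) (K : comNzRingType).
Implicit Types (f g h : fps n K) (m : 'X_{1..n}).

HB.instance Definition _ := gen_eqMixin (fps n K).
HB.instance Definition _ := gen_choiceMixin (fps n K).

Definition fps_zero : fps n K := fun=> 0.
Definition fps_opp f : fps n K := fun m => - f m.
Definition fps_add f g : fps n K := fun m => f m + g m.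

Fact fps_addA : associative fps_add.
Proof. by move=> f g h; apply/funext=> m; apply: addrA. Qed.
Fact fps_addC : commutative fps_add.
Proof. by move=> f g; apply/funext=> m; apply: addrC. Qed.
Fact fps_add0 : left_id fps_zero fps_add.
Proof. by move=> f; apply/funext=> m; apply: add0r. Qed.
Fact fps_addN : left_inverse fps_zero fps_opp fps_add.
Proof. by move=> f; apply/funext=> m; apply: addNr. Qed.

HB.instance Definition _ :=
  GRing.isZmodule.Build (fps n K) fps_addA fps_addC fps_add0 fps_addN.

Definition fps_one : fps n K := fun m => (m == 0%MM)%:R.

Definition fps_mul f g : fps n K := fun m =>
  \sum_(k : 'X_{1..n < (mdeg m).+1, (mdeg m).+1} | m == (k.1 + k.2)%MM)
     f k.1 * g k.2.

Definition fps_trunc N f : {mpoly K[n]} :=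
  \sum_(k : 'X_{1..n < N}) f k *: 'X_[k].

Fact fps_truncE N f m : (mdeg m < N)%N -> (fps_trunc N f)@_m = f m.
Proof.
move=> lt_mN; rewrite /fps_trunc raddf_sum /=.
rewrite (bigD1 (BMultinom lt_mN)) //= mcoeffZ mcoeffX eqxx mulr1.
rewrite big1 ?addr0 // => k ne_k; rewrite mcoeffZ mcoeffX.
suff /negPf-> : val k != m by rewrite mulr0.
by apply: contra ne_k => /eqP e; apply/eqP/val_inj.
Qed.

Fact fps_mulE N f g p r m : (mdeg m < N)%N ->
  (forall k, (mdeg k < N)%N -> p@_k = f k) ->
  (forall k, (mdeg k < N)%N -> r@_k = g k) ->
  fps_mul f g m = (p * r)@_m.
Proof.
move=> lt_mN ep er; rewrite mcoeffM; apply: eq_bigr => k _.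
by rewrite ep ?er //; apply: leq_trans lt_mN; apply: bmdeg.
Qed.

Fact fps_mulA : associative fps_mul.
Proof.
move=> f g h; apply/funext=> m.
pose N := (mdeg m).+1; pose t := fps_trunc N.
have tE e k : (mdeg k < N)%N -> (t e)@_k = e k by apply: fps_truncE.
rewrite (@fps_mulE N _ _ (t f) (t g * t h)) //; last first.
  move=> k lt_k; rewrite (@fps_mulE N _ _ (t g) (t h)) //; exact: tE.
  exact: tE.
rewrite (@fps_mulE N _ _ (t f * t g) (t h)) ?mulrA //; last exact: tE.
move=> k lt_k; rewrite (@fps_mulE N _ _ (t f) (t g)) //; exact: tE.
Qed.

Fact fps_mulC : commutative fps_mul.
Proof.
move=> f g; apply/funext=> m; pose t := fps_trunc (mdeg m).+1.
have tE e k : (mdeg k < (mdeg m).+1)%N -> (t e)@_k = e k by apply: fps_truncE.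
rewrite (@fps_mulE (mdeg m).+1 f g (t f) (t g)) //; [|exact: tE..].
by rewrite mulrC (@fps_mulE (mdeg m).+1 g f (t g) (t f)) //; exact: tE.
Qed.

Fact fps_mul1 : left_id fps_one fps_mul.
Proof.
move=> f; apply/funext=> m.
rewrite (@fps_mulE (mdeg m).+1 _ _ 1 (fps_trunc (mdeg m).+1 f)) ?mul1r //.
- by rewrite fps_truncE.
- by move=> k _; rewrite mcoeff1.
- by move=> k; apply: fps_truncE.
Qed.

Fact fps_mulDl : left_distributive fps_mul fps_add.
Proof.
move=> f g h; apply/funext=> m; rewrite /fps_mul /fps_add -big_split /=.
by apply: eq_bigr => k _; rewrite mulrDl.
Qed.

Fact fps_one_neq0 : fps_one != 0 :> fps n K.
Proof.
apply/eqP=> /(congr1 (fun f : fps n K => f 0%MM)) /eqP.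
by rewrite /fps_one eqxx oner_eq0.
Qed.

HB.instance Definition _ := GRing.Zmodule_isComNzRing.Build (fps n K)
  fps_mulA fps_mulC fps_mul1 fps_mulDl fps_one_neq0.

Lemma fps_coef0 m : (0 : fps n K) m = 0. Proof. by []. Qed.
Lemma fps_coefN f m : (- f) m = - f m. Proof. by []. Qed.
Lemma fps_coefD f g m : (f + g) m = f m + g m. Proof. by []. Qed.
Lemma fps_coef1 m : (1 : fps n K) m = (m == 0%MM)%:R. Proof. by []. Qed.
Lemma fps_coefM f g m : (f * g) m =
  \sum_(k : 'X_{1..n < (mdeg m).+1, (mdeg m).+1} | m == (k.1 + k.2)%MM)
     f k.1 * g k.2.
Proof. by []. Qed.

End FpsRing.

Section FpsOps.
Variables (n : nat) (K : comNzRingType).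
Implicit Types (f g : fps n K) (m : 'X_{1..n}).

Definition fpsC (c : K) : fps n K := fun m => if m == 0%MM then c else 0.
Definition fpsX (i : 'I_n) : fps n K := fun m => (m == U_(i)%MM)%:R.

(* The inverse of a series [f] with constant term 1, as the geometric series in
   [1 - f]; the omitted powers of [1 - f] do not contribute to the coefficient
   at [m]. *)
Definition fps_inv1 f : fps n K := fun m =>
  \sum_(s < (mdeg m).+1) ((1 - f) ^+ s : fps n K) m.

(* Substitution of a series [g] without constant term into a univariate series;
   the omitted powers of [g] do not contribute to the coefficient at [m]. *)
Definition fps_comp (F : fps 1 K) g : fps n K := fun m =>
  \sum_(s < (mdeg m).+1) F (U_(ord0) *+ s)%MM * (g ^+ s : fps n K) m.

End FpsOps.

Section FpsTheory.
Variables (n : nat) (K : comNzRingType).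
Implicit Types (f g h : fps n K) (m : 'X_{1..n}).

Lemma fps_coef_sum (I : Type) (r : seq I) (P : pred I) (F : I -> fps n K) m :
  (\sum_(i <- r | P i) F i) m = \sum_(i <- r | P i) F i m.
Proof. by apply: (big_morph (fun f : fps n K => f m)). Qed.

Lemma fps_coefM0 f g : (f * g) 0%MM = f 0%MM * g 0%MM.
Proof.
rewrite [LHS](@fps_mulE _ _ 1 f g (fps_trunc 1 f) (fps_trunc 1 g)) ?mdeg0 //;
  [|exact: fps_truncE..].
by rewrite rmorphM /= !fps_truncE ?mdeg0.
Qed.

Lemma fps_coefCM (c : K) f m : (fpsC c * f) m = c * f m.
Proof.
rewrite [LHS](@fps_mulE _ _ (mdeg m).+1 _ _ c%:MP (fps_trunc (mdeg m).+1 f)) //.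
- by rewrite mcoeffCM fps_truncE.
- by move=> k _; rewrite mcoeffC /fpsC; case: eqP; rewrite ?mulr1 ?mulr0.
- by move=> k; apply: fps_truncE.
Qed.

Lemma fps_coefXM i f m : (fpsX K i * f) (U_(i) + m)%MM = f m.
Proof.
set N := (mdeg (U_(i) + m)).+1.
rewrite [LHS](@fps_mulE _ _ N _ _ 'X_[U_(i)] (fps_trunc N f)) //.
- by rewrite mulrC mcoeffMX fps_truncE // /N mdegD ltnS leq_addl.
- by move=> k _; rewrite mcoeffX /fpsX eq_sym.
- by move=> k; apply: fps_truncE.
Qed.

Lemma fps_expr_small h s m : h 0%MM = 0 -> (mdeg m < s)%N -> (h ^+ s : fps n K) m = 0.
Proof.
move=> h0; elim: s m => // s IHs m lt_ms.
rewrite exprS fps_coefM big1 // => -[k1 k2] /= /eqP em.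
case: (eqVneq (val k1) 0%MM) => [->|nz]; first by rewrite h0 mul0r.
rewrite IHs ?mulr0 //; apply: leq_trans (_ : mdeg m <= s)%N => //.
by rewrite [X in (_ < X)%N](congr1 mdeg em) mdegD -[X in (X < _)%N]add0n ltn_add2r lt0n mdeg_eq0.
Qed.

Lemma fps_inv1P f : f 0%MM = 1 -> f * fps_inv1 f = 1.
Proof.
move=> f0; apply/funext=> m; pose h := 1 - f.
have h0 : h 0%MM = 0 by rewrite /h fps_coefD fps_coefN fps_coef1 eqxx f0 subrr.
pose S := \sum_(s < (mdeg m).+1) h ^+ s.
have fE : f = - (h - 1) by rewrite /h opprB opprB addrC subrK.
transitivity ((f * S) m).
  rewrite !fps_coefM; apply: eq_bigr => -[k1 k2] /= /eqP em; congr (_ * _).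
  have le_k : (mdeg k2 <= mdeg m)%N by rewrite [leqRHS](congr1 mdeg em) mdegD leq_addl.
  rewrite /fps_inv1 /S fps_coef_sum (big_ord_widen (mdeg m).+1 (fun s => (h ^+ s : fps n K) k2)) //.
  rewrite big_mkcond; apply: eq_bigr => s _; case: ltnP => // lt_s.
  by rewrite fps_expr_small.
have -> : f * S = 1 - h ^+ (mdeg m).+1 by rewrite /S fE mulNr -subrX1 opprB.
by rewrite fps_coefD fps_coefN fps_expr_small // subr0.
Qed.

End FpsTheory.

(* Q(q, hbar) as the fraction field of Q[hbar][q]. *)

Notation Qqh := {fraction {poly {poly rat}}}.

Definition qv : Qqh := ('X : {poly {poly rat}})%:F.
Definition hv : Qqh := (('X : {poly rat})%:P : {poly {poly rat}})%:F.

(* [x] lies in q^N times the local ring of Q(q, hbar) at q = 0. *)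
Definition qadic_small (N : nat) (x : Qqh) : Prop :=
  exists f g : {poly {poly rat}}, g.[0] != 0 /\ x = qv ^+ N * (f%:F / g%:F).

Definition qadic_cvg (u : nat -> Qqh) (l : Qqh) : Prop :=
  forall N, exists M0, forall M, (M0 <= M)%N -> qadic_small N (u M - l).

Definition qadic_lim (u : nat -> Qqh) : Qqh := classical_sets.xget 0 (qadic_cvg u).

Definition Fpart (M : nat) : fps 1 Qqh :=
  \prod_(m < M) ((1 - fpsC (hv * qv ^+ m) * fpsX Qqh ord0) *
                 fps_inv1 (1 - fpsC (qv ^+ m) * fpsX Qqh ord0)).

(* The infinite product is the coefficientwise q-adic limit of its partial
   products; it converges by [Fprod_cvg]. *)
Definition Fprod : fps 1 Qqh := fun m => qadic_lim (fun M => Fpart M m).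

Section QadicTheory.

Let val0 (g : {poly {poly rat}}) : g.[0] != 0 -> g%:F != 0 :> Qqh.
Proof. by apply: contra; rewrite tofrac_eq0 => /eqP->; rewrite horner0. Qed.

Lemma qadic_small0 N : qadic_small N 0.
Proof. by exists 0, 1; rewrite hornerC oner_eq0 tofrac0 mul0r mulr0. Qed.

Lemma qadic_smallD N x y :
  qadic_small N x -> qadic_small N y -> qadic_small N (x + y).
Proof.
move=> [f1 [g1 [g1nz ->]]] [f2 [g2 [g2nz ->]]].
exists (f1 * g2 + f2 * g1), (g1 * g2); split.
  by rewrite hornerM mulf_neq0.
by rewrite -mulrDr addf_div ?val0 // tofracD !tofracM.
Qed.

Lemma qadic_smallM N M x y :
  qadic_small N x -> qadic_small M y -> qadic_small (N + M) (x * y).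
Proof.
move=> [f1 [g1 [g1nz ->]]] [f2 [g2 [g2nz ->]]].
exists (f1 * f2), (g1 * g2); split; first by rewrite hornerM mulf_neq0.
by rewrite mulrACA -exprD mulf_div !tofracM.
Qed.

Lemma qadic_small_frac (f g : {poly {poly rat}}) :
  g.[0] != 0 -> qadic_small 0 (f%:F / g%:F).
Proof. by move=> nz; exists f, g; rewrite expr0 mul1r. Qed.

Lemma qadic_small_poly (f : {poly {poly rat}}) : qadic_small 0 f%:F.
Proof.
by rewrite -[f%:F]divr1 -tofrac1; apply: qadic_small_frac; rewrite hornerC oner_eq0.
Qed.

Lemma qadic_smallW N M x : (N <= M)%N -> qadic_small M x -> qadic_small N x.
Proof.
move=> le [f [g [nz ->]]]; exists ('X ^+ (M - N) * f), g; split=> //.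
by rewrite -{1}(subnKC le) exprD tofracM tofracXn -/qv !mulrA.
Qed.

Lemma qadic_smallN N x : qadic_small N x -> qadic_small N (- x).
Proof.
by move=> [f [g [nz ->]]]; exists (- f), g; rewrite tofracN mulNr mulrN.
Qed.

Lemma qadic_smallB N x y :
  qadic_small N x -> qadic_small N y -> qadic_small N (x - y).
Proof. by move=> sx sy; apply/qadic_smallD/qadic_smallN. Qed.

Lemma qadic_smallX N : qadic_small N (qv ^+ N).
Proof.
by exists 1, 1; rewrite hornerC oner_eq0 tofrac1 divr1 mulr1.
Qed.

Let intq m : qadic_small 0 (qv ^+ m).
Proof. by rewrite /qv -tofracXn; apply: qadic_small_poly. Qed.

Let inth : qadic_small 0 hv.
Proof. exact: qadic_small_poly. Qed.

Let int1 : qadic_small 0 1.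
Proof. exact: (intq 0). Qed.

Let intM x y : qadic_small 0 x -> qadic_small 0 y -> qadic_small 0 (x * y).
Proof. exact: qadic_smallM. Qed.

Lemma subr_qv_neq0 d : 1 - qv ^+ d.+1 != 0.
Proof.
rewrite /qv -tofracXn -tofrac1 -tofracB; apply: val0.
by rewrite hornerD hornerN hornerXn hornerC expr0n subr0 oner_eq0.
Qed.

Let intV d : qadic_small 0 (1 - qv ^+ d.+1)^-1.
Proof.
rewrite -[_^-1]mul1r /qv -tofracXn -tofrac1 -tofracB.
apply: qadic_small_frac.
by rewrite hornerD hornerN hornerXn hornerC expr0n subr0 oner_eq0.
Qed.

Let z : fps 1 Qqh := fpsX Qqh ord0.
Let Z (c : Qqh) : fps 1 Qqh := 1 - fpsC c * z.
Let dil (f : fps 1 Qqh) : fps 1 Qqh := fun m => qv ^+ mdeg m * f m.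

Let dilM f g : dil (f * g) = dil f * dil g.
Proof.
apply/funext=> m; rewrite /dil !fps_coefM mulr_sumr; apply: eq_bigr => k /eqP em.
by rewrite [in qv ^+ mdeg m]em mdegD exprD mulrACA.
Qed.

Let dil1 : dil 1 = 1.
Proof.
apply/funext=> m; rewrite /dil !fps_coef1.
by case: eqP => [->|_]; rewrite ?mdeg0 ?mulr1 ?mulr0.
Qed.

Let dilZ c : dil (Z c) = Z (c * qv).
Proof.
apply/funext=> m; rewrite /dil /Z !fps_coefD !fps_coefN !fps_coefCM !fps_coef1.
rewrite /z /fpsX; case: (eqVneq m 0%MM) => [->|nz].
  by rewrite mdeg0 expr0 mul1r [0%MM == _]eq_sym mnm1_eq0 !mulr0.
case: (eqVneq m U_(ord0)%MM) => [->|nz']; last by rewrite !mulr0 subr0 mulr0.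
by rewrite mdeg1 expr1 !mulr1 !sub0r mulrN mulrC.
Qed.

Let Z0 c : Z c 0%MM = 1.
Proof.
rewrite /Z fps_coefD fps_coefN fps_coefCM fps_coef1 eqxx /z /fpsX.
by rewrite eq_sym mnm1_eq0 mulr0 subr0.
Qed.

Let FpartS M : Fpart M.+1 * Z (qv ^+ M) = Fpart M * Z (hv * qv ^+ M).
Proof.
rewrite /Fpart big_ord_recr /= -!mulrA; congr (_ * _); rewrite /Z -/z.
by rewrite [fps_inv1 _ * _]mulrC fps_inv1P ?mulr1 //; apply: Z0.
Qed.

Let cancelZ c f g : f * Z c = g * Z c -> f = g.
Proof.
move=> /(congr1 (fun h => h * fps_inv1 (Z c))).
by rewrite -!mulrA fps_inv1P ?mulr1.
Qed.

Let dilFpart M : Z (qv ^+ M) * Z hv * dil (Fpart M)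
                 = Z 1 * Z (hv * qv ^+ M) * Fpart M.
Proof.
elim: M => [|M IHM].
  by rewrite /Fpart big_ord0 dil1 expr0 !mulr1.
have e1 := congr1 dil (FpartS M); rewrite !dilM !dilZ -mulrA -!exprSr in e1.
apply: (@cancelZ (qv ^+ M)).
have -> : Z (qv ^+ M.+1) * Z hv * dil (Fpart M.+1) * Z (qv ^+ M)
  = Z hv * Z (qv ^+ M) * (dil (Fpart M.+1) * Z (qv ^+ M.+1)) by ring.
have -> : Z 1 * Z (hv * qv ^+ M.+1) * Fpart M.+1 * Z (qv ^+ M)
  = Z 1 * Z (hv * qv ^+ M.+1) * (Fpart M.+1 * Z (qv ^+ M)) by ring.
rewrite e1 FpartS.
have -> : Z hv * Z (qv ^+ M) * (dil (Fpart M) * Z (hv * qv ^+ M.+1))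
  = Z (hv * qv ^+ M.+1) * (Z (qv ^+ M) * Z hv * dil (Fpart M)) by ring.
by rewrite IHM; ring.
Qed.

Let mz (d : nat) : 'X_{1..1} := (U_(ord0) *+ d)%MM.

Let mzS d : mz d.+1 = (U_(ord0) + mz d)%MM.
Proof. by rewrite /mz mulmS. Qed.

Let ZfS c f d : (Z c * f) (mz d.+1) = f (mz d.+1) - c * f (mz d).
Proof.
by rewrite /Z mulrBl mul1r fps_coefD fps_coefN -mulrA fps_coefCM [in X in _ - X]mzS fps_coefXM.
Qed.

Let Zf0 c f : (Z c * f) (mz 0) = f (mz 0).
Proof. by rewrite /mz mulm0n fps_coefM0 Z0 mul1r. Qed.

Let dilE f d : dil f (mz d) = qv ^+ d * f (mz d).
Proof. by rewrite /dil /mz mdegMn mdeg1 mul1n. Qed.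

Let Fc M d := Fpart M (mz d).

Let Fc0 M : Fc M 0 = 1.
Proof.
rewrite /Fc /mz mulm0n; elim: M => [|M IHM].
  by rewrite /Fpart big_ord0 fps_coef1 eqxx.
have := congr1 (fun f : fps 1 Qqh => f 0%MM) (FpartS M).
by rewrite !fps_coefM0 !Z0 !mulr1 IHM.
Qed.

Let Fc1 M : (1 - qv) * Fc M 1 = 1 - hv + qv ^+ M * (hv - 1).
Proof.
have := congr1 (fun f : fps 1 Qqh => f (mz 1)) (dilFpart M).
rewrite -!mulrA !ZfS !Zf0 !dilE -/(Fc M 1) -/(Fc M 0) Fc0 expr0 expr1 !mulr1.
by move=> e; rewrite mulrBl mul1r; apply/eqP; rewrite -subr_eq0;
  move/eqP: e; rewrite -subr_eq0 => /eqP e; rewrite -oppr_eq0 -[X in _ == X]e;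
  apply/eqP; ring.
Qed.

Let FcSS M d : (1 - qv ^+ d.+2) * Fc M d.+2 = (1 - hv * qv ^+ d.+1) * Fc M d.+1
  + qv ^+ M * ((hv - qv ^+ d.+1) * Fc M d.+1 - hv * (1 - qv ^+ d) * Fc M d).
Proof.
have := congr1 (fun f : fps 1 Qqh => f (mz d.+2)) (dilFpart M).
rewrite -!mulrA !ZfS !dilE -/(Fc M d.+2) -/(Fc M d.+1) -/(Fc M d).
move/eqP; rewrite -subr_eq0 => /eqP e; apply/eqP.
by rewrite -subr_eq0 -oppr_eq0 -[X in _ == X]e; apply/eqP; ring.
Qed.

Let good d := (forall M, qadic_small 0 (Fc M d)) /\
              (exists l, qadic_cvg (fun M => Fc M d) l).

(* If (1 - q^(d+1)) u_M = c w_M + q^M r_M, with c, w_M, r_M integral and w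
   convergent, then u is integral and convergent. *)
Let good_step d c (u w r : nat -> Qqh) : qadic_small 0 c ->
  (forall M, qadic_small 0 (w M)) -> (exists l, qadic_cvg w l) ->
  (forall M, qadic_small 0 (r M)) ->
  (forall M, (1 - qv ^+ d.+1) * u M = c * w M + qv ^+ M * r M) ->
  (forall M, qadic_small 0 (u M)) /\ (exists l, qadic_cvg u l).
Proof.
move=> ic iw [l wl] ir ue.
have uE M : u M = (1 - qv ^+ d.+1)^-1 * (c * w M + qv ^+ M * r M).
  by rewrite -ue mulKf ?subr_qv_neq0.
split=> [M|].
  by rewrite uE; apply: intM (intV d) _; apply: qadic_smallD; apply: intM.
exists ((1 - qv ^+ d.+1)^-1 * (c * l)) => N; have [M0 hM0] := wl N.
exists (maxn M0 N) => M; rewrite geq_max => /andP[/hM0 sw le_NM].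
rewrite uE -mulrBr addrAC -mulrBr.
apply: (@qadic_smallM 0 N _ _ (intV d)); apply: qadic_smallD.
  exact: (@qadic_smallM 0 N).
rewrite -[N]addn0; apply: qadic_smallM (ir M).
exact: qadic_smallW le_NM (qadic_smallX M).
Qed.

Let good_all d : good d /\ good d.+1.
Proof.
have g0 : good 0.
  split=> [M|]; first by rewrite Fc0.
  by exists 1 => N; exists 0%N => M _; rewrite Fc0 subrr; apply: qadic_small0.
elim: d => [|d [[i0 c0] [i1 c1]]].
  split=> //; apply: (@good_step 0 (1 - hv) _ (fun=> 1) (fun=> hv - 1)).
  - exact: qadic_smallB.
  - by [].
  - by exists 1 => N; exists 0%N => M _; rewrite subrr; apply: qadic_small0.
  - by move=> M; apply: qadic_smallB.
  - by move=> M; rewrite expr1 mulr1 Fc1.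
split=> //; apply: (good_step _ i1 c1 _ (FcSS^~ d)).
  by apply: qadic_smallB => //; apply: intM.
move=> M; apply: qadic_smallB; first by apply: intM => //; apply: qadic_smallB.
by apply: intM => //; apply: intM => //; apply: qadic_smallB.
Qed.

Lemma Fprod_cvg m : qadic_cvg (fun M => Fpart M m) (Fprod m).
Proof.
have [_ [l hl]] := (good_all (mdeg m)).1.
have em : m = mz (mdeg m).
  apply/mnmP=> i; rewrite ord1 /mz mulmnE mnm1E eqxx mul1n.
  by rewrite mdegE big_ord1.
move: (mdeg m) em hl => d -> hl.
by apply: (@classical_sets.xgetPex _ 0 (qadic_cvg _)); exists l.
Qed.

End QadicTheory.

(* The vertex of the quiver labelled a, for a in 1..n, is the ordinal [i : 'I_n]
   with [i.+1 = a]. The index a of [eps n a] also runs over 1..n. *)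

Definition eps (n a : nat) : 'rV[rat]_n := \row_(j < n) (j.+1 == a)%:R.

Definition simple_root (n : nat) (i : 'I_n) : 'rV[rat]_n :=
  if (i.+1 < n)%N then eps n i.+1 - eps n i.+2 else eps n n.-1 + eps n n.

Definition pairing (n : nat) (x y : 'rV[rat]_n) : rat := \sum_j x 0 j * y 0 j.

Definition positive_roots (n : nat) : seq 'rV[rat]_n :=
  [seq eps n i - eps n j | i <- iota 1 n, j <- iota i.+1 (n - i)] ++
  [seq eps n i + eps n j | i <- iota 1 n, j <- iota i.+1 (n - i)].

Definition simple_mx (n : nat) : 'M[rat]_n := \matrix_(i < n) simple_root i.

(* The basis dual to the simple roots, see [pairing_fund_weight]. *)
Definition fund_weight (n : nat) (i : 'I_n) : 'rV[rat]_n :=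
  row i (invmx (simple_mx n))^T.

(* The coordinate m_i of a root in the basis of simple roots, see
   [positive_rootE]. *)
Definition root_coef (n : nat) (a : 'rV[rat]_n) (i : 'I_n) : nat :=
  Num.truncn ((a *m invmx (simple_mx n)) 0 i).

Section RootTheory.
Variable n : nat.
Hypothesis n_gt1 : (1 < n)%N.

Let omat_entry (a b : nat) : rat :=
  if (a < n.-1)%N then (b <= a)%:R
  else if a == n.-1 then (if b == n then - 2^-1 else 2^-1) else 2^-1.

Let omat : 'M[rat]_n := \matrix_(i, j) omat_entry i.+1 j.+1.

Let half2 : 2^-1 + 2^-1 = 1 :> rat. Proof. by apply/eqP. Qed.

Let sum_eps (F : nat -> rat) a : (0 < a <= n)%N ->
  \sum_(j < n) F j.+1 * eps n a 0 j = F a.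
Proof.
case: a => // a /andP[_ lt_an]; rewrite (bigD1 (Ordinal lt_an)) //= mxE eqxx mulr1.
rewrite big1 ?addr0 // => j ne; rewrite mxE eqSS.
by move: ne; rewrite -val_eqE /= => /negPf->; rewrite mulr0.
Qed.

Let omat_simple : omat *m (simple_mx n)^T = 1%:M.
Proof.
apply/matrixP=> i j; rewrite !mxE.
under eq_bigr => t _ do rewrite !mxE.
have ltin := ltn_ord i; have ltjn := ltn_ord j.
rewrite /simple_root; case: ltnP => hj.
  under eq_bigr => t _ do rewrite mxE [X in _ + X]mxE mulrBr.
  rewrite sumrB !sum_eps; [|lia..].
  rewrite /omat_entry -val_eqE /=.
  case: ltnP => hi.
    by case: (eqVneq (i : nat) j) => eij; case: leqP => h1; case: leqP => h2;
      rewrite ?subrr ?subr0 //; exfalso; lia.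
  have [ej|ej] := eqVneq j.+1 n; first by exfalso; lia.
  have [ei|ei] := eqVneq i.+1 n.-1; have [ej'|ej'] := eqVneq j.+2 n;
    have [e|e] := eqVneq (i : nat) j;
    rewrite ?subrr ?opprK ?half2 //; exfalso; lia.
under eq_bigr => t _ do rewrite mxE mulrDr.
rewrite big_split /= !sum_eps; [|lia..].
rewrite /omat_entry -val_eqE /=.
case: ltnP => hi.
  have -> : (n <= i.+1)%N = false by lia.
  case: (eqVneq (i : nat) j) => eij; rewrite ?addr0 //; exfalso; lia.
rewrite eqxx; have [en|en] := eqVneq n.-1 n; first by exfalso; lia.
by have [ei|ei] := eqVneq i.+1 n.-1; have [e|e] := eqVneq (i : nat) j;
  rewrite ?subrr ?half2 //; exfalso; lia.
Qed.

Let invmx_simple : invmx (simple_mx n) = omat^T.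
Proof.
have e : simple_mx n *m omat^T = 1%:M.
  by apply: trmx_inj; rewrite trmx_mul trmxK trmx1.
have [u _] := mulmx1_unit e.
by rewrite -[LHS]mulmx1 -e mulmxA mulVmx // mul1mx.
Qed.

Lemma simple_mx_unit : simple_mx n \in unitmx.
Proof.
by have [] := @mulmx1_unit _ _ (omat) ((simple_mx n)^T) omat_simple;
  rewrite unitmx_tr.
Qed.

Lemma pairing_fund_weight (i j : 'I_n) :
  pairing (fund_weight i) (simple_root j) = (i == j)%:R.
Proof.
have /matrixP/(_ j i) := mulmxV simple_mx_unit.
rewrite !mxE eq_sym => <-; apply: eq_bigr => t _.
by rewrite !mxE mulrC.
Qed.

Lemma positive_rootE (a : 'rV[rat]_n) : a \in positive_roots n ->
  a = \sum_i (root_coef a i)%:R *: simple_root i.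
Proof.
move=> ha; have -> : \sum_i (root_coef a i)%:R *: simple_root i
    = (a *m invmx (simple_mx n)) *m simple_mx n; last first.
  by rewrite mulmxKV // simple_mx_unit.
rewrite [RHS]mulmx_sum_row; apply: eq_bigr => i _; rewrite rowK; congr (_ *: _).
rewrite /root_coef truncnK // invmx_simple mxE.
under eq_bigr => t _ do rewrite mxE [omat i t]mxE mulrC.
have in1 := ltn_ord i.
move: ha; rewrite mem_cat => /orP[] /allpairsPdep[x [y [hx hy ->]]];
  move: hx hy; rewrite !mem_iota => hx hy.
- under eq_bigr => t _ do rewrite mxE [X in _ + X]mxE mulrBr.
  rewrite sumrB !sum_eps; [|lia..]; rewrite /omat_entry.
  case: ifP => _.
    case: (leqP y i.+1) => h1; last by rewrite subr0 natr_nat.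
    by rewrite (_ : (x <= i.+1)%N) ?subrr //; lia.
  rewrite (_ : (x == n) = false); last by lia.
  case: ifP => _; last by rewrite subrr.
  by case: ifP => _; rewrite ?subrr // opprK half2.
- under eq_bigr => t _ do rewrite mxE mulrDr.
  rewrite big_split /= !sum_eps; [|lia..]; rewrite /omat_entry.
  case: ifP => _; first by rewrite -natrD natr_nat.
  rewrite (_ : (x == n) = false); last by lia.
  by do 2?[case: ifP => _]; rewrite ?subrr // half2.
Qed.

End RootTheory.

Definition arrow (n : nat) (i j : 'I_n) : bool :=
  ((i.+1 <= n - 2)%N && (j.+1 == i.+2)) || ((i.+1 == n - 2)%N && (j.+1 == n)).

Definition minuscule (n : nat) (k : 'I_n) : bool :=
  k.+1 \in [:: 1; n.-1; n]%N.

Definition delta (n : nat) (k : 'I_n) : 'I_n -> nat := fun j => (j == k)%N.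

(* Points of T^*Rep_Q(v, w), with V_i = C^(v i) and W_i = C^(w i) as spaces of
   column vectors. [rX i j : V_i -> V_j] and [rY i j : V_j -> V_i] are used only
   when there is an arrow i -> j; the other components are irrelevant. *)

Record framed_rep (C : fieldType) (n : nat) (v w : 'I_n -> nat) := FramedRep {
  rX : forall i j : 'I_n, 'M[C]_(v j, v i);
  rY : forall i j : 'I_n, 'M[C]_(v i, v j);
  rA : forall i : 'I_n, 'M[C]_(v i, w i);
  rB : forall i : 'I_n, 'M[C]_(w i, v i) }.

Definition moment_map (C : fieldType) (n : nat) (v w : 'I_n -> nat)
    (p : framed_rep C v w) (i : 'I_n) : 'M[C]_(v i) :=
  \sum_(j | arrow j i) rX p j i *m rY p j i
  - \sum_(j | arrow i j) rY p i j *m rX p i j + rA p i *m rB p i.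

Definition stable (C : fieldType) (n : nat) (v w : 'I_n -> nat)
    (p : framed_rep C v w) : Prop :=
  forall S : (forall i : 'I_n, {vspace 'cV[C]_(v i)}),
    (forall i (u : 'cV[C]_(w i)), rA p i *m u \in S i) ->
    (forall i j, arrow i j ->
       (forall u, u \in S i -> rX p i j *m u \in S j) /\
       (forall u, u \in S j -> rY p i j *m u \in S i)) ->
    forall i, S i = fullv.

(* M(v, w) is the set of orbits of G_v on the stable points of the zero fiber of
   the moment map. *)
Definition quiver_variety_nonempty (C : fieldType) (n : nat)
    (v w : 'I_n -> nat) : Prop :=
  exists p : framed_rep C v w, (forall i, moment_map p i = 0) /\ stable p.

(* The element d_(i,j) is the pair (i, j); the color is the label in 1..n of a
   vertex, and [wexp] is the exponent of hbar in the weight. *)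

Definition cell (n : nat) : finType := ('I_n.+1 * 'I_n.+1)%type.

Record cwposet (n : nat) := CWPoset {
  elems : {set cell n};
  gens : rel (cell n);
  color : cell n -> nat;
  wexp : cell n -> nat }.

Definition spin_elem (n i j : nat) : bool :=
  [|| [&& 1 <= i <= n - 2 & 1 <= j <= i],
      (i == n - 1) && (1 <= j <= (n - 1)./2) |
      (i == n) && (1 <= j <= n./2)]%N.

(* Whether d_(i,j) <= d_(i',j') is a generating relation; relations involving a
   pair that is not an element are discarded in [poset_le]. *)
Definition spin_gen (n i j i' j' : nat) : bool :=
  [|| [&& 1 <= i' <= n - 3, i == i'.+1 & j == j'],
      [&& 1 <= i <= n - 3, i' == i.+1 & j' == j.+1],
      [&& i == n - 2, i' == n - 1 & j == (2 * j' - 1)],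
      [&& i == n - 1, i' == n - 2 & j' == (2 * j)],
      [&& i == n - 2, i' == n & j == (2 * j' - 2)] |
      [&& i == n, i' == n - 2 & j' == (2 * j - 1)]]%N.

Definition spin_wexp (n i j : nat) : nat :=
  if (i <= n - 2)%N then (n - i + j - 2)%N
  else if (i == n - 1)%N then (2 * j - 1)%N else (2 * j - 2)%N.

Definition spin_poset (n : nat) : cwposet n :=
  {| elems := [set x : cell n | spin_elem n x.1 x.2];
     gens := fun x y => spin_gen n x.1 x.2 y.1 y.2;
     color := fun x => x.1;
     wexp := fun x => spin_wexp n x.1 x.2 |}.

Definition swap_color (n c : nat) : nat :=
  if (c == n - 1)%N then n else if c == n then (n - 1)%N else c.

Definition spin_poset' (n : nat) : cwposet n :=
  {| elems := elems (spin_poset n);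
     gens := gens (spin_poset n);
     color := fun x => swap_color n (color (spin_poset n) x);
     wexp := wexp (spin_poset n) |}.

Definition vector_elem (n i j : nat) : bool :=
  ((1 <= i <= n - 2) && (1 <= j <= 2) || (n - 1 <= i <= n) && (j == 1))%N.

Definition vector_gen (n i j i' j' : nat) : bool :=
  [|| [&& 1 <= i <= n - 2, i' == i.+1, j == 1 & j' == 1],
      [&& 1 <= i' <= n - 3, i == i'.+1, j == 2 & j' == 2],
      [&& i == n - 2, j == 1, i' == n & j' == 1],
      [&& i == n, j == 1, i' == n - 2 & j' == 2] |
      [&& i == n - 1, j == 1, i' == n - 2 & j' == 2]]%N.

Definition vector_wexp (n i j : nat) : nat := if j == 1%N then 0%N else (n - i - 1)%N.

Definition vector_poset (n : nat) : cwposet n :=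
  {| elems := [set x : cell n | vector_elem n x.1 x.2];
     gens := fun x y => vector_gen n x.1 x.2 y.1 y.2;
     color := fun x => x.1;
     wexp := fun x => vector_wexp n x.1 x.2 |}.

Definition minuscule_poset (n : nat) (k : 'I_n) : cwposet n :=
  if k.+1 == 1%N then vector_poset n
  else if k.+1 == n then spin_poset n else spin_poset' n.

Definition poset_le (n : nat) (D : cwposet n) : rel (cell n) :=
  connect (fun x y => [&& x \in elems D, y \in elems D & gens D x y]).

Definition order_ideal (n : nat) (D : cwposet n) (P : {set cell n}) : bool :=
  (P \subset elems D) &&
  [forall x, forall y, (y \in P) && poset_le D x y ==> (x \in P)].

Definition has_dim (n : nat) (D : cwposet n) (v : 'I_n -> nat)
    (P : {set cell n}) : bool :=
  [forall i : 'I_n, #|[set x in P | color D x == i.+1]| == v i].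

(* The order ideal attached to v; the junk value [set0] can only occur when the
   quiver variety is empty. *)
Definition ideal_of (n : nat) (k : 'I_n) (v : 'I_n -> nat) : {set cell n} :=
  odflt set0
    [pick P : {set cell n} | order_ideal (minuscule_poset k) P &&
                             has_dim (minuscule_poset k) v P].

(* For d < 0 a vanishing factor contributes 0^-1 = 0. This does not affect the
   vertex function, where neither a pole nor a zero denominator occurs. *)
Definition qpoch (x : Qqh) (d : int) : Qqh :=
  match d with
  | Posz m => \prod_(0 <= i < m) (1 - x * qv ^+ i)
  | Negz m => \prod_(1 <= i < m.+2) (1 - x * qv ^- i)^-1
  end.

(* The framing is delta_k throughout. *)
Section Vertex.
Variables (n : nat) (k : 'I_n) (v : 'I_n -> nat).

Local Notation D := (minuscule_poset k).
Local Notation P := (ideal_of k v).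
Local Notation elt := {x : cell n | x \in P}.

Definition b_coef (j : 'I_n) : int :=
  \sum_(i | arrow i j) (v i)%:Z - \sum_(i | arrow j i) (v i)%:Z
  + (delta k j)%:Z.

Definition is_rpp (pi : elt -> nat) : bool :=
  [forall x : elt, forall y : elt,
     poset_le D (val x) (val y) ==> (pi x <= pi y)%N].

Definition rpp_deg (pi : elt -> nat) : 'X_{1..n} :=
  [multinom (\sum_(x : elt | color D (val x) == i.+1) pi x)%N | i < n].

Definition rpp_N (pi : elt -> nat) : int :=
  \sum_j b_coef j * (rpp_deg pi j)%:Z.

Definition wt (x : elt) : Qqh := hv ^+ wexp D (val x).

Definition rpp_weight (pi : elt -> nat) : Qqh :=
  (qv / hv) ^ rpp_N pi
  * (\prod_(x : elt | color D (val x) == k.+1)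
       (qpoch (hv * wt x) (pi x) / qpoch (qv * wt x) (pi x)))
  * (\prod_(e : 'I_n * 'I_n | arrow e.1 e.2)
     \prod_(x : elt | color D (val x) == e.1.+1)
     \prod_(y : elt | color D (val y) == e.2.+1)
       (qpoch (hv * (wt y / wt x)) ((pi y)%:Z - (pi x)%:Z)
        / qpoch (qv * (wt y / wt x)) ((pi y)%:Z - (pi x)%:Z)))
  * (\prod_(i : 'I_n)
     \prod_(x : elt | color D (val x) == i.+1)
     \prod_(y : elt | color D (val y) == i.+1)
       (qpoch (qv * (wt y / wt x)) ((pi y)%:Z - (pi x)%:Z)
        / qpoch (hv * (wt y / wt x)) ((pi y)%:Z - (pi x)%:Z))).

(* The coefficient at z^d; a reverse plane partition of degree d takes values
   at most |d|. *)
Definition vertex : fps n Qqh := fun d =>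
  \sum_(pi : {ffun elt -> 'I_(mdeg d).+1}
        | is_rpp (fun x => pi x) && (rpp_deg (fun x => pi x) == d))
    rpp_weight (fun x => pi x).

Definition a_coef (i : 'I_n) : int := (v i)%:Z - \sum_(j | arrow i j) (v j)%:Z.

Definition exp_root (a : 'rV[rat]_n) : fps n Qqh :=
  \prod_i (fpsC ((qv / hv) ^ a_coef i) * fpsX Qqh i) ^+ root_coef a i.

End Vertex.

(* Main.v *)
(** The vertex function is computed by adding the vertices of the quiver one at a
    time. Let v be a dimension vector with (mu_v, alpha_i) = 1, so that
    v + delta_i belongs to the reflected weight s_i mu_v = mu_v - alpha_i. The sum
    over the v_i + 1 integers sitting at the vertex i of v + delta_i and the sum
    over the v_i integers sitting at the vertex i of v, with all the other
    integers fixed, are the two sides of a duality between the multiple basic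
    hypergeometric sums attached to 1 + m and to m variables (the Kajihara
    transformation, here obtained by comparing a polynomial with its zeros). It
    yields a recursion expressing the vertex function of v + delta_i through that
    of v. The product side satisfies the same recursion, because s_i permutes the
    positive roots other than alpha_i, and F(z) = sum_d (hbar)_d / (q)_d z^d.
    Every v with a nonempty quiver variety is reached from 0 by such steps: the
    dimension of the quiver variety is nonnegative, which gives
    (mu_v, mu_v) <= (omega_k, omega_k) and hence, omega_k being minuscule, a very
    rigid shape of v. *)

Require Import Defs.
From HB Require Import structures.
From mathcomp Require Import all_boot all_order all_algebra all_fingroup.
From mathcomp Require Import reals complex mpoly.
From mathcomp Require Import boolp ring zify.

Set Implicit Arguments.
Unset Strict Implicit.
Unset Printing Implicit Defensive.

Import Order.TTheory GRing.Theory Num.Theory.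
Local Open Scope ring_scope.

(** * A duality of multiple basic hypergeometric sums *)

Section Duality.
Variables (L : fieldType) (q h : L).

(** The duality is proved with an extra parameter X scaling all the variables [u]. The
    self-interaction [wtT] is homogeneous of degree 0, so X enters only through [wtX]. After
    clearing denominators both sides are polynomials in X, and at each zero of the common
    denominator their difference is an instance of the duality with smaller [l] and shifted
    variables. So the difference is a constant e times the denominator, and the leading coefficients
    give e = r^(ml) e with r = h / q. This forces e = 0, and with it a closed formula for [Tsum].
    The argument needs simple, distinct poles, whereas variables of the form hbar^s q^t may produce
    coinciding ones; the identity is therefore proved for a one-parameter deformation and then
    specialized. The weight of a labelling vanishes as soon as an order relation fails, so the sum
    at one vertex may run over all compositions, as the duality requires. Since the recursion
    changes both v and the degree in z, all sums are taken in a box [M], [N] that is fixed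
    beforehand and large enough. *)

Definition poch (x : L) (g : nat) : L := \prod_(i < g) (1 - x * q ^+ i).
Definition pochq (x : L) (g : nat) : L := poch (h * x) g / poch (q * x) g.

Lemma pochD x g g' : poch x (g + g') = poch x g * poch (x * q ^+ g) g'.
Proof.
rewrite /poch big_split_ord /=; congr (_ * _).
by apply: eq_bigr => i _; rewrite exprD mulrA.
Qed.

Lemma pochqD x g g' : pochq x (g + g') = pochq x g * pochq (x * q ^+ g) g'.
Proof. by rewrite /pochq !pochD -mulf_div !mulrA. Qed.

Lemma pochq0 x : pochq x 0 = 1.
Proof. by rewrite /pochq /poch !big_ord0 divr1. Qed.

Lemma poch_neq0 x g : (forall j, (j < g)%N -> q ^+ j.+1 * x != 1) -> poch (q * x) g != 0.
Proof.
move=> hx; apply/prodf_neq0 => i _; rewrite subr_eq0 eq_sym.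
by rewrite mulrAC -exprS; apply: hx.
Qed.

(* The numerator of [pochq x g] over the common denominator [poch (q * x) l]. *)
Definition pnum (x : L) (g l : nat) : L :=
  poch (h * x) g * \prod_(g <= j < l) (1 - q ^+ j.+1 * x).

Lemma poch_split x g l : (g <= l)%N ->
  poch (q * x) l = poch (q * x) g * \prod_(g <= j < l) (1 - q ^+ j.+1 * x).
Proof.
move=> le_gl; have E k : poch (q * x) k = \prod_(0 <= j < k) (1 - q ^+ j.+1 * x).
  rewrite /poch big_mkord; apply: eq_bigr => i _.
  by rewrite exprS mulrAC.
by rewrite !E; apply: big_cat_nat.
Qed.

Lemma pnumE x g l : (g <= l)%N -> poch (q * x) l != 0 ->
  pnum x g l = pochq x g * poch (q * x) l.
Proof.
move=> le_gl; rewrite /pnum /pochq (poch_split _ le_gl) mulf_eq0 negb_or => /andP[nz _].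
by rewrite mulrA divfK.
Qed.

(** For g < k the factor 1 - q^k x is still among the uncancelled denominators. At q^k x = 1 the
    cleared sums therefore keep only the terms with index at least k. *)
Lemma pnum_eq0 x g l k : (g < k <= l)%N -> q ^+ k * x = 1 -> pnum x g l = 0.
Proof.
case: k => // k /andP[lt_gk lt_kl] e; rewrite /pnum.
by rewrite (@big_cat_nat _ _ _ k) ?(ltnW lt_kl) //= (big_ltn lt_kl) e subrr mul0r !mulr0.
Qed.

Hypothesis q0 : q != 0.
Hypothesis h0 : h != 0.
Hypothesis q_free : forall k, q ^+ k.+1 != 1.

Lemma poch_q_neq0 i g : poch (q * q ^+ i) g != 0.
Proof. by apply: poch_neq0 => j _; rewrite -exprD addSn. Qed.

Lemma poch1_neq0 g : poch (q * 1) g != 0.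
Proof. by rewrite -(expr0 q) poch_q_neq0. Qed.

(** The vanishing denominator has been cancelled, and since h x q^k = h, the numerator factors
    beyond the k-th restart at argument 1. *)
Lemma pnum_pole x g l k : q ^+ k * x = 1 -> (k + g <= l)%N ->
  pnum x (k + g) l = poch (h * x) k * poch (q * 1) (l - k) * pochq 1 g.
Proof.
move=> e le; rewrite /pnum pochD -mulrA.
have -> : h * x * q ^+ k = h * 1 by rewrite -e; ring.
rewrite /pochq -!mulrA; congr (_ * _); rewrite mulrCA; congr (_ * _).
have le' : (g <= l - k)%N by lia.
rewrite (poch_split 1 le') mulrAC divff ?poch1_neq0 // mul1r.
rewrite [in LHS]addnC big_addn.
apply: eq_big_nat => i /andP[hi _].
rewrite -addSn exprD -mulrA e //.
Qed.

Section Sums.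
Variable N : nat.

(** The variables interact through their displaced positions q^(g a) u_a; the diagonal factors are
    (h)_g / (q)_g. *)
Definition wtT (n : nat) (u : 'I_n -> L) (g : 'I_n -> nat) : L :=
  \prod_a \prod_a' pochq (q ^+ g a * u a / (q ^+ g a' * u a')) (g a').

Definition wtX (n m : nat) (u : 'I_n -> L) (w : 'I_m -> L) (g : 'I_n -> nat) : L :=
  \prod_a \prod_b pochq (u a * w b) (g a).

(** The bound [N] only makes the index type finite: each part is at most [l], so every N > l gives
    the same sum. *)
Definition Ssum (n m : nat) (u : 'I_n -> L) (w : 'I_m -> L) (l : nat) : L :=
  \sum_(g : {ffun 'I_n -> 'I_N} | (\sum_a (g a : nat) == l)%N)
     wtT u (fun a => g a) * wtX u w (fun a => g a).

Definition shift (n : nat) (u : 'I_n -> L) (a0 : 'I_n) (k : nat) : 'I_n -> L :=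
  fun a => if a == a0 then q ^+ k * u a else u a.

Section Residue.
Variables (n m : nat) (u : 'I_n -> L) (w : 'I_m -> L) (a0 : 'I_n) (b0 : 'I_m) (k l : nat).
Hypothesis u0 : forall a, u a != 0.
Hypothesis pole : q ^+ k * (u a0 * w b0) = 1.
Hypothesis no_other : forall a b j, (a, b) != (a0, b0) -> q ^+ j.+1 * (u a * w b) != 1.

(** The factor common to all terms at the pole q^k u_a0 w_b0 = 1. It is symmetric in the two
    families ([resC_sym]), so the two sides of the duality acquire the same one. *)
Definition resC : L :=
  poch (h * (u a0 * w b0)) k * poch (q * 1) (l - k) * pochq 1 k *
  (\prod_(b | b != b0) (pochq (u a0 * w b) k * poch (q * (u a0 * w b)) l)) *
  (\prod_(a | a != a0) (pochq (u a * w b0) k * poch (q * (u a * w b0)) l)) *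
  \prod_(a | a != a0) \prod_(b | b != b0) poch (q * (u a * w b)) l.

Let u' := shift u a0 k.
Let w' := shift w b0 k.

(** At the pole both [u a0] and [w b0] get multiplied by q^k, and what remains is a term of the same
    kind of sum, with total lowered by k. The bound on the total keeps every symbol inside the
    common denominator of length [l]. *)
Lemma residue_term (g : 'I_n -> nat) : (\sum_a g a + k <= l)%N ->
  wtT u (fun a => g a + (a == a0) * k)%N *
    \prod_a \prod_b pnum (u a * w b) (g a + (a == a0) * k) l
  = resC * (wtT u' g * wtX u' w' g).
Proof.
move=> le_l.
have le_a a : (g a + k <= l)%N.
  apply: leq_trans le_l; rewrite leq_add2r (bigD1 a) //= leq_addr //.
rewrite /wtT /wtX; set g1 := fun a => (g a + (a == a0) * k)%N.
pose t a a' := pochq (q ^+ g1 a * u a / (q ^+ g1 a' * u a')) (g1 a').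
pose t' a a' := pochq (q ^+ g a * u' a / (q ^+ g a' * u' a')) (g a').
pose f a b := pnum (u a * w b) (g1 a) l.
pose f' a b := pochq (u' a * w' b) (g a).
pose D a b := poch (q * (u a * w b)) l.
have g10 : g1 a0 = (k + g a0)%N by rewrite /g1 eqxx mul1n addnC.
have g1a a : a != a0 -> g1 a = g a by move=> /negPf e; rewrite /g1 e mul0n addn0.
have u'0 : u' a0 = q ^+ k * u a0 by rewrite /u' /shift eqxx.
have u'a a : a != a0 -> u' a = u a by rewrite /u' /shift => /negPf->.
have w'0 : w' b0 = q ^+ k * w b0 by rewrite /w' /shift eqxx.
have w'b b : b != b0 -> w' b = w b by rewrite /w' /shift => /negPf->.
have wE : w b0 = (q ^+ k * u a0)^-1.
  apply: (mulfI (u0 a0)); rewrite invfM mulrCA divff // mulr1.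
  by apply: (@mulfI _ (q ^+ k)); rewrite ?expf_neq0 // pole divff ?expf_neq0.
have Xeq a : q ^+ g1 a * u a = q ^+ g a * u' a.
  case: (eqVneq a a0) => [->|ne]; last by rewrite g1a ?u'a.
  by rewrite g10 u'0 addnC exprD mulrA.
have g1le a : (g1 a <= l)%N.
  case: (eqVneq a a0) => [->|ne]; rewrite ?g10 ?g1a //; have := le_a a; have := le_a a0; lia.
have Dnz a b : (a, b) != (a0, b0) -> D a b != 0.
  by move=> ne; apply: poch_neq0 => j _; apply: no_other.
have tt a a' : a' != a0 -> t a a' = t' a a'.
  by move=> ne; rewrite /t /t' !Xeq g1a.
(* The pole factor becomes the diagonal self-interaction of the shifted problem, while the diagonal
   self-interaction becomes the interaction of [a0] with [b0]. *)
have t00 : t a0 a0 * f a0 b0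
    = poch (h * (u a0 * w b0)) k * poch (q * 1) (l - k) * pochq 1 k * (t' a0 a0 * f' a0 b0).
  rewrite /t /t' /f /f' !Xeq g10 divff; last by rewrite mulf_neq0 ?expf_neq0 ?u'0 ?mulf_neq0 ?expf_neq0.
  rewrite pnum_pole //; last by have := le_a a0; lia.
  have -> : u' a0 * w' b0 = 1 * q ^+ k by rewrite u'0 w'0 -pole; ring.
  by rewrite pochqD; ring.
have f0b b : b != b0 -> f a0 b = pochq (u a0 * w b) k * D a0 b * f' a0 b.
  move=> ne; have Dn : D a0 b != 0 by apply: Dnz; rewrite xpair_eqE (negPf ne) andbF.
  rewrite /f /f' pnumE // -/(D a0 b) g10 pochqD u'0 w'b //.
  have -> : q ^+ k * u a0 * w b = u a0 * w b * q ^+ k by ring.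
  by ring.
(* Since w_b0 = 1 / (q^k u_a0), the interaction of [a] with [b0] is a symbol in u_a / u_a0 and
   combines with the self-interaction of [a] and [a0]: a symbol of length g_a + k is split in both
   orders. *)
have ta0 a : a != a0 ->
    t a a0 * f a b0 = pochq (u a * w b0) k * D a b0 * (t' a a0 * f' a b0).
  move=> ne; have Dn : D a b0 != 0 by apply: Dnz; rewrite xpair_eqE (negPf ne).
  rewrite /t /t' /f /f' !Xeq pnumE // -/(D a b0) u'a // u'0 w'0 g10 g1a // wE.
  set y := u a / u a0.
  have qk0 i : q ^+ i != 0 by rewrite expf_neq0.
  have -> : u a * (q ^+ k / (q ^+ k * u a0)) = y by rewrite /y; field; rewrite qk0 u0.
  have -> : u a / (q ^+ k * u a0) = y / q ^+ k by rewrite /y; field; rewrite qk0 u0.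
  rewrite [(k + g a0)%N]addnC pochqD.
  set z := q ^+ g a * u a / _.
  have -> : z * q ^+ g a0 = y / q ^+ k * q ^+ g a.
    by rewrite /z /y; field; rewrite !qk0 u0.
  have E1 : pochq (y / q ^+ k) (g a) * pochq (y / q ^+ k * q ^+ g a) k
          = pochq (y / q ^+ k) k * pochq y (g a).
    by rewrite -pochqD addnC pochqD divfK.
  set A := pochq (y / _) (g a) in E1 *; set B := pochq (y / q ^+ k * _) k in E1 *.
  set A' := pochq (y / _) k in E1 *; set B' := pochq y (g a) in E1 *.
  by transitivity (pochq z (g a0) * D a b0 * (A * B)); [|rewrite E1]; ring.
have fab a b : a != a0 -> b != b0 -> f a b = D a b * f' a b.
  move=> na nb; have Dn : D a b != 0 by apply: Dnz; rewrite xpair_eqE (negPf na).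
  by rewrite /f /f' pnumE // -/(D a b) u'a // w'b // g1a // mulrC.
have splitT F : \prod_a \prod_a' F a a' = F a0 a0 * (\prod_(a' | a' != a0) F a0 a')
    * (\prod_(a | a != a0) F a a0) * \prod_(a | a != a0) \prod_(a' | a' != a0) F a a' :> L.
  rewrite (bigD1 a0) //= [X in X * _](bigD1 a0) //= -[RHS]mulrA; congr (_ * _).
  by rewrite -big_split /=; apply: eq_bigr => a _; rewrite [LHS](bigD1 a0).
have splitF F : \prod_a \prod_b F a b = F a0 b0 * (\prod_(b | b != b0) F a0 b)
    * (\prod_(a | a != a0) F a b0) * \prod_(a | a != a0) \prod_(b | b != b0) F a b :> L.
  rewrite (bigD1 a0) //= [X in X * _](bigD1 b0) //= -[RHS]mulrA; congr (_ * _).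
  by rewrite -big_split /=; apply: eq_bigr => a _; rewrite [LHS](bigD1 b0).
rewrite -/(\prod_a \prod_a' t a a') -/(\prod_a \prod_b f a b).
rewrite -/(\prod_a \prod_a' t' a a') -/(\prod_a \prod_b f' a b).
rewrite !splitT !splitF /resC -/(\prod_(a | a != a0) \prod_(b | b != b0) D a b).
have -> : \prod_(b | b != b0) f a0 b = \prod_(b | b != b0) (pochq (u a0 * w b) k * D a0 b) *
    \prod_(b | b != b0) f' a0 b.
  by rewrite -big_split /=; apply: eq_bigr => b /f0b.
rewrite (eq_bigr _ (tt a0)).
have -> : \prod_(a | a != a0) \prod_(a' | a' != a0) t a a'
        = \prod_(a | a != a0) \prod_(a' | a' != a0) t' a a'.
  by apply: eq_bigr => a _; apply: eq_bigr => a' /tt.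
have -> : \prod_(a | a != a0) \prod_(b | b != b0) f a b
  = (\prod_(a | a != a0) \prod_(b | b != b0) D a b) *
    \prod_(a | a != a0) \prod_(b | b != b0) f' a b.
  rewrite -big_split /=; apply: eq_bigr => a na; rewrite -big_split /=.
  by apply: eq_bigr => b nb; rewrite fab.
have E2 : (\prod_(a | a != a0) t a a0) * (\prod_(a | a != a0) f a b0)
  = (\prod_(a | a != a0) (pochq (u a * w b0) k * D a b0)) *
    ((\prod_(a | a != a0) t' a a0) * (\prod_(a | a != a0) f' a b0)).
  by rewrite -!big_split /=; apply: eq_bigr => a /ta0.
rewrite -/(\prod_(b | b != b0) D a0 b).
move: t00 E2; rewrite -/(\prod_(a | a != a0) D a b0).
move: (t a0 a0) (f a0 b0) (t' a0 a0) (f' a0 b0) => x1 x2 x3 x4.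
move: (\prod_(a | a != a0) t a a0) (\prod_(a | a != a0) f a b0) => x5 x6.
move: (\prod_(a | a != a0) t' a a0) (\prod_(a | a != a0) f' a b0) => x7 x8 t00 E2.
move: (\prod_(a' | a' != a0) t' a0 a') (\prod_(b | b != b0) f' a0 b) => y1 y2.
move: (\prod_(a | a != a0) \prod_(a' | a' != a0) t' a a') => y3.
move: (\prod_(a | a != a0) \prod_(b | b != b0) f' a b) => y4.
move: (\prod_(a | a != a0) \prod_(b | b != b0) D a b) => y5.
move: t00 E2; set z1 := poch (h * _) k; set z2 := poch _ (l - k); set z3 := pochq 1 k.
set z4 := \prod_(a | a != a0) _; set z6 := \prod_(b | b != b0) _ => t00 E2.
transitivity (x1 * x2 * (x5 * x6) * (y1 * y3 * (z6 * y2) * (y5 * y4))); first by ring.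
rewrite t00 E2; ring.
Qed.

Lemma wtT_ext (u1 : 'I_n -> L) g g' : g =1 g' -> wtT u1 g = wtT u1 g'.
Proof. by move=> e; apply: eq_bigr => a _; apply: eq_bigr => a' _; rewrite !e. Qed.

Lemma residue_sum p : (p < N)%N -> (p <= l)%N -> (0 < k <= l)%N ->
  \sum_(g : {ffun 'I_n -> 'I_N} | (\sum_a (g a : nat) == p)%N)
     wtT u (fun a => g a) * \prod_a \prod_b pnum (u a * w b) (g a) l
  = if (k <= p)%N then resC * Ssum u' w' (p - k) else 0.
Proof.
move=> lt_pN le_pl /andP[k_gt0 le_kl].
have vanish (g : {ffun 'I_n -> 'I_N}) : (g a0 < k)%N ->
    wtT u (fun a => g a) * \prod_a \prod_b pnum (u a * w b) (g a) l = 0.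
  move=> h1; rewrite [X in _ * X](bigD1 a0) //= (bigD1 b0) //= (@pnum_eq0 _ _ _ k) ?h1 //.
  by rewrite !mul0r mulr0.
have g_le (g : {ffun 'I_n -> 'I_N}) s : (\sum_a (g a : nat) == s)%N -> forall a, (g a <= s)%N.
  by move=> /eqP <- a; rewrite (bigD1 a) //= leq_addr.
case: leqP => [le_kp|lt_pk]; last first.
  rewrite big1 // => g hg; apply: vanish.
  exact: leq_ltn_trans (g_le _ _ hg a0) lt_pk.
(* The default of [insubd] is taken only where the shifted index would leave the range; such [g] are
   excluded by the total or by the round-trip condition of [reindex_onto]. *)
pose up (g : {ffun 'I_n -> 'I_N}) : {ffun 'I_n -> 'I_N} :=
  [ffun a => insubd (g a) (g a + (a == a0) * k)%N].
pose dn (g : {ffun 'I_n -> 'I_N}) : {ffun 'I_n -> 'I_N} :=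
  [ffun a => insubd (g a) (g a - (a == a0) * k)%N].
have dnE g a : dn g a = (g a - (a == a0) * k)%N :> nat.
  rewrite ffunE val_insubd; case: ifP => // /negbT/negP[].
  exact: leq_ltn_trans (leq_subr _ _) (ltn_ord (g a)).
have upE (g : {ffun 'I_n -> 'I_N}) a : (g a0 + k < N)%N -> up g a = (g a + (a == a0) * k)%N :> nat.
  move=> lt; rewrite ffunE val_insubd; case: ifP => // /negbT/negP[].
  by case: eqP => [->|_]; rewrite ?mul1n // addn0.
have upsum (g : {ffun 'I_n -> 'I_N}) : (g a0 + k < N)%N ->
    (\sum_a (up g a : nat) = \sum_a (g a : nat) + k)%N.
  move=> lt; under eq_bigr => a _ do rewrite upE //.
  rewrite big_split /= (bigD1 a0) //= [X in (_ + X)%N](bigD1 a0) //= eqxx mul1n.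
  by rewrite [X in (k + X)%N]big1 ?addn0 // => a /negPf->.
rewrite (bigID (fun g : {ffun 'I_n -> 'I_N} => (k <= g a0)%N)) /=.
rewrite [X in _ + X]big1 ?addr0; last by move=> g /andP[_]; rewrite -ltnNge => /vanish.
rewrite (reindex_onto up dn) /=; last first.
  move=> g /andP[_ le_k]; apply/ffunP=> a; apply: val_inj.
  have le0 : (dn g a0 + k < N)%N by rewrite dnE eqxx mul1n subnK.
  rewrite /= upE // dnE; case: eqP => [->|_]; last by rewrite subn0 addn0.
  by rewrite mul1n subnK.
rewrite /Ssum mulr_sumr; apply: eq_big => [g|g].
  apply/idP/idP => [/andP[/andP[/eqP sp le_k] /eqP dup]|/eqP sp].
    case: (ltnP (g a0 + k) N) => [lt|ge].
      by rewrite -sp upsum // addnK.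
    have := congr1 (fun f : {ffun 'I_n -> 'I_N} => f a0 : nat) dup.
    have e : up g a0 = g a0.
      by apply: val_inj; rewrite ffunE val_insubd eqxx mul1n ltnNge ge.
    by rewrite dnE e eqxx mul1n; rewrite e in le_k; lia.
  have lt : (g a0 + k < N)%N.
    apply: leq_ltn_trans lt_pN; rewrite -(subnK le_kp) leq_add2r.
    by apply: g_le; rewrite sp.
  rewrite upsum // sp subnK // eqxx upE // eqxx mul1n leq_addl /=.
  apply/eqP/ffunP=> a; apply: val_inj; rewrite /= dnE upE //.
  by rewrite addnK.
move=> /andP[/andP[/eqP sp le_k] /eqP dup].
have lt : (g a0 + k < N)%N.
  rewrite ltnNge; apply/negP => ge.
  have := congr1 (fun f : {ffun 'I_n -> 'I_N} => f a0 : nat) dup.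
  have e : up g a0 = g a0.
    by apply: val_inj; rewrite ffunE val_insubd eqxx mul1n ltnNge ge.
  by rewrite dnE e eqxx mul1n; rewrite e in le_k; lia.
rewrite -residue_term; last by rewrite -upsum // sp.
congr (_ * _); first by apply: wtT_ext => a; rewrite upE.
by apply: eq_bigr => a _; apply: eq_bigr => b _; rewrite upE.
Qed.

End Residue.
Lemma resC_sym n m (u : 'I_n -> L) (w : 'I_m -> L) a0 b0 k l :
  resC u w a0 b0 k l = resC w u b0 a0 k l.
Proof.
rewrite /resC [in LHS]exchange_big /= [w b0 * u a0]mulrC [X in X * _ = _]mulrAC.
congr (_ * _ * _ * _).
- by apply: eq_bigr => a _; rewrite [w b0 * _]mulrC.
- by apply: eq_bigr => b _; rewrite [w b * _]mulrC.
- by apply: eq_bigr => b _; apply: eq_bigr => a _; rewrite [w b * _]mulrC.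
Qed.

Definition r : L := h / q.

(** The coefficient [c] may vanish: the leading terms of the two sides are compared before they are
    known to cancel. *)
Definition top_at (p : {poly L}) (d : nat) (c : L) : Prop := (size p <= d.+1)%N /\ p`_d = c.

Lemma top_at1 : top_at 1 0 1.
Proof. by split; rewrite ?size_poly1 // coef1. Qed.

Lemma top_atM p p' d d' c c' : top_at p d c -> top_at p' d' c' ->
  top_at (p * p') (d + d') (c * c').
Proof.
move=> [sp pc] [sp' pc']; split.
  apply: leq_trans (size_polyMleq _ _) _; move: (size p) (size p') sp sp' => x y; lia.
rewrite coefM (bigD1 (inord d)) //= inordK ?ltnS ?leq_addr // pc addKn pc' big1 ?addr0 //.
move=> i ne; have {}ne : (i : nat) != d.
  by apply: contra ne => /eqP e; apply/eqP/val_inj; rewrite /= inordK // ltnS leq_addr.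
case: (ltngtP i d) ne => // hid _.
  by rewrite [p'`__]nth_default ?mulr0 //; apply: leq_trans sp' _; lia.
by rewrite nth_default ?mul0r //; apply: leq_trans sp _.
Qed.

Lemma top_at_prod (I : Type) (s : seq I) (P : pred I) (p : I -> {poly L}) d c :
  (forall i, P i -> top_at (p i) (d i) (c i)) ->
  top_at (\prod_(i <- s | P i) p i) (\sum_(i <- s | P i) d i) (\prod_(i <- s | P i) c i).
Proof.
move=> hp; elim: s => [|i s IHs]; first by rewrite !big_nil; apply: top_at1.
by rewrite !big_cons; case: ifP => // Pi; apply: top_atM => //; apply: hp.
Qed.

Lemma top_at_lin x : top_at (1 - x *: 'X) 1 (- x).
Proof.
split; last by rewrite coefB coefZ coefX coef1 mulr1 sub0r.
apply: leq_trans (size_polyD _ _) _; rewrite size_polyN geq_max size_poly1 /=.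
exact: leq_trans (size_scale_leq _ _) (eq_leq (size_polyX _)).
Qed.

Lemma top_at_sum (I : Type) (s : seq I) (P : pred I) (p : I -> {poly L}) d c :
  (forall i, P i -> top_at (p i) d (c i)) ->
  top_at (\sum_(i <- s | P i) p i) d (\sum_(i <- s | P i) c i).
Proof.
move=> hp; elim: s => [|i s IHs]; first by rewrite !big_nil; split; rewrite ?size_poly0 // coef0.
rewrite !big_cons; case: ifP => // Pi; have [s1 <-] := hp i Pi; have [s2 <-] := IHs.
by split; rewrite ?coefD //; apply: leq_trans (size_polyD _ _) _; rewrite geq_max s1.
Qed.

Lemma top_atZ x p d c : top_at p d c -> top_at (x *: p) d (x * c).
Proof. by move=> [sp <-]; split; rewrite ?coefZ //; apply: leq_trans (size_scale_leq _ _) sp. Qed.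

Definition pnumX (x : L) (g l : nat) : {poly L} :=
  (\prod_(i < g) (1 - (h * x * q ^+ i) *: 'X)) *
  \prod_(g <= j < l) (1 - (q ^+ j.+1 * x) *: 'X).

Lemma pnumX_horner x g l c : (pnumX x g l).[c] = pnum (x * c) g l.
Proof.
rewrite /pnumX /pnum hornerM !horner_prod; congr (_ * _).
  by apply: eq_bigr => i _; rewrite !(hornerD, hornerN, hornerC, hornerZ, hornerX); ring.
by apply: eq_bigr => i _; rewrite !(hornerD, hornerN, hornerC, hornerZ, hornerX); ring.
Qed.

Definition ptop (x : L) (l : nat) : L := \prod_(0 <= j < l) (- (q ^+ j.+1 * x)).

Lemma ptop_neq0 x l : x != 0 -> ptop x l != 0.
Proof. by move=> x0; rewrite /ptop big_mkord; apply/prodf_neq0 => j _; rewrite oppr_eq0 mulf_neq0 ?expf_neq0. Qed.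

(** Each of the first [g] factors has h in place of q in its leading coefficient, whence the power
    of r = h / q. *)
Lemma pnumX_top x g l : (g <= l)%N -> top_at (pnumX x g l) l (r ^+ g * ptop x l).
Proof.
move=> le_gl; rewrite /pnumX -[X in top_at _ X _](subnKC le_gl).
have -> : ptop x l = ptop x g * \prod_(g <= j < l) - (q ^+ j.+1 * x) by apply: big_cat_nat.
rewrite mulrA /ptop; apply: top_atM.
  have -> : r ^+ g * \prod_(0 <= j < g) - (q ^+ j.+1 * x) = \prod_(i < g) (- (h * x * q ^+ i)).
    rewrite big_mkord -[g in r ^+ g]card_ord -prodr_const -big_split /=.
    by apply: eq_bigr => i _; rewrite /r exprS; field.
  have E : (\sum_(i < g) 1)%N = g by rewrite sum1_card card_ord.
  by rewrite -[X in top_at _ X _]E; apply: top_at_prod => i _; apply: top_at_lin.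
have -> : (l - g = \sum_(g <= j < l) 1)%N by rewrite sum_nat_const_nat muln1.
by apply: top_at_prod => i _; apply: top_at_lin.
Qed.

(** The sum [Ssum] for the variables X u, multiplied by its common denominator; [wtT] does not see
    the scaling by X. *)
Definition Spoly (n m : nat) (u : 'I_n -> L) (w : 'I_m -> L) (p l : nat) : {poly L} :=
  \sum_(g : {ffun 'I_n -> 'I_N} | (\sum_a (g a : nat) == p)%N)
     wtT u (fun a => g a) *: \prod_a \prod_b pnumX (u a * w b) (g a) l.

Definition Tsum (n : nat) (u : 'I_n -> L) (p : nat) : L :=
  \sum_(g : {ffun 'I_n -> 'I_N} | (\sum_a (g a : nat) == p)%N) wtT u (fun a => g a).

Lemma Spoly_top n m (u : 'I_n -> L) (w : 'I_m -> L) p l : (p <= l)%N ->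
  top_at (Spoly u w p l) (n * (m * l)) ((\prod_a \prod_b ptop (u a * w b) l) * (r ^+ (m * p) * Tsum u p)).
Proof.
move=> le_pl; rewrite /Tsum !mulr_sumr; apply: top_at_sum => g /eqP sg.
rewrite mulrA [X in top_at _ _ X]mulrC; apply: top_atZ.
have -> : (\prod_a \prod_b ptop (u a * w b) l) * r ^+ (m * p)
    = \prod_a \prod_b (r ^+ g a * ptop (u a * w b) l).
  rewrite mulrC -sg big_distrr /= expr_sum -big_split /=.
  apply: eq_bigr => a _; rewrite big_split /= prodr_const card_ord -exprM; congr (_ ^+ _ * _).
  exact: mulnC.
have -> : (n * (m * l) = \sum_(a < n) \sum_(b < m) l)%N by rewrite !sum_nat_const !card_ord.
apply: top_at_prod => a _; apply: top_at_prod => b _; apply: pnumX_top.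
by apply: leq_trans le_pl; rewrite -sg (bigD1 a) //= leq_addr.
Qed.

Lemma Spoly_horner n m (u : 'I_n -> L) (w : 'I_m -> L) p l c :
  (Spoly u w p l).[c] = \sum_(g : {ffun 'I_n -> 'I_N} | (\sum_a (g a : nat) == p)%N)
     wtT u (fun a => g a) * \prod_a \prod_b pnum (u a * w b * c) (g a) l.
Proof.
rewrite /Spoly horner_sum; apply: eq_bigr => g _; rewrite hornerZ; congr (_ * _).
rewrite horner_prod; apply: eq_bigr => a _; rewrite horner_prod; apply: eq_bigr => b _.
by rewrite pnumX_horner.
Qed.

Lemma pnum0 g l : pnum 0 g l = 1.
Proof.
rewrite /pnum /poch big1 ?mul1r => [|i _]; last by rewrite mulr0 mul0r subr0.
by rewrite big1 // => i _; rewrite mulr0 subr0.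
Qed.

Lemma Spoly_at0 n m (u : 'I_n -> L) (w : 'I_m -> L) p l : (Spoly u w p l).[0] = Tsum u p.
Proof.
rewrite Spoly_horner; apply: eq_bigr => g _.
rewrite big1 ?mulr1 // => a _; rewrite big1 // => b _.
by rewrite mulr0 pnum0.
Qed.

Lemma wtT_scale n (u : 'I_n -> L) c g : c != 0 -> wtT (fun a => c * u a) g = wtT u g.
Proof.
move=> c0; apply: eq_bigr => a _; apply: eq_bigr => a' _.
by rewrite [q ^+ g a * _]mulrCA [q ^+ g a' * _]mulrCA invfM mulrACA divff // mul1r.
Qed.

(** Distinct pairs of indices never share a pole, even after shifts by powers of q. As q is not a
    root of unity, all zeros of the common denominator are then simple. *)
Definition generic n m (u : 'I_n -> L) (w : 'I_m -> L) : Prop :=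
  [/\ forall a, u a != 0, forall b, w b != 0 &
      forall a b a' b' i j, (a, b) != (a', b') ->
        q ^+ i * (u a * w b) != q ^+ j * (u a' * w b')].

Lemma generic_sym n m (u : 'I_n -> L) (w : 'I_m -> L) : generic u w -> generic w u.
Proof.
move=> [u0 w0 uw]; split=> // b a b' a' i j ne.
rewrite [w b * _]mulrC [w b' * _]mulrC; apply: uw.
by apply: contra ne; rewrite !xpair_eqE andbC.
Qed.

Lemma generic_scale n m (u : 'I_n -> L) (w : 'I_m -> L) c : c != 0 ->
  generic u w -> generic (fun a => c * u a) w.
Proof.
move=> c0 [u0 w0 uw]; split=> // [a|a b a' b' i j ne]; first by rewrite mulf_neq0.
rewrite -!(mulrA c) !(mulrCA _ c); apply: contra (uw _ _ _ _ i j ne).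
by move=> /eqP /(mulfI c0) ->.
Qed.

Lemma generic_shift n m (u : 'I_n -> L) (w : 'I_m -> L) a0 k :
  generic u w -> generic (shift u a0 k) w.
Proof.
move=> [u0 w0 uw]; split=> // [a|a b a' b' i j ne].
  by rewrite /shift; case: ifP => // _; rewrite mulf_neq0 ?expf_neq0.
rewrite /shift; case: ifP => _; case: ifP => _; rewrite -?(mulrA (q ^+ k)) ?(mulrA (q ^+ _) (q ^+ _)) -?exprD;
  exact: uw.
Qed.

Definition no_pole n m (u : 'I_n -> L) (w : 'I_m -> L) : Prop :=
  forall a b j, q ^+ j.+1 * (u a * w b) != 1.

Definition Fpoly (a : nat) : {poly L} := \poly_(j < N) (r ^+ (a * j) * pochq 1 j).

(** The coefficient of X^l in F(X) F(rX) ... F(r^(n-1) X), with F the truncated series of (h)_j /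
    (q)_j. It turns out to be the value of [Tsum], whatever the variables. *)
Definition piF (n l : nat) : L := (\prod_(a < n) Fpoly a)`_l.

Lemma piF_S n l : (l < N)%N ->
  piF n.+1 l = \sum_(j < l.+1) r ^+ (n * j) * pochq 1 j * piF n (l - j).
Proof.
move=> lt_lN; rewrite /piF big_ord_recr /= mulrC coefM; apply: eq_bigr => j _.
by rewrite /Fpoly coef_poly (leq_ltn_trans _ lt_lN) // -ltnS.
Qed.

(** Splits off the factor F(X), where [piF_S] splits off F(r^n X). The former governs the leading
    coefficient of the dual side, the latter its constant term. *)
Lemma piF_shift n l : (l < N)%N ->
  \sum_(j < l.+1) pochq 1 j * (r ^+ (l - j) * piF n (l - j)) = piF n.+1 l.
Proof.
move=> lt_lN; rewrite /piF big_ord_recl coefM; apply: eq_bigr => j _.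
have lt_jN : (j < N)%N by apply: leq_ltn_trans lt_lN; rewrite -ltnS.
rewrite /Fpoly coef_poly lt_jN mul0n expr0 mul1r; congr (_ * _).
move: {j lt_jN}(l - j)%N => i; elim: n i => [|n IHn] i.
  by rewrite !big_ord0 coef1; case: i => [|i]; rewrite ?mulr1 ?mulr0.
rewrite !big_ord_recr /= !coefM mulr_sumr; apply: eq_bigr => j _.
have le_ji : (j <= i)%N by rewrite -ltnS.
have -> : r ^+ i = r ^+ j * r ^+ (i - j) by rewrite -exprD subnKC.
rewrite -IHn !coef_poly; case: ifP => _; last by rewrite !mulr0.
by rewrite /bump add1n mulSn exprD; ring.
Qed.

Lemma piF0 n : (0 < N)%N -> piF n 0 = 1.
Proof.
move=> N0; elim: n => [|n IHn]; first by rewrite /piF big_ord0 coef1.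
by rewrite piF_S // big_ord1 subn0 IHn muln0 pochq0 !mulr1.
Qed.

Lemma big_ffun_sum0 n (F : ('I_n -> nat) -> L) : (0 < N)%N ->
  (forall g g', g =1 g' -> F g = F g') ->
  \sum_(g : {ffun 'I_n -> 'I_N} | (\sum_a (g a : nat) == 0)%N) F (fun a => g a) = F (fun=> 0%N).
Proof.
move=> N0 Fext; rewrite (big_pred1 [ffun=> Ordinal N0]) => [|g /=].
  by apply: Fext => a; rewrite ffunE.
rewrite sum_nat_eq0; apply/forallP/eqP => [g0|-> a]; last by rewrite ffunE.
by apply/ffunP=> a; apply/val_inj/eqP; rewrite ffunE; apply: (implyP (g0 a)).
Qed.

Lemma Tsum0 n (u : 'I_n -> L) : (0 < N)%N -> Tsum u 0 = 1.
Proof.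
move=> N0; rewrite /Tsum (big_ffun_sum0 (F := wtT u)) //; last exact: wtT_ext.
by rewrite /wtT big1 // => a _; rewrite big1 // => a' _; rewrite pochq0.
Qed.

Lemma Tsum1 (u : 'I_1 -> L) l : u ord0 != 0 -> (l < N)%N -> Tsum u l = pochq 1 l.
Proof.
move=> u0 lt_lN; rewrite /Tsum (big_pred1 [ffun=> Ordinal lt_lN]) => [|g /=].
  by rewrite /wtT !big_ord1 ffunE divff // mulf_neq0 ?expf_neq0.
rewrite big_ord1; apply/eqP/eqP => [e|-> ]; last by rewrite ffunE.
by apply/ffunP=> a; apply: val_inj; rewrite ord1 ffunE.
Qed.

Lemma Ssum_ord0 m (u : 'I_0 -> L) (w : 'I_m -> L) l : Ssum u w l = (l == 0%N)%:R.
Proof.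
rewrite /Ssum big_mkcond (big_pred1 (ffun0 (card_ord 0))) => [|g].
  rewrite big_ord0 eq_sym; case: eqP => // _.
  by rewrite /wtT /wtX !big_ord0 mulr1.
by apply/esym/eqP/ffunP=> -[].
Qed.

Hypothesis r_free : forall k, r ^+ k.+1 != 1.

Lemma q_exp_inj : injective (fun i => q ^+ i).
Proof.
have lt i j : (i < j)%N -> q ^+ i != q ^+ j.
  move=> ij; rewrite -(subnKC (ltnW ij)) exprD -{1}[q ^+ i]mulr1.
  apply/negP => /eqP /(mulfI (expf_neq0 _ q0)) e.
  by have := q_free (j - i).-1; rewrite prednK ?subn_gt0 // -e eqxx.
move=> i j /eqP e; case: (ltngtP i j) => // ij; first by rewrite (negPf (lt _ _ ij)) in e.
by rewrite eq_sym (negPf (lt _ _ ij)) in e.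
Qed.

Definition dual_rhs m n (w : 'I_m -> L) (u : 'I_n -> L) (l : nat) : L :=
  \sum_(j < l.+1) r ^+ (m * j) * pochq 1 j * Ssum w u (l - j).

Section Step.
Variables (m l : nat) (u : 'I_m.+1 -> L) (w : 'I_m -> L).
Hypothesis uw : generic u w.
Hypothesis lt_lN : (l < N)%N.
Hypothesis Tw : forall p, (p < N)%N -> Tsum w p = piF m p.
Hypothesis IH : forall k (u' : 'I_m.+1 -> L) (w' : 'I_m -> L), (k < l)%N ->
  generic u' w' -> no_pole u' w' -> Ssum u' w' k = dual_rhs w' u' k.

(** The difference of the two sides after scaling [u] by X. One product clears the denominators of
    both, because both involve the same u_a w_b. *)
Definition Epoly : {poly L} := Spoly u w l l -
  \sum_(j < l.+1) (r ^+ (m * j) * pochq 1 j) *: Spoly w u (l - j) l.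

(** The values of the two sides are [resC] times the two sides of the duality for [l - k] and the
    variables shifted at [a0] and [b0], which are again generic and without poles. *)
Lemma Epoly_pole a0 b0 k : (0 < k <= l)%N -> Epoly.[(q ^+ k * (u a0 * w b0))^-1] = 0.
Proof.
move=> /andP[k_gt0 le_kl]; set c := _^-1; have [u0 w0 g_uw] := uw.
have c0 : c != 0 by rewrite invr_eq0 !mulf_neq0 ?expf_neq0.
pose uc a := c * u a.
have guc : generic uc w by apply: generic_scale.
have [uc0 _ g_uc] := guc.
have pole : q ^+ k * (uc a0 * w b0) = 1.
  by rewrite /uc -mulrA mulrCA mulVf // !mulf_neq0 ?expf_neq0.
have no_o a b j : (a, b) != (a0, b0) -> q ^+ j.+1 * (uc a * w b) != 1.
  by move=> ne; rewrite -pole; apply: g_uc.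
rewrite /Epoly hornerD hornerN Spoly_horner horner_sum.
have -> : \sum_(g : {ffun 'I_m.+1 -> 'I_N} | (\sum_a (g a : nat) == l)%N)
     wtT u (fun a => g a) * \prod_a \prod_b pnum (u a * w b * c) (g a) l
  = \sum_(g : {ffun 'I_m.+1 -> 'I_N} | (\sum_a (g a : nat) == l)%N)
     wtT uc (fun a => g a) * \prod_a \prod_b pnum (uc a * w b) (g a) l.
  apply: eq_bigr => g _; rewrite wtT_scale //; congr (_ * _).
  apply: eq_bigr => a _; apply: eq_bigr => b _; congr (pnum _ _ _).
  by rewrite /uc; ring.
rewrite (residue_sum uc0 pole no_o) ?le_kl ?k_gt0 //.
have R j : ((r ^+ (m * j) * pochq 1 j) *: Spoly w u (l - j) l).[c]
    = r ^+ (m * j) * pochq 1 j * (if (k <= l - j)%N then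
       resC uc w a0 b0 k l * Ssum (shift w b0 k) (shift uc a0 k) (l - j - k) else 0).
  rewrite hornerZ Spoly_horner resC_sym -residue_sum ?k_gt0 //.
  - congr (_ * _); apply: eq_bigr => g _; congr (_ * _).
    apply: eq_bigr => b _; apply: eq_bigr => a _; congr (pnum _ _ _).
    by rewrite /uc; ring.
  - by rewrite [w b0 * _]mulrC.
  - move=> b a i ne; rewrite [w b * _]mulrC; apply: no_o.
    by apply: contra ne; rewrite !xpair_eqE andbC.
  - exact: leq_ltn_trans (leq_subr _ _) lt_lN.
  - exact: leq_subr.
under eq_bigr => j _ do rewrite R.
rewrite IH; last first.
- move=> a b j; rewrite /shift; case: (eqVneq a a0) => [->|na]; case: (eqVneq b b0) => [->|nb].
  + have -> : q ^+ j.+1 * (q ^+ k * uc a0 * (q ^+ k * w b0))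
        = q ^+ j.+1 * q ^+ k * (q ^+ k * (uc a0 * w b0)) by ring.
    by rewrite pole mulr1 -exprD addSn.
  + have -> : q ^+ j.+1 * (q ^+ k * uc a0 * w b) = q ^+ j.+1 * q ^+ k * (uc a0 * w b) by ring.
    by rewrite -exprD addSn; apply: no_o; rewrite xpair_eqE (negPf nb) andbF.
  + have -> : q ^+ j.+1 * (uc a * (q ^+ k * w b0)) = q ^+ j.+1 * q ^+ k * (uc a * w b0) by ring.
    by rewrite -exprD addSn; apply: no_o; rewrite xpair_eqE (negPf na).
  + by apply: no_o; rewrite xpair_eqE (negPf na).
- by apply/generic_sym/generic_shift/generic_sym/generic_shift.
- by rewrite ltn_subrL k_gt0 (leq_trans k_gt0 le_kl).
rewrite /dual_rhs mulr_sumr.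
rewrite (big_ord_widen l.+1 (fun j => resC uc w a0 b0 k l * (r ^+ (m * j) * pochq 1 j *
  Ssum (shift w b0 k) (shift uc a0 k) (l - k - j)))) ?ltnS ?leq_subr //.
rewrite big_mkcond /= -sumrB big1 // => j _; rewrite ltnS.
have -> : (k <= l - j)%N = (j <= l - k)%N by have := ltn_ord j; lia.
case: ifP => _; last by rewrite mulr0 subrr.
by rewrite subnAC; ring.
Qed.

Let Dpoly : {poly L} := \prod_a \prod_b pnumX (u a * w b) 0 l.
Let Dt := \prod_a \prod_b ptop (u a * w b) l.

Let Dpoly_top : top_at Dpoly (m.+1 * (m * l)) Dt.
Proof.
have -> : (m.+1 * (m * l) = \sum_(a < m.+1) \sum_(b < m) l)%N.
  by rewrite !sum_nat_const !card_ord.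
apply: top_at_prod => a _; apply: top_at_prod => b _.
by have := pnumX_top (u a * w b) (leq0n l); rewrite expr0 mul1r.
Qed.

Let Dpoly_root a b k : (0 < k <= l)%N -> Dpoly.[(q ^+ k * (u a * w b))^-1] = 0.
Proof.
move=> kl; have [u0 w0 _] := uw.
have nz : q ^+ k * (u a * w b) != 0 by rewrite !mulf_neq0 ?expf_neq0.
rewrite /Dpoly horner_prod (bigD1 a) //= horner_prod (bigD1 b) //= pnumX_horner.
by rewrite (pnum_eq0 kl) ?mul0r // mulrA divff.
Qed.

Let Epoly_top : top_at Epoly (m.+1 * (m * l))
  (Dt * (r ^+ (m * l) * (Tsum u l - piF m.+1 l))).
Proof.
rewrite mulrBr mulrBr /Epoly.
have -> : Dt * (r ^+ (m * l) * piF m.+1 l) = \sum_(j < l.+1)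
   r ^+ (m * j) * pochq 1 j * (Dt * (r ^+ (m.+1 * (l - j)) * Tsum w (l - j))).
  rewrite -piF_shift // !mulr_sumr; apply: eq_bigr => j _.
  rewrite Tw; last exact: leq_ltn_trans (leq_subr _ _) lt_lN.
  rewrite mulSn exprD; have -> : r ^+ (m * l) = r ^+ (m * j) * r ^+ (m * (l - j)).
    by rewrite -exprD -mulnDr subnKC // -ltnS.
  by ring.
have topN p d c : top_at p d c -> top_at (- p) d (- c).
  by move=> [sp <-]; split; rewrite ?size_polyN ?coefN.
have topD p p' d c c' : top_at p d c -> top_at p' d c' -> top_at (p + p') d (c + c').
  move=> [sp <-] [sp' <-]; split; rewrite ?coefD //.
  by apply: leq_trans (size_polyD _ _) _; rewrite geq_max sp.
apply: topD; first exact: Spoly_top.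
apply/topN/top_at_sum => j _; apply: top_atZ.
have := Spoly_top w u (leq_subr j l); rewrite [in X in top_at _ X _]mulnCA.
rewrite exchange_big /=; congr top_at; congr (_ * _).
by apply: eq_bigr => a _; apply: eq_bigr => b _; rewrite mulrC.
Qed.

Let Epoly0 : Epoly.[0] = Tsum u l - piF m.+1 l.
Proof.
rewrite /Epoly hornerD hornerN Spoly_at0 horner_sum piF_S //; congr (_ - _).
apply: eq_bigr => j _; rewrite hornerZ Spoly_at0 Tw //.
exact: leq_ltn_trans (leq_subr _ _) lt_lN.
Qed.

(** [Epoly] vanishes at all zeros of the common denominator [Dpoly], whose value at 0 is 1. The
    difference in question has the further zero 0, one more than its degree allows. *)
Let EpolyE : Epoly = Epoly.[0] *: Dpoly.
Proof.
apply/eqP; rewrite -subr_eq0; apply/negPn/negP => nz.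
have [u0 w0 g_uw] := uw.
pose f (t : ('I_m.+1 * 'I_m) * 'I_l) := (q ^+ t.2.+1 * (u t.1.1 * w t.1.2))^-1.
have f_inj : injective f.
  move=> [[a b] j] [[a' b'] j'] /invr_inj /eqP; rewrite /f /=.
  case: (eqVneq (a, b) (a', b')) => [[-> ->] /eqP|ne]; last by rewrite (negPf (g_uw _ _ _ _ _ _ ne)).
  move=> /(mulIf _) e; have /q_exp_inj [] : q ^+ j.+1 = q ^+ j'.+1 by apply: e; rewrite mulf_neq0.
  by move=> /val_inj ->.
have := max_poly_roots (rs := 0 :: [seq f t | t <- enum {: ('I_m.+1 * 'I_m) * 'I_l}]) nz.
rewrite /= size_map -cardE !card_prod !card_ord => hroot.
have : (size (Epoly - Epoly.[0] *: Dpoly)%R <= (m.+1 * (m * l)).+1)%N.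
  apply: leq_trans (size_polyD _ _) _; rewrite size_polyN geq_max Epoly_top.1 /=.
  exact: leq_trans (size_scale_leq _ _) Dpoly_top.1.
rewrite leqNgt mulnA => /negP[]; apply: hroot; last first.
  rewrite map_inj_uniq ?enum_uniq // andbT; apply/mapP => -[[[a b] j] _] /eqP.
  by rewrite eq_sym invr_eq0; apply/negP; rewrite !mulf_neq0 ?expf_neq0.
apply/andP; split.
  rewrite rootE hornerD hornerN hornerZ [X in _ * X](_ : Dpoly.[0] = 1) ?mulr1 ?subrr //.
  rewrite /Dpoly horner_prod big1 // => a _; rewrite horner_prod big1 // => b _.
  by rewrite pnumX_horner mulr0 pnum0.
apply/allP => _ /mapP[[[a b] j] _ ->].
have jl : (0 < j.+1 <= l)%N by rewrite /=.
by rewrite rootE hornerD hornerN hornerZ /f /= Dpoly_root // Epoly_pole // mulr0 subrr.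
Qed.

Hypothesis m_gt0 : (0 < m)%N.

(** With e the value of [Epoly] at 0, comparing leading coefficients gives e r^(ml) = e. For
    positive m and l this forces e = 0, since r is not a root of unity. *)
Lemma Tsum_step : Tsum u l = piF m.+1 l.
Proof.
have [u0 w0 _] := uw.
have [l0|l_gt0] := posnP l; first by rewrite l0 Tsum0 ?piF0 // -l0 (leq_ltn_trans _ lt_lN).
have Dt0 : Dt != 0.
  by apply/prodf_neq0 => a _; apply/prodf_neq0 => b _; apply/ptop_neq0/mulf_neq0.
have := Epoly_top.2; rewrite EpolyE coefZ Dpoly_top.2 Epoly0.
move: (Tsum u l - _) (subr_eq0 (Tsum u l) (piF m.+1 l)) => e eE E1.
have : Dt * (e * (1 - r ^+ (m * l))) = 0.
  by rewrite mulrBr mulr1 mulrBr [Dt * e]mulrC E1 [e * _]mulrC subrr.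
move/eqP; rewrite !mulf_eq0 (negPf Dt0) /= eE subr_eq0 [1 == _]eq_sym.
have := r_free (m * l).-1; rewrite prednK ?muln_gt0 ?m_gt0 // => /negPf ->.
by rewrite orbF => /eqP.
Qed.

Lemma Ssum_step : no_pole u w -> Ssum u w l = dual_rhs w u l.
Proof.
move=> npole.
have E0 : Epoly.[1] = 0 by rewrite EpolyE Epoly0 Tsum_step subrr scale0r horner0.
pose D := \prod_a \prod_b poch (q * (u a * w b)) l.
have D0 : D != 0.
  by apply/prodf_neq0 => a _; apply/prodf_neq0 => b _; apply: poch_neq0 => j _; apply: npole.
have g_le n (g : {ffun 'I_n -> 'I_N}) s : (\sum_a (g a : nat) == s)%N -> forall a, (g a <= s)%N.
  by move=> /eqP <- a; rewrite (bigD1 a) //= leq_addr.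
move: E0; rewrite /Epoly hornerD hornerN Spoly_horner horner_sum => /eqP.
rewrite subr_eq0 => /eqP E0; apply: (mulIf D0).
transitivity (\sum_(g : {ffun 'I_m.+1 -> 'I_N} | (\sum_a (g a : nat) == l)%N)
  wtT u (fun a => g a) * \prod_a \prod_b pnum (u a * w b * 1) (g a) l).
  rewrite /Ssum mulr_suml; apply: eq_bigr => g /g_le hg; rewrite -[LHS]mulrA; congr (_ * _).
  rewrite /wtX /D -big_split /=; apply: eq_bigr => a _; rewrite -big_split /=.
  apply: eq_bigr => b _; rewrite mulr1 pnumE //.
  by apply: poch_neq0 => j _; apply: npole.
rewrite E0 /dual_rhs mulr_suml; apply: eq_bigr => j _.
rewrite hornerZ Spoly_horner -[RHS]mulrA; congr (_ * _).
rewrite /Ssum mulr_suml; apply: eq_bigr => g /g_le hg; rewrite -[RHS]mulrA; congr (_ * _).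
rewrite /wtX /D [X in _ = _ * X]exchange_big -big_split /=; apply: eq_bigr => b _; rewrite -big_split /=.
apply: eq_bigr => a _; rewrite mulr1 pnumE; first by rewrite [w b * _]mulrC.
  exact: leq_trans (hg b) (leq_subr _ _).
by apply: poch_neq0 => j' _; rewrite [w b * _]mulrC; apply: npole.
Qed.

End Step.

(** The formula for [Tsum] is carried along because the comparison of constant and leading terms
    needs it for the family [w], which has one variable less. *)
Theorem Ssum_dual m l (u : 'I_m.+1 -> L) (w : 'I_m -> L) : (l < N)%N -> generic u w ->
  Tsum u l = piF m.+1 l /\ (no_pole u w -> Ssum u w l = dual_rhs w u l).
Proof.
elim: m l u w => [|m IHm] l u w.
  move=> lt_lN [u0 _ _].
  have Tu : Tsum u l = pochq 1 l by rewrite Tsum1.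
  split.
    rewrite Tu piF_S // (bigD1 ord_max) //= subnn mul0n mul1r piF0 ?mulr1; last first.
      exact: leq_ltn_trans lt_lN.
    rewrite big1 ?addr0 // => j ne; rewrite /piF big_ord0 coef1.
    have : (j < l)%N.
      rewrite ltn_neqAle -ltnS ltn_ord andbT; apply: contra ne => /eqP e.
      by apply/eqP/val_inj.
    by rewrite -subn_gt0; case: (l - j)%N => // i _; rewrite mulr0.
  move=> _; rewrite /dual_rhs (bigD1 ord_max) //= subnn mul0n mul1r Ssum_ord0 eqxx mulr1.
  rewrite big1 => [|j ne]; last first.
    have : (j < l)%N.
      rewrite ltn_neqAle -ltnS ltn_ord andbT; apply: contra ne => /eqP e.
      by apply/eqP/val_inj.
    by rewrite Ssum_ord0 -subn_gt0; case: (l - j)%N => // i _; rewrite mulr0.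
  rewrite addr0 -Tu; apply: eq_bigr => g _.
  by rewrite /wtX big1 ?mulr1 // => a _; rewrite big_ord0.
elim/ltn_ind: l u w => l IHl u w lt_lN uw.
have Tw p : (p < N)%N -> Tsum w p = piF m.+1 p.
  (* The induction hypothesis for [w] asks for a companion family with one variable less than [w];
     all but two of the [u] serve. *)
  move=> lt_p; pose i0 (b : 'I_m) : 'I_m.+2 := lift ord0 (lift ord0 b).
  have gw : generic w (fun b => u (i0 b)).
    have [u0 w0 g_uw] := generic_sym uw; split=> // a b a' b' i j ne.
    apply: g_uw; apply: contra ne; rewrite !xpair_eqE => /andP[-> /eqP /lift_inj /lift_inj ->].
    by rewrite eqxx.
  by have [] := IHm p _ _ lt_p gw.
have IH k (u' : 'I_m.+2 -> L) (w' : 'I_m.+1 -> L) : (k < l)%N ->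
    generic u' w' -> no_pole u' w' -> Ssum u' w' k = dual_rhs w' u' k.
  by move=> lt_k g'; have [] := IHl k lt_k u' w' (ltn_trans lt_k lt_lN) g'.
split; first exact: (Tsum_step uw lt_lN Tw IH isT).
exact: (Ssum_step uw lt_lN Tw IH isT).
Qed.

End Sums.
End Duality.

(** * Specialization of the duality to variables in special position *)

Section Specialize.
Variable K : fieldType.
Local Notation L := {fraction {poly K}}.
Local Notation "p %:F" := (tofrac p).

(** Evaluation at X = 1 is a relation, since a rational function may have a pole there. *)
Definition spec1 (x : L) (v : K) : Prop :=
  exists f g : {poly K}, [/\ g.[1] != 0, x = f%:F / g%:F & v = f.[1] / g.[1]].

Let nz (g : {poly K}) : g.[1] != 0 -> g%:F != 0 :> L.
Proof. by apply: contra; rewrite tofrac_eq0 => /eqP->; rewrite horner0. Qed.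

Lemma spec1_inj x v v' : spec1 x v -> spec1 x v' -> v = v'.
Proof.
move=> [f [g [g1 -> ->]]] [f' [g' [g'1 e ->]]].
apply/eqP; rewrite eqr_div // -!hornerM; apply/eqP; congr (_.[_]).
apply/eqP; rewrite -tofrac_eq !tofracM; apply/eqP.
by apply/eqP; rewrite -eqr_div ?nz //; apply/eqP.
Qed.

Lemma spec1_poly (f : {poly K}) : spec1 f%:F f.[1].
Proof. by exists f, 1; rewrite hornerC oner_neq0 tofrac1 !divr1. Qed.

Lemma spec1D x y v w : spec1 x v -> spec1 y w -> spec1 (x + y) (v + w).
Proof.
move=> [f [g [g1 -> ->]]] [f' [g' [g'1 -> ->]]].
exists (f * g' + f' * g), (g * g'); rewrite hornerD !hornerM mulf_neq0 //.
by rewrite !addf_div ?nz // tofracD !tofracM.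
Qed.

Lemma spec1M x y v w : spec1 x v -> spec1 y w -> spec1 (x * y) (v * w).
Proof.
move=> [f [g [g1 -> ->]]] [f' [g' [g'1 -> ->]]].
by exists (f * f'), (g * g'); rewrite !hornerM mulf_neq0 // !mulf_div !tofracM.
Qed.

Lemma spec1V x v : v != 0 -> spec1 x v -> spec1 x^-1 v^-1.
Proof.
move=> v0 [f [g [g1 -> ve]]]; exists g, f; rewrite !invf_div ve invf_div.
by split=> //; apply: contra v0; rewrite ve => /eqP->; rewrite mul0r.
Qed.

Lemma spec1N x v : spec1 x v -> spec1 (- x) (- v).
Proof.
move=> [f [g [g1 -> ->]]]; exists (- f), g.
by rewrite hornerN !mulNr tofracN mulNr.
Qed.

Lemma spec1_1 : spec1 1 1.
Proof. by rewrite -tofrac1 -[X in spec1 _ X](hornerC 1 1); apply: spec1_poly. Qed.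

Lemma spec1_0 : spec1 0 0.
Proof. by rewrite -tofrac0 -[X in spec1 _ X](horner0 1); apply: spec1_poly. Qed.

Lemma spec1X x v n : spec1 x v -> spec1 (x ^+ n) (v ^+ n).
Proof. by move=> xv; elim: n => [|n IHn]; rewrite ?expr0 ?exprS; [apply: spec1_1|apply: spec1M]. Qed.

Lemma spec1_sum (I : Type) (s : seq I) (P : pred I) x v :
  (forall i, P i -> spec1 (x i) (v i)) ->
  spec1 (\sum_(i <- s | P i) x i) (\sum_(i <- s | P i) v i).
Proof. by move=> xv; elim/big_ind2: _ => //; [apply: spec1_0 | move=> *; apply: spec1D]. Qed.

Lemma spec1_prod (I : Type) (s : seq I) (P : pred I) x v :
  (forall i, P i -> spec1 (x i) (v i)) ->
  spec1 (\prod_(i <- s | P i) x i) (\prod_(i <- s | P i) v i).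
Proof. by move=> xv; elim/big_ind2: _ => //; [apply: spec1_1 | move=> *; apply: spec1M]. Qed.

Variables (q h : K) (N : nat).
Hypothesis q0 : q != 0.
Hypothesis h0 : h != 0.
Hypothesis q_free : forall k, q ^+ k.+1 != 1.
Hypothesis r_free : forall k, (h / q) ^+ k.+1 != 1.

Let qL : L := q%:P%:F.
Let hL : L := h%:P%:F.

Let spC c : spec1 c%:P%:F c.
Proof. by rewrite -[X in spec1 _ X](hornerC c 1); apply: spec1_poly. Qed.

Lemma spec1_poch x v g : spec1 x v -> spec1 (poch qL x g) (poch q v g).
Proof.
move=> xv; apply: spec1_prod => i _; apply: spec1D; first exact: spec1_1.
by apply: spec1N; apply: spec1M => //; apply/spec1X/spC.
Qed.

Lemma spec1_pochq x v g : spec1 x v -> poch q (q * v) g != 0 ->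
  spec1 (pochq qL hL x g) (pochq q h v g).
Proof.
move=> xv nz'; apply: spec1M; first by apply/spec1_poch/spec1M => //; apply: spC.
by apply: spec1V => //; apply/spec1_poch/spec1M => //; apply: spC.
Qed.

(** Keeps the off-diagonal denominators of [wtT] away from 0 when X is set to 1. *)
Definition q_separated n (u : 'I_n -> K) : Prop :=
  (forall a, u a != 0) /\ forall a a' i j, a != a' -> q ^+ i * u a != q ^+ j * u a'.

Let spec1_wtT n (U : 'I_n -> L) u g : q_separated u -> (forall a, spec1 (U a) (u a)) ->
  spec1 (wtT qL hL U g) (wtT q h u g).
Proof.
move=> [u0 us] Uu; apply: spec1_prod => a _; apply: spec1_prod => a' _.
apply: spec1_pochq.
  apply: spec1M; first by apply: spec1M => //; apply/spec1X/spC.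
  apply: spec1V; first by rewrite mulf_neq0 ?expf_neq0.
  by apply: spec1M => //; apply/spec1X/spC.
have [<-|ne] := eqVneq a a'.
  by rewrite divff ?mulf_neq0 ?expf_neq0 //; apply: poch1_neq0.
apply: poch_neq0 => j _.
have nz' : q ^+ g a' * u a' != 0 by rewrite mulf_neq0 ?expf_neq0.
rewrite mulrA -(inj_eq (mulIf nz')) divfK // mul1r mulrA -exprD.
exact: us.
Qed.

Let spec1_wtX n m (U : 'I_n -> L) u (W : 'I_m -> L) w g : no_pole q u w ->
  (forall a, spec1 (U a) (u a)) -> (forall b, spec1 (W b) (w b)) ->
  spec1 (wtX qL hL U W g) (wtX q h u w g).
Proof.
move=> np Uu Ww; apply: spec1_prod => a _; apply: spec1_prod => b _.
by apply: spec1_pochq; [apply: spec1M | apply: poch_neq0 => j _; apply: np].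
Qed.

Let spec1_Ssum n m (U : 'I_n -> L) u (W : 'I_m -> L) w l : no_pole q u w -> q_separated u ->
  (forall a, spec1 (U a) (u a)) -> (forall b, spec1 (W b) (w b)) ->
  spec1 (Ssum qL hL N U W l) (Ssum q h N u w l).
Proof.
move=> np us Uu Ww; apply: spec1_sum => g _.
by apply: spec1M; [apply: spec1_wtT | apply: spec1_wtX].
Qed.

Theorem Ssum_dual_spec m l (u : 'I_m.+1 -> K) (w : 'I_m -> K) : (l < N)%N ->
  q_separated u -> q_separated w -> no_pole q u w ->
  Ssum q h N u w l = dual_rhs q h N w u l.
Proof.
move=> lt_lN us ws np; have [u0 _] := us; have [w0 _] := ws.
pose XL : L := ('X : {poly K})%:F.
(* The exponent a m + b of U_a W_b determines the pair (a, b) because b < m, so the deformed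
   variables are generic; at X = 1 they become [u] and [w]. *)
pose U (a : 'I_m.+1) : L := (u a)%:P%:F * XL ^+ (a * m).
pose W (b : 'I_m) : L := (w b)%:P%:F * XL ^+ b.
have XL1 n : spec1 (XL ^+ n) 1.
  by rewrite -[X in spec1 _ X](expr1n _ n); apply: spec1X; rewrite -[X in spec1 _ X](hornerX 1); apply: spec1_poly.
have Uu a : spec1 (U a) (u a) by rewrite -[X in spec1 _ X]mulr1; apply: spec1M.
have Ww b : spec1 (W b) (w b) by rewrite -[X in spec1 _ X]mulr1; apply: spec1M.
have CX c i d j : c != 0 -> c%:P%:F * XL ^+ i = d%:P%:F * XL ^+ j -> i = j /\ c = d.
  move=> c0; rewrite /XL -!tofracXn -!tofracM => /eqP; rewrite tofrac_eq => /eqP e.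
  have := congr1 (fun p : {poly K} => p`_i) e; rewrite !coefCM !coefXn eqxx mulr1.
  by case: eqP => [->|_]; rewrite ?mulr1 ?mulr0 // => c00; rewrite c00 eqxx in c0.
have qL0 : qL != 0 by rewrite tofrac_eq0 polyC_eq0.
have hL0 : hL != 0 by rewrite tofrac_eq0 polyC_eq0.
have CXn c n : (c%:P%:F : L) ^+ n = (c ^+ n)%:P%:F by rewrite -tofracXn polyC_exp.
have Cinj : injective (fun c : K => c%:P%:F : L).
  by move=> c d /eqP; rewrite tofrac_eq => /eqP /polyC_inj.
have qL_free k : qL ^+ k.+1 != 1.
  rewrite CXn -tofrac1 tofrac_eq -polyC1; apply: contra (q_free k).
  by move=> /eqP/polyC_inj ->.
have rL_free k : (r qL hL) ^+ k.+1 != 1.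
  rewrite /r expr_div_n !CXn; apply: contra (r_free k) => /eqP e.
  have {}e : (h ^+ k.+1)%:P%:F = (q ^+ k.+1)%:P%:F :> L.
    exact: divr1_eq e.
  by rewrite expr_div_n (Cinj _ _ e) divff // expf_neq0.
have UWE i a b : qL ^+ i * (U a * W b) = (q ^+ i * (u a * w b))%:P%:F * XL ^+ (a * m + b).
  by rewrite /U /W CXn !polyCM !tofracM exprD; ring.
have gen : generic qL U W.
  have Z0 c i : c != 0 -> c%:P%:F * XL ^+ i != 0.
    move=> c0; apply: mulf_neq0; first by rewrite tofrac_eq0 polyC_eq0.
    by apply: expf_neq0; rewrite tofrac_eq0 polyX_eq0.
  split=> [a|b|a b a' b' i j ne]; [exact: Z0 | exact: Z0 |].
  apply/eqP; rewrite !UWE => /CX[].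
    by rewrite !mulf_neq0 ?expf_neq0.
  move=> e _; case/negP: ne; have bm := ltn_ord b; have b'm := ltn_ord b'.
  have := congr1 (modn^~ m) e; rewrite !modnMDl !modn_small // => /val_inj eb.
  move: e; rewrite eb => /addIn /eqP; rewrite eqn_mul2r -[m == 0%N]negbK -lt0n (leq_ltn_trans _ bm) //= => /eqP/val_inj ->.
  by rewrite eqxx.
have npL : no_pole qL U W.
  move=> a b j; apply/eqP; rewrite UWE => e.
  have [] := CX (q ^+ j.+1 * (u a * w b)) (a * m + b)%N 1 0%N.
  - by rewrite !mulf_neq0 ?expf_neq0.
  - by rewrite e polyC1 tofrac1 expr0 mulr1.
  - by move=> _ /eqP; rewrite (negPf (np a b j)).
have [_ /(_ npL) E] := Ssum_dual qL0 hL0 qL_free rL_free lt_lN gen.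
apply: (@spec1_inj (Ssum qL hL N U W l)); first exact: spec1_Ssum.
rewrite E; apply: spec1_sum => j _; apply: spec1M.
  apply: spec1M; first by apply: spec1X; apply: spec1M; [exact: spC | apply: spec1V => //; exact: spC].
  by apply: spec1_pochq; [exact: spec1_1 | apply: poch1_neq0].
apply: spec1_Ssum => // b a i; by rewrite [w b * _]mulrC; apply: np.
Qed.

End Specialize.

(** * Translation and reflection of sums over compositions *)

Section CompositionSums.
Variables (K : fieldType) (N : nat).

Definition extz (m : nat) (g : 'I_m -> nat) : nat -> nat :=
  fun a => if insub a is Some i then g i else 0%N.

Lemma extzE m (g : 'I_m -> nat) (a : 'I_m) : extz g a = g a.
Proof. by rewrite /extz valK. Qed.

Lemma extz_ext m (g g' : 'I_m -> nat) : g =1 g' -> extz g =1 extz g'.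
Proof. by move=> e a; rewrite /extz; case: insubP => // i _ _; rewrite e. Qed.

Definition csum (m D : nat) (F : (nat -> nat) -> K) : K :=
  \sum_(g : {ffun 'I_m -> 'I_N} | (\sum_a (g a : nat) == D)%N) F (extz (fun a => g a)).

(** Lower bounds that the vanishing of [F] enforces are absorbed by a translation. *)
Lemma csum_shift m D (F : (nat -> nat) -> K) (A : nat -> nat) : (D < N)%N ->
  (forall p p', (forall a, (a < m)%N -> p a = p' a) -> F p = F p') ->
  (forall p a, (a < m)%N -> (p a < A a)%N -> F p = 0) ->
  csum m D F = if (\sum_(a < m) A a <= D)%N
    then csum m (D - \sum_(a < m) A a) (fun p => F (fun a => A a + p a)%N) else 0.
Proof.
move=> lt_DN Fext Fv.
have Fv' (g : {ffun 'I_m -> 'I_N}) : ~~ [forall a : 'I_m, (A a <= g a)%N] -> F (extz (fun a => g a)) = 0.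
  by rewrite negb_forall => /existsP[a]; rewrite -ltnNge => lt; apply: (Fv _ a); rewrite ?extzE.
rewrite /csum (bigID (fun g : {ffun 'I_m -> 'I_N} => [forall a : 'I_m, (A a <= g a)%N])) /=.
rewrite [X in _ + X]big1 ?addr0; last by move=> g /andP[_ /Fv'].
case: leqP => [le_AD|lt_DA]; last first.
  rewrite big1 // => g /andP[/eqP sg /forallP hg]; move: lt_DA.
  by rewrite -sg ltnNge leq_sum.
pose up (g : {ffun 'I_m -> 'I_N}) : {ffun 'I_m -> 'I_N} := [ffun a : 'I_m => insubd (g a) (A a + g a)%N].
pose dn (g : {ffun 'I_m -> 'I_N}) : {ffun 'I_m -> 'I_N} := [ffun a : 'I_m => insubd (g a) (g a - A a)%N].
have dnE g (a : 'I_m) : dn g a = (g a - A a)%N :> nat.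
  rewrite ffunE val_insubd; case: ifP => // /negbT/negP[].
  exact: leq_ltn_trans (leq_subr _ _) (ltn_ord (g a)).
have upE (g : {ffun 'I_m -> 'I_N}) (a : 'I_m) : (A a + g a < N)%N -> up g a = (A a + g a)%N :> nat.
  by move=> lt; rewrite ffunE val_insubd lt.
rewrite (reindex_onto up dn) /=; last first.
  move=> g /andP[_ /forallP le_A]; apply/ffunP=> a; apply: val_inj => /=.
  by rewrite upE dnE subnKC // ltn_ord.
have key (g : {ffun 'I_m -> 'I_N}) :
   [&& (\sum_a (up g a : nat) == D)%N, [forall a : 'I_m, (A a <= up g a)%N] & dn (up g) == g]
   = (\sum_a (g a : nat) == D - \sum_(a < m) A a)%N /\
   ((\sum_a (g a : nat) == D - \sum_(a < m) A a)%N -> forall a : 'I_m, (A a + g a < N)%N).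
  have lt_of : (\sum_a (g a : nat) == D - \sum_(a < m) A a)%N -> forall a : 'I_m, (A a + g a < N)%N.
    move=> /eqP sg a; apply: leq_ltn_trans lt_DN; rewrite -(subnKC le_AD) -sg.
    by apply: leq_add; [rewrite (bigD1 a) //= leq_addr | rewrite [leqRHS](bigD1 a) //= leq_addr].
  split=> //; apply/and3P/idP => [[/eqP su /forallP hu /eqP du]|sg].
    have lt (a : 'I_m) : (A a + g a < N)%N.
      rewrite ltnNge; apply/negP => ge.
      have e : up g a = g a by apply: val_inj; rewrite ffunE val_insubd ltnNge ge.
      have := congr1 (fun f : {ffun 'I_m -> 'I_N} => f a : nat) du; rewrite dnE e.
      by have := hu a; have := ltn_ord (g a); rewrite e; lia.
    rewrite -su; under [X in (X - _)%N]eq_bigr => a _ do rewrite upE //.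
    by rewrite big_split /= addKn.
  have lt := lt_of sg; split.
  - under eq_bigr => a _ do rewrite upE //.
    by rewrite big_split /= (eqP sg) subnKC.
  - by apply/forallP => a; rewrite upE ?leq_addr.
  - by apply/eqP/ffunP=> a; apply: val_inj => /=; rewrite dnE upE // addKn.
apply: eq_big => [g|g]; first by have [<- _] := key g; rewrite andbA.
rewrite -andbA => hg; have [e lt] := key g; rewrite e in hg.
by apply: Fext => a am; rewrite (extzE _ (Ordinal am)) upE ?lt // (extzE _ (Ordinal am)).
Qed.

(** Upper bounds that the vanishing of [F] enforces allow passing to complements in [B]. The
    reflected summand carries a guard because the subtraction is truncated. *)
Lemma csum_reflect m R (F : (nat -> nat) -> K) (B : nat -> nat) :
  (\sum_(a < m) B a < N)%N -> (R < N)%N ->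
  (forall p p', (forall a, (a < m)%N -> p a = p' a) -> F p = F p') ->
  (forall p a, (a < m)%N -> (B a < p a)%N -> F p = 0) ->
  csum m R F = if (R <= \sum_(a < m) B a)%N
    then csum m (\sum_(a < m) B a - R)
      (fun p => if [forall a : 'I_m, (p a <= B a)%N] then F (fun a => B a - p a)%N else 0) else 0.
Proof.
move=> lt_BN lt_RN Fext Fv.
have Fv' (g : {ffun 'I_m -> 'I_N}) : ~~ [forall a : 'I_m, (g a <= B a)%N] -> F (extz (fun a => g a)) = 0.
  by rewrite negb_forall => /existsP[a]; rewrite -ltnNge => lt; apply: (Fv _ a); rewrite ?extzE.
rewrite /csum (bigID (fun g : {ffun 'I_m -> 'I_N} => [forall a : 'I_m, (g a <= B a)%N])) /=.
rewrite [X in _ + X]big1 ?addr0; last by move=> g /andP[_ /Fv'].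
case: leqP => [le_RB|lt_BR]; last first.
  rewrite big1 // => g /andP[/eqP sg /forallP hg]; move: lt_BR.
  by rewrite -sg ltnNge leq_sum.
pose rf (g : {ffun 'I_m -> 'I_N}) : {ffun 'I_m -> 'I_N} := [ffun a : 'I_m => insubd (g a) (B a - g a)%N].
have B_lt (a : 'I_m) : (B a < N)%N.
  by apply: leq_ltn_trans lt_BN; rewrite (bigD1 a) //= leq_addr.
have rfE g (a : 'I_m) : rf g a = (B a - g a)%N :> nat.
  rewrite ffunE val_insubd; case: ifP => // /negbT/negP[].
  exact: leq_ltn_trans (leq_subr _ _) (B_lt a).
rewrite (reindex_onto rf rf) /=; last first.
  move=> g /andP[_ /forallP le_B]; apply/ffunP=> a; apply: val_inj => /=.
  by rewrite !rfE subKn.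
rewrite [RHS](bigID (fun g : {ffun 'I_m -> 'I_N} => [forall a : 'I_m, (g a <= B a)%N])) /=.
rewrite [X in _ = _ + X]big1 ?addr0; last first.
  move=> g /andP[_]; rewrite negb_forall => /existsP[a h1]; case: ifP => // /forallP /(_ a).
  by rewrite extzE (negPf h1).
apply: eq_big => [g|g].
  apply/andP/andP => [[/andP[/eqP sr _] /eqP rr]|[/eqP sg /forallP hg]].
    have hg (a : 'I_m) : (g a <= B a)%N.
      have := congr1 (fun f : {ffun 'I_m -> 'I_N} => f a : nat) rr; rewrite !rfE => <-.
      exact: leq_subr.
    split; last by apply/forallP.
    rewrite -sr; under [X in (_ == _ - X)%N]eq_bigr => a _ do rewrite rfE.
    rewrite sumnB; last by move=> a _; apply: hg.
    by rewrite subKn // leq_sum.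
  split; last by apply/eqP/ffunP=> a; apply: val_inj => /=; rewrite !rfE subKn.
  apply/andP; split; last by apply/forallP => a; rewrite rfE leq_subr.
  under eq_bigr => a _ do rewrite rfE.
  by rewrite sumnB ?sg ?subKn // => a _; apply: hg.
move=> /andP[_ /eqP rr].
have hg (a : 'I_m) : (g a <= B a)%N.
  have := congr1 (fun f : {ffun 'I_m -> 'I_N} => f a : nat) rr; rewrite !rfE => <-.
  exact: leq_subr.
have -> : [forall a : 'I_m, (extz (fun a0 : 'I_m => g a0) a <= B a)%N] by apply/forallP=> a; rewrite extzE.
by apply: Fext => a am; rewrite (extzE _ (Ordinal am)) rfE (extzE _ (Ordinal am)).
Qed.

End CompositionSums.

(** * The duality for the integers at one vertex *)

Section LocalDuality.
Variables (K : fieldType) (q h : K).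
Hypothesis q0 : q != 0.
Hypothesis h0 : h != 0.
Hypothesis hq_inj : forall a b c d, h ^+ a * q ^+ b = h ^+ c * q ^+ d -> a = c /\ b = d.

Definition zpoch (x : K) (d : int) : K :=
  match d with
  | Posz m => \prod_(0 <= i < m) (1 - x * q ^+ i)
  | Negz m => \prod_(1 <= i < m.+2) (1 - x * q ^- i)^-1
  end.

Definition zpochq (x : K) (d : int) : K := zpoch (h * x) d / zpoch (q * x) d.

Lemma hq_eq1 (s t : int) : h ^ s * q ^ t = 1 -> s = 0 /\ t = 0.
Proof.
have qn n : q ^+ n != 0 by rewrite expf_neq0.
have hn n : h ^+ n != 0 by rewrite expf_neq0.
case: s t => [s|s] [t|t]; rewrite ?NegzE -?exprnN -?exprnP => /eqP.
- have -> : (1 = h ^+ 0 * q ^+ 0) by rewrite mulr1.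
  by move=> /eqP /hq_inj [-> ->].
- rewrite -(inj_eq (mulIf (qn t.+1))) divfK // mul1r => /eqP e.
  by have := @hq_inj s 0 0 t.+1; rewrite mulr1 mul1r => /(_ e) [].
- rewrite -(inj_eq (mulfI (hn s.+1))) mulrA divff // mul1r mulr1 => /eqP e.
  by have := @hq_inj 0 t s.+1 0; rewrite mulr1 mul1r => /(_ e) [].
- rewrite -invfM invr_eq1 => /eqP e.
  by have := @hq_inj s.+1 t.+1 0 0; rewrite mulr1 => /(_ e) [].
Qed.

Lemma q_free k : q ^+ k.+1 != 1.
Proof. by apply/eqP=> e; have [] := @hq_eq1 0 k.+1; rewrite ?expr0z ?mul1r. Qed.

Lemma r_free k : (h / q) ^+ k.+1 != 1.
Proof.
apply/eqP=> e; have [] := @hq_eq1 k.+1 (- k.+1%:Z) => //.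
by rewrite -exprnN -exprVn -exprMn.
Qed.

Lemma zpoch_nat x (g : nat) : zpoch x g = poch q x g.
Proof. by rewrite /zpoch /poch big_mkord. Qed.

Lemma zpochq_nat x (g : nat) : zpochq x g = pochq q h x g.
Proof. by rewrite /zpochq !zpoch_nat. Qed.

Lemma zpochq0 x : zpochq x 0 = 1.
Proof. by rewrite (zpochq_nat x 0) pochq0. Qed.

(** For negative d the factors 1 - x q^(-i) must not vanish, since a vanishing one would be inverted
    to 0 and could not be cancelled. *)
Lemma zpoch_succ x (d : int) : 0 <= d \/ (forall i, x != q ^+ i.+1) ->
  zpoch x (d + 1) = zpoch x d * (1 - x * q ^ d).
Proof.
case: d => [d _|d [//|hx]]; first by rewrite -PoszD addn1 /zpoch big_nat_recr.
have nz i : 1 - x * q ^- i.+1 != 0.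
  rewrite subr_eq0 eq_sym -(inj_eq (mulIf (expf_neq0 i.+1 q0))) mul1r divfK ?expf_neq0 //.
rewrite [zpoch x (Negz d)]/= big_nat_recr //= divfK //.
have -> : Negz d + 1 = - d%:Z by lia.
by case: d => [|d]; [rewrite oppr0 (zpoch_nat x 0) /poch big_ord0 big_geq | rewrite -NegzE].
Qed.

Lemma zpoch_add x (d : int) (g : nat) : 0 <= d \/ (forall i, x != q ^+ i.+1) ->
  zpoch x (d + g) = zpoch x d * poch q (x * q ^ d) g.
Proof.
move=> hd; elim: g => [|g IHg]; first by rewrite addr0 /poch big_ord0 mulr1.
rewrite -addn1 PoszD addrA zpoch_succ; last by case: hd => [d0|]; [left; rewrite addr_ge0|right].
rewrite IHg pochD mulrA; congr (_ * _).
by rewrite /poch big_ord1 mulr1 expfzDr // -mulrA.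
Qed.

Lemma zpochq_add (s d : int) (g : nat) : s != 0 \/ 0 <= d ->
  zpochq (h ^ s) (d + g) = zpochq (h ^ s) d * pochq q h (h ^ s * q ^ d) g.
Proof.
move=> hs; rewrite /zpochq /pochq !zpoch_add -?mulf_div ?mulrA //.
  case: hs => [s0|]; [right=> i|by left]; apply/eqP=> e.
  have [] := @hq_eq1 s (- i%:Z); last by move/eqP: s0.
  have e' : h ^ s = q ^+ i by apply: (mulfI q0); rewrite -exprS.
  by rewrite -exprnN e' divff // expf_neq0.
right=> i; apply/eqP=> e; have [] := @hq_eq1 (s + 1) (- i.+1%:Z) => //.
by rewrite expfzDr // expr1z -exprnN -e [h ^ s * h]mulrC divff // mulf_neq0 // expfz_neq0.
Qed.

Lemma zpochq_neq0 (s d : int) : (s = -1 -> d <= 0) -> (s = 0 -> 0 <= d) ->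
  zpochq (h ^ s) d != 0.
Proof.
have nz1 (a b : int) : a != 0 \/ b != 0 -> 1 - h ^ a * q ^ b != 0.
  by move=> ab; rewrite subr_eq0 eq_sym; apply/eqP=> /hq_eq1[a0 b0]; case: ab; rewrite ?a0 ?b0.
move=> h1 h2; rewrite /zpochq mulf_neq0 ?invr_eq0 //.
  case: d h1 h2 => d h1 h2; rewrite /zpoch.
    rewrite big_mkord; apply/prodf_neq0 => i _.
    have -> : h * h ^ s * q ^+ i = h ^ (s + 1) * q ^ i by rewrite expfzDr // expr1z [h * _]mulrC.
    by apply: nz1; left; apply/eqP=> e; have := ltn_ord i; have := h1 (_ : s = -1); lia.
  rewrite big_add1 /= big_mkord; apply/prodf_neq0 => i _.
  have -> : h * h ^ s * q ^- i.+1 = h ^ (s + 1) * q ^ (- i.+1%:Z).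
    by rewrite expfzDr // expr1z -exprnN [h * _]mulrC.
  by rewrite invr_eq0; apply: nz1; right; lia.
case: d h1 h2 => d h1 h2; rewrite /zpoch.
  rewrite big_mkord; apply/prodf_neq0 => i _.
  have -> : q * h ^ s * q ^+ i = h ^ s * q ^ (i%:Z + 1) by rewrite expfzDr // expr1z [q * _]mulrC -mulrA [q * _]mulrC.
  by apply: nz1; right; lia.
rewrite big_add1 /= big_mkord; apply/prodf_neq0 => i _.
have -> : q * h ^ s * q ^- i.+1 = h ^ s * q ^ (1 - i.+1%:Z) by rewrite expfzDr // expr1z -exprnN [q * _]mulrC -mulrA.
by rewrite invr_eq0; apply: nz1; left; apply/eqP=> s0; have := h2 s0.
Qed.

(** These zeros encode the order relations: the symbol forces d <= 0 for s = -1 and d >= 0 for s =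
    0. *)
Lemma zpochq_eq0 (s d : int) : (s = -1) /\ (0 < d) \/ (s = 0) /\ (d < 0) ->
  zpochq (h ^ s) d = 0.
Proof.
case: d => d [[-> d0]|[-> d0]] //; rewrite /zpochq /zpoch.
  case: d d0 => // d _; rewrite big_nat_recl // exprN1 divff // mulr1 subrr !mul0r //.
(* The symbol (q)_d has a pole here. The convention [0^-1 = 0] sends it to 0 and its inverse to 0 as
   well, which is the right value of the quotient. *)
by rewrite [X in _ / X]big_ltn // expr0z !mulr1 expr1 divff // subrr invr0 mul0r invr0 mulr0.
Qed.

(** Turns an arrow leaving a vertex into one entering it: the weight of the neighbour gains a factor
    hbar and a power of q / hbar splits off. *)
Lemma zpochq_rev x (d : int) : x != 0 ->
  zpochq x (- d) = (q / h) ^ d * zpochq (h * x)^-1 d.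
Proof.
have pos y (g : nat) : y != 0 -> zpochq y (- g%:Z) = (q / h) ^+ g * zpochq (h * y)^-1 g.
  move=> y0; case: g => [|g]; first by rewrite oppr0 !zpochq0 mulr1.
  rewrite -NegzE /zpochq /zpoch !big_add1 /= !big_mkord -!prodfV -!big_split /=.
  rewrite -[X in _ ^+ X]card_ord -prodr_const -big_split /=; apply: eq_bigr => i _.
  have qi : q ^+ i != 0 by rewrite expf_neq0.
  have -> : 1 - h * y * q ^- i.+1 = - (h * y * q ^- i.+1) * (1 - q * (h * y)^-1 * q ^+ i).
    by rewrite exprS; field; rewrite ?q0 ?qi ?h0 ?y0.
  have -> : 1 - q * y * q ^- i.+1 = - (y * q ^- i) * (1 - h * (h * y)^-1 * q ^+ i).
    by rewrite exprS; field; rewrite ?q0 ?qi ?h0 ?y0.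
  have AC : (- (h * y * q ^- i.+1))^-1 * (- (y * q ^- i)) = q / h.
    by rewrite exprS; field; rewrite ?q0 ?qi ?h0 ?y0 ?oppr_eq0 ?mulf_neq0.
  have gen (A B C D : K) : A^-1 * C = q / h -> (A * B)^-1 / (C * D)^-1 = q / h * (D / B).
    by move=> <-; rewrite invrK invfM mulrACA [B^-1 * _]mulrC.
  exact: gen.
move=> x0; case: (intP d) => [|g|g]; first by rewrite oppr0 !zpochq0 mulr1.
  by rewrite pos.
rewrite opprK; have hx0 : (h * x)^-1 != 0 by rewrite invr_eq0 mulf_neq0.
rewrite (pos _ g.+1 hx0) mulrA -exprnN mulVf ?mul1r.
  by rewrite [(h * x)^-1]invfM mulrA divff // mul1r invrK.
by rewrite expf_neq0 // mulf_neq0 ?invr_eq0.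
Qed.

Lemma expz_sum (x : K) (I : Type) (r : seq I) (P : pred I) (F : I -> int) : x != 0 ->
  x ^ (\sum_(i <- r | P i) F i) = \prod_(i <- r | P i) x ^ F i.
Proof. by move=> x0; apply: (big_morph (fun z => x ^ z)) => // a b; rewrite expfzDr. Qed.

Lemma hdiv (a b : nat) : h ^+ a / h ^+ b = h ^ (a%:Z - b%:Z).
Proof. by rewrite expfzDr // -exprnN. Qed.

Lemma qdiv (a b : nat) : q ^+ a / q ^+ b = q ^ (a%:Z - b%:Z).
Proof. by rewrite expfzDr // -exprnN. Qed.

Lemma pochq_neq0 (s t : int) (g : nat) :
  (s = -1 -> forall i, (i < g)%N -> t + i%:Z != 0) ->
  (s = 0 -> forall i, (i < g)%N -> t + i.+1%:Z != 0) ->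
  pochq q h (h ^ s * q ^ t) g != 0.
Proof.
have nz1 (a b : int) : a != 0 \/ b != 0 -> 1 - h ^ a * q ^ b != 0.
  by move=> ab; rewrite subr_eq0 eq_sym; apply/eqP=> /hq_eq1[a0 b0]; case: ab; rewrite ?a0 ?b0.
move=> h1 h2; rewrite /pochq mulf_neq0 ?invr_eq0 //; apply/prodf_neq0 => i _.
  have -> : h * (h ^ s * q ^ t) * q ^+ i = h ^ (s + 1) * q ^ (t + i%:Z).
    by rewrite !expfzDr // expr1z [h * _]mulrC -!mulrA [q ^ t * (h * _)]mulrCA.
  by apply: nz1; have [e|e] := eqVneq s (-1); [right; apply: h1 | left; lia].
have -> : q * (h ^ s * q ^ t) * q ^+ i = h ^ s * q ^ (t + i.+1%:Z).
  by rewrite expfzDr // exprSz mulrCA -!mulrA; congr (_ * _); rewrite mulrCA.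
by apply: nz1; have [e|e] := eqVneq s 0; [right; apply: h2 | left].
Qed.

Lemma zpoch_neg x (g : nat) : zpoch x (- g%:Z) = (poch q (x * q ^- g) g)^-1.
Proof.
case: g => [|g]; first by rewrite oppr0 (zpoch_nat x 0) /poch !big_ord0 invr1.
rewrite -NegzE /zpoch /poch big_add1 /= big_mkord -prodfV (reindex_inj rev_ord_inj) /=.
apply: eq_bigr => i _; congr (1 - _)^-1; rewrite -mulrA; congr (_ * _).
have lt_i := ltn_ord i.
have e : q ^+ g.+1 = q ^+ i * q ^+ (g.+1 - i) by rewrite -exprD; congr (_ ^+ _); lia.
rewrite e invfM subSS -subSn -1?ltnS // mulrAC mulVf ?mul1r //.
by rewrite expf_neq0.
Qed.

Lemma pochq_flip x (g : nat) : x != 0 ->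
  (pochq q h (x * q ^- g) g)^-1 = (q / h) ^+ g * pochq q h (h * x)^-1 g.
Proof.
move=> x0; transitivity (zpochq x (- g%:Z)); last by rewrite zpochq_rev // zpochq_nat.
by rewrite /zpochq !zpoch_neg /pochq !mulrA invrK invf_div mulrC.
Qed.

Section Chain.
Variable e : nat -> nat.
Hypothesis e_lt : forall a, (e a < e a.+1)%N.

Lemma e_mono a b : (a < b)%N -> (e a + (b - a) <= e b)%N.
Proof.
elim: b => // b IHb; rewrite ltnS leq_eqVlt => /predU1P[->|/[dup] lt /IHb].
  by have := e_lt b; rewrite subSnn addn1.
by have := e_lt b; lia.
Qed.

Lemma e_inj a b : e a = e b -> a = b.
Proof. by case: (ltngtP a b) => // /[dup] ? /e_mono; lia. Qed.

Lemma e_succ a b : e b = (e a).+1 -> b = a.+1.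
Proof. by case: (ltngtP a b) => [/[dup] ? /e_mono|/[dup] ? /e_mono|->]; lia. Qed.

(** The factors of the vertex weight that involve the integers at one vertex. A pair in [ys] holds
    the hbar-exponent and the value of a neighbouring cell; [e] lists the exponents at the vertex
    itself. *)
Definition Gwt (M : nat) (ys : seq (nat * nat)) (p : nat -> nat) : K :=
  (\prod_(a < M) \prod_(y <- ys) zpochq (h ^+ e a / h ^+ y.1) ((p a)%:Z - y.2%:Z)) *
  \prod_(a < M) \prod_(a' < M) (zpochq (h ^+ e a' / h ^+ e a) ((p a')%:Z - (p a)%:Z))^-1.

(** The configuration of 2m + 1 neighbours to which the duality applies: (e c, A c) bounds the c-th
    integer from below by A c, and (e b + 1, B b) bounds the b-th one from above by B b. *)
Definition nbrs (m : nat) (A B : nat -> nat) : seq (nat * nat) :=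
  (e 0%N, A 0%N) :: flatten [seq [:: ((e a).+1, B a); (e a.+1, A a.+1)] | a <- iota 0 m].

Lemma big_nbrs (R : Type) (idx : R) (op : Monoid.com_law idx) m A B (f : nat * nat -> R) :
  \big[op/idx]_(y <- nbrs m A B) f y = op (\big[op/idx]_(c < m.+1) f (e c, A c))
                                  (\big[op/idx]_(b < m) f ((e b).+1, B b)).
Proof.
rewrite big_cons big_flatten big_map big_ord_recl -Monoid.mulmA; congr (op _ _).
have -> : iota 0 m = index_iota 0 m by rewrite /index_iota subn0.
rewrite big_mkord; etransitivity; last exact: big_split.
apply: eq_bigr => b _; rewrite !big_cons big_nil Monoid.mulm1 Monoid.mulmC.
by rewrite lift0.
Qed.

Lemma Gwt_ext M ys p p' : (forall a, (a < M)%N -> p a = p' a) -> Gwt M ys p = Gwt M ys p'.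
Proof.
move=> pp'; rewrite /Gwt; congr (_ * _); apply: eq_bigr => a _.
  by apply: eq_bigr => y _; rewrite pp'.
by apply: eq_bigr => a' _; rewrite !pp'.
Qed.

Lemma Gwt_vanish M ys p y a : y \in ys -> (a < M)%N ->
  (y.1 = e a /\ (p a < y.2)%N) \/ (y.1 = (e a).+1 /\ (y.2 < p a)%N) -> Gwt M ys p = 0.
Proof.
move=> yys aM hy; rewrite /Gwt (bigD1 (Ordinal aM)) //= (big_rem y) //= hdiv.
rewrite zpochq_eq0 ?mul0r //; case: hy => [[-> lt]|[-> lt]].
  by right; rewrite subrr; split=> //; lia.
by left; split; lia.
Qed.

Variables (m : nat) (A B : nat -> nat).
Hypothesis AB : forall a, (a < m)%N -> (A a <= B a)%N.
Hypothesis BA : forall a, (a < m)%N -> e a.+1 = (e a).+1 -> (B a <= A a.+1)%N.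

(** The displaced variables q^(g a) u_a are hbar^(e a) q^(p a) for p = A + g. Since u_a w_b = h^(e a
    - e b - 1) q^(A a - B b), the hypothesis [BA] rules out poles. *)
Let u (a : 'I_m.+1) : K := h ^+ e a * q ^+ A a.
Let w (b : 'I_m) : K := (h ^+ (e b).+1 * q ^+ B b)^-1.

Let qn n : q ^+ n != 0. Proof. by rewrite expf_neq0. Qed.
Let hn n : h ^+ n != 0. Proof. by rewrite expf_neq0. Qed.

(** [Gbase] and [Gbase'] are the cross terms at the extreme configurations p = A and p = B. *)
Definition Gbase : K :=
  \prod_(a < m.+1) \prod_(b < m) zpochq (h ^+ e a / h ^+ (e b).+1) ((A a)%:Z - (B b)%:Z).
Definition Gbase' : K :=
  \prod_(b < m) \prod_(c < m.+1) zpochq (h ^+ e b / h ^+ e c) ((B b)%:Z - (A c)%:Z).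

Let pochq_vanish a g : (A a <= B a)%N -> (B a < A a + g)%N ->
  pochq q h (h ^+ e a * q ^+ A a / (h ^+ (e a).+1 * q ^+ B a)) g = 0.
Proof.
move=> le lt; have lt' : (B a - A a < g)%N by lia.
rewrite /pochq /poch (bigD1 (Ordinal lt')) //=.
rewrite [X in 1 - X](_ : _ = 1) ?subrr ?mul0r //.
have -> : q ^+ B a = q ^+ A a * q ^+ (B a - A a) by rewrite -exprD subnKC.
by rewrite /= exprS; field; rewrite ?h0 ?hn ?qn.
Qed.

(** The symbols of [p a] against the lower bound [A c] and against [p c] differ by a symbol of
    length g c; their quotients make up [wtT]. The symbols against the upper bounds give [Gbase] and
    [wtX]. *)
Lemma Gwt_upper (g : nat -> nat) :
  Gwt m.+1 (nbrs m A B) (fun a => A a + g a)%N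
  = Gbase * (wtT q h u (fun a => g a) * wtX q h u w (fun a => g a)).
Proof.
set p := fun a => (A a + g a)%N.
(* When two exponents are adjacent and the order is violated, a divisor in [Gwt] is 0, so the left
   side is 0; the right side is 0 because p a exceeds the upper bound B a. *)
have [/forallP good|] := boolP [forall a : 'I_m, (e a.+1 == (e a).+1) ==> (p a <= p a.+1)%N]; last first.
  rewrite negb_forall => /existsP[a]; rewrite negb_imply -ltnNge => /andP[/eqP ea lt].
  pose a0 := widen_ord (leqnSn m) a; pose a1 := lift ord0 a.
  have am := ltn_ord a; have := AB am; have := BA am ea => B1 B2.
  have -> : Gwt m.+1 (nbrs m A B) p = 0.
    rewrite /Gwt [X in _ * X](bigD1 a1) //= [X in _ * (X * _)](bigD1 a0) //=.
    rewrite /bump leq0n add1n hdiv zpochq_eq0 ?invr0 ?mul0r ?mulr0 //.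
    by left; rewrite ea; lia.
  rewrite /wtX (bigD1 a0) //= (bigD1 a) //= /u /w /= pochq_vanish // ?mul0r ?mulr0 //.
  by move: lt; rewrite /p; lia.
have {}good a a' : (a < m.+1)%N -> (a' < m.+1)%N -> e a' = (e a).+1 -> (p a <= p a')%N.
  move=> am a'm /[dup] /e_succ ea'; rewrite ea' in a'm * => ea.
  by have := good (Ordinal (a'm : a < m)%N); rewrite /= ea eqxx.
rewrite /Gwt; under eq_bigr => a _ do rewrite big_nbrs /=.
rewrite big_split /= [X in _ * _ * X]exchange_big /= mulrAC -big_split /=.
rewrite [RHS]mulrCA; congr (_ * _).
  apply: eq_bigr => a _; rewrite -big_split /=; apply: eq_bigr => c _.
  rewrite hdiv; set s := _ - _.
  have -> : (p a)%:Z - (A c)%:Z = ((p a)%:Z - (p c)%:Z) + g c by rewrite /p; lia.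
  have s0 : s = 0 -> a = c by move=> /eqP; rewrite subr_eq0 => /eqP[] /e_inj /val_inj.
  rewrite zpochq_add; last by have [/s0->|] := eqVneq s 0; [right; rewrite subrr | left].
  rewrite mulrAC divff ?mul1r; last first.
    apply: zpochq_neq0 => [s1|/s0 ->]; last by rewrite subrr.
    by rewrite subr_le0 lez_nat; apply: good => //; lia.
  congr (pochq _ _ _ _); rewrite /u /p /s expfzDr // -exprnN.
  rewrite expfzDr // -exprnN -!exprnP !exprD; field; rewrite ?hn ?qn //.
rewrite /Gbase /wtX -big_split; apply: eq_bigr => a _; rewrite -big_split; apply: eq_bigr => b _ /=.
have -> : (p a)%:Z - (B b)%:Z = ((A a)%:Z - (B b)%:Z) + g a by rewrite /p; lia.
rewrite hdiv zpochq_add; last first.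
  have [s0|] := eqVneq ((e a)%:Z - ((e b).+1)%:Z) 0; last by left.
  have ea : e a = (e b).+1 by lia.
  by right; rewrite subr_ge0 lez_nat (e_succ ea); apply: BA => //; rewrite -(e_succ ea).
congr (_ * pochq _ _ _ _); rewrite /u /w expfzDr // -exprnN expfzDr // -exprnN -!exprnP invfM.
by rewrite mulrACA.
Qed.

Lemma prod_const_exp (I : finType) (P : pred I) (x : K) (F : I -> nat) :
  \prod_(i | P i) x ^+ F i = x ^+ (\sum_(i | P i) F i).
Proof. by rewrite expr_sum. Qed.

Lemma Gwt_lower_vanish (d : 'I_m -> nat) (b : 'I_m) : (B b < A b + d b)%N ->
  wtX q h w u d = 0.
Proof.
move=> lt; pose b0 := widen_ord (leqnSn m) b; have bm := ltn_ord b; have b1 := AB bm.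
by rewrite /wtX (bigD1 b) //= (bigD1 b0) //= /u /w /= [X in pochq _ _ X _]mulrC pochq_vanish // ?mul0r ?mulr0.
Qed.

(** The m integers are now measured downwards from their upper bounds. Reversing the symbols yields,
    per unit of [d], m + 1 factors q / h from the lower bounds and m from the integers and upper
    bounds among themselves. *)
Lemma Gwt_lower (d : nat -> nat) : (forall b, (b < m)%N -> (d b <= B b)%N) ->
  Gwt m (nbrs m A B) (fun b => B b - d b)%N
  = Gbase' * (q / h) ^+ (m.*2.+1 * \sum_(b < m) d b) *
    (wtT q h w (fun b => d b) * wtX q h w u (fun b => d b)).
Proof.
move=> dB; set p := fun b => (B b - d b)%N.
have [/forallP good|] := boolP [forall b : 'I_m, (A b <= p b)%N]; last first.
  rewrite negb_forall => /existsP[b]; rewrite -ltnNge => lt.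
  have bm := ltn_ord b; have b1 := AB bm; have b2 := dB b bm.
  pose b0 := widen_ord (leqnSn m) b.
  have -> : Gwt m (nbrs m A B) p = 0.
    rewrite /Gwt (bigD1 b) //= big_nbrs /= (bigD1 b0) //= hdiv zpochq_eq0 ?mul0r //.
    by right; lia.
  rewrite (@Gwt_lower_vanish _ b) ?mulr0 //.
  by move: lt; rewrite /p; lia.
have {}good b : (b < m)%N -> (A b <= p b)%N by move=> bm; apply: (good (Ordinal bm)).
have pE b : (b < m)%N -> (p b)%:Z = (B b)%:Z - (d b)%:Z.
  by move=> bm; have := dB b bm; rewrite /p; lia.
rewrite /Gwt; under eq_bigr => b _ do rewrite big_nbrs /=.
rewrite big_split /= -[LHS]mulrA -[X in _ * X = _]big_split /=.
match goal with |- ?x * ?y = _ => set Q1 := x; set Q2 := y end.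
have -> : Q1 = Gbase' * (q / h) ^+ (m.+1 * \sum_(b < m) d b) * wtX q h w u (fun b => d b).
  rewrite big_distrr /= -prod_const_exp /Gbase' /wtX -!big_split; apply: eq_bigr => b _ /=.
  have bm := ltn_ord b.
  rewrite mulnC exprM -[m.+1 in X in _ * X * _]card_ord -prodr_const -!big_split.
  apply: eq_bigr => c _ /=; rewrite hdiv; set s := _ - _.
  have s0 : s = 0 -> (b : nat) = c by move=> /eqP; rewrite subr_eq0 => /eqP[] /e_inj.
  have s1 : s = -1 -> (B b <= A c)%N.
    rewrite /s => e1; have ec : e c = (e b).+1 by lia.
    by rewrite (e_succ ec); apply: BA => //; rewrite -(e_succ ec).
  have pb := pE b bm.
  have -> : (B b)%:Z - (A c)%:Z = ((p b)%:Z - (A c)%:Z) + d b by lia.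
  rewrite zpochq_add; last first.
    by have [/s0 <-|] := eqVneq s 0; [right; rewrite subr_ge0 lez_nat; apply: good | left].
  set t := (p b)%:Z - (A c)%:Z.
  have x0 : h ^ s * q ^ (t + d b) != 0 by rewrite mulf_neq0 // expfz_neq0.
  have := pochq_flip (d b) x0; rewrite expfzDr // mulrA mulfK //.
  have nz : pochq q h (h ^ s * q ^ t) (d b) != 0.
    apply: pochq_neq0 => [/s1 le i lt|/s0 bc i lt].
      by rewrite /t pb; lia.
    by have := good _ bm; rewrite /t bc; lia.
  have -> : w b * u c = (h * (h ^ s * q ^ t * q ^ d b))^-1.
    have -> : h ^ s * q ^ t * q ^ d b = h ^+ e b / h ^+ e c * (q ^+ B b / q ^+ A c).
      rewrite hdiv qdiv -mulrA -expfzDr //; congr (_ * _ ^ _).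
      by rewrite /t pb; lia.
    by rewrite /w /u exprS; field; rewrite ?h0 ?qn ?hn.
  by move=> E; rewrite -[RHS]mulrA -E mulfK.
  by rewrite expfz_neq0.
have -> : Q2 = (q / h) ^+ (m * \sum_(b < m) d b) * wtT q h w (fun b => d b).
  have r0 : q / h != 0 by rewrite mulf_neq0 ?invr_eq0.
  have -> : (q / h) ^+ (m * \sum_(b < m) d b) =
    \prod_(b < m) \prod_(b' < m) (q / h) ^ ((B b')%:Z - (p b)%:Z).
    transitivity (\prod_(b < m) (q / h) ^ (\sum_(b' < m) ((B b')%:Z - (p b)%:Z))); last first.
      by apply: eq_bigr => b _; rewrite expz_sum.
    rewrite -expz_sum // exprnP; congr (_ ^ _).
    have -> : \sum_(b < m) \sum_(b' < m) ((B b')%:Z - (p b)%:Z)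
        = \sum_(b < m) \sum_(b' < m) (B b')%:Z - \sum_(b < m) \sum_(b' < m) (p b)%:Z.
      by rewrite -sumrB; apply: eq_bigr => b _; rewrite sumrB.
    rewrite [X in _ - X]exchange_big -sumrB /=.
    rewrite (eq_bigr (fun=> (\sum_(b < m) d b)%:Z)); last first.
      move=> b _; rewrite -sumrB; rewrite (big_morph Posz PoszD (erefl _)).
      by apply: eq_bigr => b' _; rewrite pE //; lia.
    by rewrite sumr_const card_ord PoszM -mulr_natl natz.
  rewrite /wtT -big_split; apply: eq_bigr => b _; rewrite -!big_split; apply: eq_bigr => b' _ /=.
  have bm := ltn_ord b; have b'm := ltn_ord b'; have pb := pE _ bm; have pb' := pE _ b'm.
  have -> : (p b)%:Z - (B b')%:Z = - ((B b')%:Z - (p b)%:Z) by rewrite opprB.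
  rewrite zpochq_rev ?mulf_neq0 ?invr_eq0 // -[LHS]mulrA; congr (_ * _).
  have -> : (h * (h ^+ e b / h ^+ (e b').+1))^-1 = h ^ ((e b')%:Z - (e b)%:Z).
    by rewrite -hdiv exprS; field; rewrite ?h0 ?hn.
  rewrite hdiv; set s := _ - _.
  have s0 : s = 0 -> b = b' by move=> /eqP; rewrite subr_eq0 => /eqP[] /e_inj /val_inj.
  have -> : (B b')%:Z - (p b)%:Z = ((p b')%:Z - (p b)%:Z) + d b' by lia.
  rewrite zpochq_add; last by have [/s0->|] := eqVneq s 0; [right; rewrite subrr | left].
  rewrite mulrAC divff ?mul1r; last first.
    apply: zpochq_neq0 => [|/s0 ->]; last by rewrite subrr.
    rewrite /s => s1; have eb : e b = (e b').+1 by lia.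
    have := good _ bm; rewrite (e_succ eb); have := BA b'm; rewrite -(e_succ eb) => /(_ eb).
    by lia.
  congr (pochq _ _ _ _).
  have -> : h ^ s * q ^ ((p b')%:Z - (p b)%:Z) =
      h ^+ e b' / h ^+ e b * ((q ^+ B b' / q ^+ d b') / (q ^+ B b / q ^+ d b)).
    rewrite hdiv !qdiv invr_expz -expfzDr //; congr (_ * _ ^ _).
    by rewrite pb pb'; lia.
  by rewrite /w !exprS; field; rewrite ?h0 ?qn ?hn.
have -> : (m.*2.+1 * \sum_(b < m) d b = m.+1 * \sum_(b < m) d b + m * \sum_(b < m) d b)%N.
  by rewrite -mulnDl addSn addnn.
by rewrite exprD; ring.
Qed.

Lemma GbaseE : Gbase = (q / h) ^ (m.+1%:Z * (\sum_(b < m) B b)%:Z - m%:Z * (\sum_(a < m.+1) A a)%:Z) * Gbase'.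
Proof.
have r0 : q / h != 0 by rewrite mulf_neq0 ?invr_eq0.
rewrite /Gbase' [X in _ = _ * X]exchange_big /=.
have -> : m.+1%:Z * (\sum_(b < m) B b)%:Z - m%:Z * (\sum_(a < m.+1) A a)%:Z =
  \sum_(a < m.+1) \sum_(b < m) ((B b)%:Z - (A a)%:Z).
  under [RHS]eq_bigr => a _ do rewrite sumrB sumr_const card_ord.
  rewrite sumrB sumr_const card_ord !(big_morph Posz PoszD (erefl _)) sumrMnl.
  by rewrite -[_ *+ m.+1]mulr_natl -[_ *+ m]mulr_natl !natz.
rewrite expz_sum // -big_split; apply: eq_bigr => a _ /=.
rewrite expz_sum // -big_split; apply: eq_bigr => b _ /=.
have -> : (A a)%:Z - (B b)%:Z = - ((B b)%:Z - (A a)%:Z) by rewrite opprB.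
rewrite zpochq_rev ?mulf_neq0 ?invr_eq0 //; congr (_ * zpochq _ _).
by rewrite exprS; field; rewrite ?h0 ?hn.
Qed.

Let SA := (\sum_(a < m.+1) A a)%N.
Let SB := (\sum_(b < m) B b)%N.

(** Both sides reduce to [Ssum], on the left with total D - SA and on the right with total SB - (SA
    + SB + j - D) = D - SA - j, so j is the index of [dual_rhs]. The bound D <= SA + SB + j guards
    the truncated subtraction; the other terms of [dual_rhs] vanish. *)
Lemma chain_duality N D : (D < N)%N -> (SA + SB + D < N)%N ->
  csum N m.+1 D (Gwt m.+1 (nbrs m A B)) =
  \sum_(j < D.+1 | (D <= SA + SB + j)%N) r q h ^+ (m * j) * pochq q h 1 j *
     (q / h) ^ (m.*2.+1%:Z * (SA + SB + j - D)%N%:Z - m%:Z * (SA + SB)%N%:Z) *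
     csum N m (SA + SB + j - D) (Gwt m (nbrs m A B)).
Proof.
move=> lt_DN lt_YN.
have r0 : q / h != 0 by rewrite mulf_neq0 ?invr_eq0.
have memA c : (c < m.+1)%N -> (e c, A c) \in nbrs m A B.
  rewrite inE; case: c => [|c]; first by rewrite eqxx.
  rewrite ltnS => cm; apply/orP; right; apply/flattenP.
  by exists [:: ((e c).+1, B c); (e c.+1, A c.+1)]; rewrite ?inE ?eqxx ?orbT //; apply/mapP; exists c; rewrite // mem_iota.
have memB b : (b < m)%N -> ((e b).+1, B b) \in nbrs m A B.
  rewrite inE => bm; apply/orP; right; apply/flattenP.
  by exists [:: ((e b).+1, B b); (e b.+1, A b.+1)]; rewrite ?inE ?eqxx ?orbT //; apply/mapP; exists b; rewrite // mem_iota.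
rewrite (@csum_shift _ _ _ _ _ A lt_DN) //; last 2 first.
- exact: Gwt_ext.
- by move=> p a am lt; apply: (Gwt_vanish (memA a am) am); left.
rewrite -/SA.
have lowE j : (D <= SA + SB + j)%N -> (j <= D)%N -> csum N m (SA + SB + j - D) (Gwt m (nbrs m A B)) =
   if (SA + j <= D)%N then Gbase' * (q / h) ^+ (m.*2.+1 * (D - SA - j)) * Ssum q h N w u (D - SA - j) else 0.
  move=> le_D le_j; rewrite (@csum_reflect _ _ _ _ _ B) -/SB; last 4 first.
  - by apply: leq_ltn_trans lt_YN; lia.
  - by lia.
  - exact: Gwt_ext.
  - by move=> p b bm lt; apply: (Gwt_vanish (memB b bm) bm); right.
  have -> : (SA + SB + j - D <= SB)%N = (SA + j <= D)%N by lia.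
  case: leqP => // le_SD; have -> : (SB - (SA + SB + j - D) = D - SA - j)%N by lia.
  rewrite /csum /Ssum mulr_sumr; apply: eq_bigr => d /eqP sd.
  have ext : (fun b : 'I_m => extz (fun b => d b) b) =1 (fun b => d b) by move=> b; rewrite extzE.
  case: ifP => [/forallP dB|/negbT].
    rewrite Gwt_lower; last by move=> b bm; apply: (dB (Ordinal bm)).
    rewrite (wtT_ext _ _ _ ext); congr (_ * _ ^+ (_ * _) * (_ * _)).
      by rewrite -sd; apply: eq_bigr => b _; rewrite extzE.
    by apply: eq_bigr => b _; apply: eq_bigr => c _; rewrite extzE.
  rewrite negb_forall => /existsP[b]; rewrite extzE -ltnNge => lt.
  by rewrite (@Gwt_lower_vanish _ b) ?mulr0 // (leq_trans lt) // leq_addl.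
rewrite (eq_bigr (fun j : 'I_D.+1 => Gbase * (if (SA + j <= D)%N then
    r q h ^+ (m * j) * pochq q h 1 j * Ssum q h N w u (D - SA - j) else 0))); last first.
  move=> j le_D; rewrite lowE //; last by rewrite -ltnS.
  case: ifP => le_SD; rewrite ?mulr0 // GbaseE -/SA -/SB.
  have -> : m.+1%:Z * SB%:Z - m%:Z * SA%:Z = (m.*2.+1%:Z * (SA + SB + j - D)%N%:Z - m%:Z * (SA + SB)%N%:Z)
      + (m.*2.+1 * (D - SA - j))%N%:Z.
    have E1 : (SA + SB + j - D)%N%:Z = SB%:Z - (D - SA - j)%N%:Z by lia.
    by rewrite E1 PoszM -addnn -addSn !PoszD; ring.
  rewrite [in RHS](expfzDr _ _ r0); move: ((q / h) ^ (_ - _)) => Z; rewrite -exprnP.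
  move: (pochq q h 1 j) (Ssum _ _ _ _ _ _) ((q / h) ^+ _) (r q h ^+ _) => x1 x2 x3 x4.
  by ring.
case: leqP => [le_SD|lt_DS]; last first.
  rewrite big1 // => j _; rewrite ifF ?mulr0 //; apply/negbTE; rewrite -ltnNge.
  exact: leq_trans lt_DS (leq_addr _ _).
have lt_SN : (D - SA < N)%N by apply: leq_ltn_trans lt_DN; apply: leq_subr.
have -> : csum N m.+1 (D - SA) (fun p => Gwt m.+1 (nbrs m A B) (fun a => A a + p a)%N)
    = Gbase * Ssum q h N u w (D - SA).
  rewrite /csum /Ssum mulr_sumr; apply: eq_bigr => g _.
  rewrite Gwt_upper; congr (_ * (_ * _)); first by apply: wtT_ext => a; rewrite extzE.
  by apply: eq_bigr => a _; apply: eq_bigr => c _; rewrite extzE.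
rewrite (Ssum_dual_spec q0 h0 q_free r_free lt_SN); last first.
- move=> a b j; apply/eqP; rewrite /u /w => E.
  have {}E : h ^+ e a * q ^+ (j.+1 + A a) = h ^+ (e b).+1 * q ^+ B b.
    by rewrite exprD mulrCA; apply: divr1_eq; rewrite -[LHS]mulrA.
  have [ea qa] := hq_inj E; have := BA (ltn_ord b); rewrite -(e_succ ea) => /(_ ea).
  by rewrite -qa; lia.
- split=> [b|b b' i j ne]; first by rewrite invr_eq0 mulf_neq0.
  apply/eqP => E; case/negP: ne; apply/eqP/val_inj.
  have {}E : h ^+ (e b').+1 * q ^+ (i + B b') = h ^+ (e b).+1 * q ^+ (j + B b).
    rewrite !exprD ![_ ^+ (e _).+1 * _]mulrCA; apply/eqP.
    by rewrite -eqr_div ?mulf_neq0 //; apply/eqP.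
  by have [[/e_inj /= e1] _] := hq_inj E; rewrite /= e1.
- split=> [a|a a' i j ne]; first by rewrite mulf_neq0.
  apply/eqP => E; case/negP: ne; apply/eqP/val_inj.
  have {}E : h ^+ e a * q ^+ (i + A a) = h ^+ e a' * q ^+ (j + A a').
    by rewrite !exprD ![h ^+ e _ * _]mulrCA.
  by have [/e_inj /= e1 _] := hq_inj E; rewrite /= e1.
rewrite /dual_rhs -mulr_sumr; congr (_ * _).
rewrite (big_ord_widen D.+1 (fun j => r q h ^+ (m * j) * pochq q h 1 j * Ssum q h N w u (D - SA - j))) ?ltnS ?leq_subr //.
rewrite big_mkcond [RHS]big_mkcond /=; apply: eq_bigr => j _; rewrite ltnS.
have -> : (j <= D - SA)%N = (SA + j <= D)%N by lia.
case: ifP => [le_SD'|_]; last by case: ifP.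
(* The total of [d] exceeds the sum of the upper bounds, so some d_b exceeds B_b and the term
   vanishes. *)
case: leqP => // lt_YD; rewrite [Ssum _ _ _ _ _ _]big1 ?mulr0 // => d /eqP sd.
have [b lt_b] : exists b : 'I_m, (B b < d b)%N.
  apply/existsP; rewrite -[X in is_true X]negbK negb_exists; apply/negP => /forallP hB.
  have : (\sum_(b < m) (d b : nat) <= SB)%N by apply: leq_sum => b _; rewrite leqNgt; apply: hB.
  by rewrite sd; lia.
by rewrite (@Gwt_lower_vanish _ b) ?mulr0 // (leq_trans lt_b) // leq_addl.
Qed.

End Chain.

Lemma Gwt_perm e M ys ys' p : perm_eq ys ys' -> Gwt e M ys p = Gwt e M ys' p.
Proof.
by move=> yy'; rewrite /Gwt; congr (_ * _); apply: eq_bigr => a _; apply: perm_big.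
Qed.

Theorem local_duality e m ys A B N D : (forall a, (e a < e a.+1)%N) ->
  perm_eq ys (nbrs e m A B) ->
  (D < N)%N -> (\sum_(y <- ys) y.2 + D < N)%N ->
  csum N m.+1 D (Gwt e m.+1 ys) =
  \sum_(j < D.+1 | (D <= \sum_(y <- ys) y.2 + j)%N) (h / q) ^+ (m * j) * pochq q h 1 j *
     (q / h) ^ (m.*2.+1%:Z * (\sum_(y <- ys) y.2 + j - D)%N%:Z - m%:Z * (\sum_(y <- ys) y.2)%N%:Z) *
     csum N m (\sum_(y <- ys) y.2 + j - D) (Gwt e m ys).
Proof.
move=> e_lt ysP lt_DN.
pose tie b := e b.+1 == (e b).+1.
(* When e (b + 1) = e b + 1, the entries with values B b and A (b + 1) have the same exponent and
   may be exchanged. Giving the smaller value to [B'] and the larger to [A'] secures the hypothesis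
   [BA] of the chain. *)
pose A' a := if a is c.+1 then if tie c then maxn (A c.+1) (B c) else A c.+1 else A 0%N.
pose B' b := if tie b then minn (A b.+1) (B b) else B b.
have {ysP}ysP : perm_eq ys (nbrs e m A' B').
  apply: perm_trans ysP _; rewrite /nbrs perm_cons.
  elim: (iota 0 m) => //= c s IHs; apply: (@perm_cat _ [:: _; _] [:: _; _] _ _ _ IHs).
  rewrite /B'; have [/eqP ->|_] := boolP (tie c); last exact: perm_refl.
  by case: leqP => _; rewrite // (perm_catC [:: _] [:: _]).
have Gp M : Gwt e M ys = Gwt e M (nbrs e m A' B').
  by apply: funext => p; apply: Gwt_perm.
have -> : (\sum_(y <- ys) y.2 = \sum_(a < m.+1) A' a + \sum_(b < m) B' b)%N.
  by rewrite (perm_big _ ysP) big_nbrs.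
rewrite !Gp => lt_YN.
have BA a : (a < m)%N -> e a.+1 = (e a).+1 -> (B' a <= A' a.+1)%N.
  by move=> _ /eqP ea; rewrite /A' /B' /tie ea geq_min leq_maxl.
have [/forallP AB|] := boolP [forall a : 'I_m, (A' a <= B' a)%N].
  apply: (chain_duality e_lt _ BA lt_DN lt_YN) => a am; exact: (AB (Ordinal am)).
(* Some integer has a lower bound exceeding its upper bound, so every weight on either side is 0. *)
rewrite negb_forall => /existsP[a]; rewrite -ltnNge => lt_BA.
have am := ltn_ord a.
have memA : (e a, A' a) \in nbrs e m A' B'.
  rewrite inE; case: (nat_of_ord a) am => [|c] am; first by rewrite eqxx.
  apply/orP; right; apply/flattenP.
  by exists [:: ((e c).+1, B' c); (e c.+1, A' c.+1)]; rewrite ?inE ?eqxx ?orbT //; apply/mapP; exists c; rewrite // mem_iota; lia.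
have memB : ((e a).+1, B' a) \in nbrs e m A' B'.
  rewrite inE; apply/orP; right; apply/flattenP.
  by exists [:: ((e a).+1, B' a); (e a.+1, A' a.+1)]; rewrite ?inE ?eqxx ?orbT //; apply/mapP; exists (nat_of_ord a); rewrite // mem_iota.
have G0 M p : (a < M)%N -> Gwt e M (nbrs e m A' B') p = 0.
  move=> aM; have [lt|le] := ltnP (p a) (A' a); first by apply: (Gwt_vanish memA aM); left.
  by apply: (Gwt_vanish memB aM); right; split=> //; apply: leq_trans le.
have c0 M E : (a < M)%N -> csum N M E (Gwt e M (nbrs e m A' B')) = 0.
  by move=> aM; rewrite /csum big1 // => g _; rewrite G0.
by rewrite c0 ?(leqW am) // big1 // => j _; rewrite c0 ?mulr0.
Qed.

End LocalDuality.

(** * The coefficients of F *)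

Local Notation "x %:F" := (tofrac x).

Lemma qv_neq0 : qv != 0.
Proof. by rewrite /qv tofrac_eq0 polyX_eq0. Qed.

Lemma hv_neq0 : hv != 0.
Proof. by rewrite /hv tofrac_eq0 polyC_eq0 polyX_eq0. Qed.

Lemma hqv_inj a b c d : hv ^+ a * qv ^+ b = hv ^+ c * qv ^+ d -> a = c /\ b = d.
Proof.
rewrite /hv /qv -!tofracXn -!tofracM => /eqP; rewrite tofrac_eq => /eqP.
rewrite -!polyC_exp => e.
have := congr1 (fun p : {poly {poly rat}} => p`_b) e; rewrite !coefCM !coefXn eqxx mulr1.
case: (eqVneq b d) => [-> e'|_]; last first.
  by rewrite mulr0 => /eqP; rewrite expf_eq0 polyX_eq0 andbF.
have := congr1 (fun p : {poly rat} => p`_a) e'; rewrite mulr1 !coefXn eqxx.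
by case: eqP => [->|_] // /eqP; rewrite oner_eq0.
Qed.

(** Write x = F / G. If x is divisible by q^(size F) in the local ring at q = 0, so is F, and a
    nonzero polynomial cannot have order at least its size. *)
Lemma qadic_small_all_eq0 x : (forall N, qadic_small N x) -> x = 0.
Proof.
have nz (g : {poly {poly rat}}) : g.[0] != 0 -> g%:F != 0 :> Qqh.
  by apply: contra; rewrite tofrac_eq0 => /eqP->; rewrite horner0.
move=> hx; have [F [G [G0 xE]]] := hx 0%N.
suff F0 : F = 0 by rewrite xE F0 tofrac0 mul0r mulr0.
apply/eqP; apply/negPn/negP => F0.
have [f [g [g0 e]]] := hx (size F); move: e; rewrite xE expr0 mul1r => e.
have {}e : F * g = 'X^(size F) * (f * G).
  apply/eqP; rewrite -tofrac_eq !tofracM tofracXn -/qv; apply/eqP.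
  apply: (mulIf (invr_neq0 (nz _ g0))); rewrite mulfK ?nz //.
  apply: (mulIf (invr_neq0 (nz _ G0))); rewrite e.
  rewrite -!mulrA; congr (_ * _); congr (_ * _); rewrite [in RHS]mulrCA.
  by rewrite divff ?mulr1 ?nz.
have g0' : g`_0 != 0 by rewrite -horner_coef0.
have exF : exists k, F`_k != 0 by exists (size F).-1; rewrite -lead_coefE lead_coef_eq0.
have [k Fk kmin] := ex_minnP exF.
have kF : (k < size F)%N by rewrite ltnNge; apply: contra Fk => le; rewrite nth_default.
have := congr1 (fun p : {poly {poly rat}} => p`_k) e.
rewrite coefXnM kF coefM (bigD1 ord_max) //= subnn big1 => [/eqP|i ne].
  by rewrite addr0 mulf_eq0 (negPf Fk) (negPf g0').
have ik : (i < k)%N.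
  by rewrite ltn_neqAle -ltnS ltn_ord andbT; apply: contra ne => /eqP e'; apply/eqP/val_inj.
have [->|/kmin] := eqVneq F`_i 0; first by rewrite mul0r.
by rewrite leqNgt ik.
Qed.

Section FprodCoef.

Let int0 x := qadic_small 0 x.

Let intM x y : int0 x -> int0 y -> int0 (x * y).
Proof. exact: qadic_smallM. Qed.

Let intq m : int0 (qv ^+ m).
Proof. by rewrite /qv -tofracXn; apply: qadic_small_poly. Qed.

Let inth : int0 hv.
Proof. exact: qadic_small_poly. Qed.

Let z : fps 1 Qqh := fpsX Qqh ord0.
Let Z (c : Qqh) : fps 1 Qqh := 1 - fpsC c * z.
Let mz (d : nat) : 'X_{1..1} := (U_(ord0) *+ d)%MM.
Let dil (f : fps 1 Qqh) : fps 1 Qqh := fun m => qv ^+ mdeg m * f m.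

Let mz_all (m : 'X_{1..1}) : m = mz (mdeg m).
Proof. by apply/mnmP=> i; rewrite ord1 /mz mulmnE mnm1E eqxx mul1n mdegE big_ord1. Qed.

Let mdeg_mz d : mdeg (mz d) = d.
Proof. by rewrite /mz mdegMn mdeg1 mul1n. Qed.

Let Z_coef0 c : Z c 0%MM = 1.
Proof.
rewrite /Z fps_coefD fps_coefN fps_coefCM fps_coef1 eqxx /z /fpsX.
by rewrite eq_sym mnm1_eq0 mulr0 subr0.
Qed.

Let ZM_succ c f d : (Z c * f) (mz d.+1) = f (mz d.+1) - c * f (mz d).
Proof.
have e : mz d.+1 = (U_(ord0) + mz d)%MM by rewrite /mz mulmS.
by rewrite /Z mulrBl mul1r fps_coefD fps_coefN -mulrA fps_coefCM [in X in _ - X]e fps_coefXM.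
Qed.

Let dilM f g : dil (f * g) = dil f * dil g.
Proof.
apply/funext=> m; rewrite /dil !fps_coefM mulr_sumr; apply: eq_bigr => k /eqP em.
by rewrite [in qv ^+ mdeg m]em mdegD exprD mulrACA.
Qed.

Let dilZ x : dil (Z x) = Z (x * qv).
Proof.
apply/funext=> m; rewrite (mz_all m) /dil mdeg_mz; case: (mdeg m) => [|d].
  by rewrite expr0 mul1r /mz mulm0n !Z_coef0.
have E y : Z y (mz d.+1) = - (y * z (mz d.+1)).
  rewrite /Z fps_coefD fps_coefN fps_coefCM fps_coef1.
  by rewrite -mdeg_eq0 mdeg_mz sub0r.
rewrite !E mulrN /z /fpsX mulrCA; case: eqP => [e|_]; last by rewrite !mulr0.
have := congr1 mdeg e; rewrite mdeg_mz mdeg1 => -[->].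
by rewrite expr1 !mulr1.
Qed.

Let FpartS M : Fpart M.+1 * Z (qv ^+ M) = Fpart M * Z (hv * qv ^+ M).
Proof.
rewrite /Fpart big_ord_recr /= -/(Fpart M) -/z -/(Z (qv ^+ M)) -/(Z (hv * qv ^+ M)).
by rewrite -!mulrA [fps_inv1 _ * _]mulrC fps_inv1P ?mulr1 ?Z_coef0.
Qed.

(** The functional equation F(qz) (1 - hbar z) = (1 - z) F(z), exact for partial products if the
    right side has one more factor. *)
Let FpartSl M : dil (Fpart M) * Z hv = Z 1 * Fpart M.+1.
Proof.
have cancelZ x f g : f * Z x = g * Z x -> f = g.
  by move=> /(congr1 (fun k => k * fps_inv1 (Z x))); rewrite -!mulrA fps_inv1P ?mulr1.
elim: M => [|M IHM].
  have := FpartS 0; rewrite /Fpart big_ord0 !expr0 mul1r mulr1 mulrC => ->.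
  have -> : dil 1 = 1; last by rewrite mul1r.
  apply/funext=> m; rewrite /dil fps_coef1.
  by case: eqP => [->|_]; rewrite ?mdeg0 ?expr0 ?mul1r ?mulr0.
apply: (@cancelZ (qv ^+ M.+1)); rewrite -[RHS]mulrA FpartS mulrA -IHM.
rewrite mulrAC -[RHS]mulrA [Z hv * _]mulrC mulrA; congr (_ * _).
by rewrite exprSr -dilZ -dilM FpartS dilM dilZ mulrA.
Qed.

Let l d := Fprod (mz d).

Let l0 : l 0 = 1.
Proof.
apply/eqP; rewrite -subr_eq0; apply/eqP/qadic_small_all_eq0 => N.
have [M0 hM] := Fprod_cvg (mz 0) N; have := qadic_smallN (hM M0 (leqnn _)).
suff -> : Fpart M0 (mz 0) = 1 by rewrite opprB.
rewrite /mz mulm0n; elim: M0 {hM} => [|M IHM].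
  by rewrite /Fpart big_ord0 fps_coef1 eqxx.
by have := congr1 (fun f : fps 1 Qqh => f 0%MM) (FpartS M); rewrite !fps_coefM0 !Z_coef0 !mulr1 IHM.
Qed.

Let lS d : (1 - qv ^+ d.+1) * l d.+1 = (1 - hv * qv ^+ d) * l d.
Proof.
apply/eqP; rewrite -subr_eq0; apply/eqP/qadic_small_all_eq0 => N.
have [M1 h1] := Fprod_cvg (mz d.+1) N; have [M2 h2] := Fprod_cvg (mz d) N.
pose M := maxn M1 M2.
have a1 := h1 M (leq_maxl _ _); have a2 := h1 M.+1 (leq_trans (leq_maxl _ _) (leqnSn _)).
have b1 := h2 M (leq_maxr _ _); have b2 := h2 M.+1 (leq_trans (leq_maxr _ _) (leqnSn _)).
have := congr1 (fun f : fps 1 Qqh => f (mz d.+1)) (FpartSl M).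
rewrite mulrC !ZM_succ /dil !mdeg_mz mul1r => /eqP; rewrite -subr_eq0 => /eqP E.
move: a1 a2 b1 b2 E; rewrite -/(l d.+1) -/(l d).
move: (Fpart M _) (Fpart M.+1 _) (Fpart M _) (Fpart M.+1 _) => y1 y2 x1 x2 a1 a2 b1 b2 E.
have -> : (1 - qv ^+ d.+1) * l d.+1 - (1 - hv * qv ^+ d) * l d
  = (qv ^+ d.+1 * (x1 - l d.+1) - (x2 - l d.+1)) - (hv * qv ^+ d * (y1 - l d) - (y2 - l d)).
  apply/eqP; rewrite -subr_eq0; apply/eqP; rewrite -[RHS]oppr0 -[X in _ = - X]E; ring.
apply: qadic_smallB; apply: qadic_smallB => //.
  exact: (@qadic_smallM 0 N _ _ (intq _) a1).
exact: (@qadic_smallM 0 N _ _ (intM inth (intq _)) b1).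
Qed.

(** The q-binomial theorem, from the first-order recursion [lS] of the coefficients. *)
Lemma Fprod_coef d : Fprod (U_(ord0) *+ d)%MM = pochq qv hv 1 d.
Proof.
rewrite -/(mz d) -/(l d); elim: d => [|d IHd]; first by rewrite l0 pochq0.
apply: (mulfI (subr_qv_neq0 d)); rewrite lS IHd -addn1 pochqD.
have nz : 1 - qv * qv ^+ d != 0 by rewrite -exprS subr_qv_neq0.
rewrite /pochq /poch !big_ord1 !expr0 !mul1r !mulr1 addn1 exprS.
have gen (a b P : Qqh) : b != 0 -> a * P = b * (P * (a / b)).
  by move=> b0; rewrite mulrCA [b * _]mulrCA mulfV // mulr1 mulrC.
exact: gen.
Qed.

End FprodCoef.

(** * The dimension inequality for stable points *)

(** The image of x -> (f1 x, f2 x) is an isotropic subspace of a symplectic space of dimension 2m,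
    and its dimension is d by injectivity. *)
Lemma isotropic_dim (C : fieldType) d m (f1 f2 : {linear 'rV[C]_d -> 'rV[C]_m}) :
  (forall x, f1 x = 0 -> f2 x = 0 -> x = 0) ->
  (forall x y, f1 x *m (f2 y)^T = f1 y *m (f2 x)^T) -> (d <= m)%N.
Proof.
move=> inj iso; set F1 := lin1_mx f1; set F2 := lin1_mx f2.
have E1 x : f1 x = x *m F1 by rewrite mul_rV_lin1.
have E2 x : f2 x = x *m F2 by rewrite mul_rV_lin1.
have free : row_free (row_mx F1 F2).
  rewrite -kermx_eq0; apply/eqP/row_matrixP => i; rewrite row0.
  set x := row i _; have : x *m row_mx F1 F2 = 0 by apply/sub_kermxP/row_sub.
  rewrite mul_mx_row -[0]row_mx0 => /eq_row_mx[x1 x2].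
  by apply: inj; rewrite ?E1 ?E2.
have sym : F1 *m F2^T = F2 *m F1^T.
  apply/matrixP=> i j.
  have /matrixP/(_ 0 0) E := iso (delta_mx 0 i) (delta_mx 0 j).
  rewrite !E1 !E2 -!rowE !mxE in E; rewrite !mxE.
  transitivity (\sum_k row i F1 0 k * (row j F2)^T k 0); first by apply: eq_bigr => k _; rewrite !mxE.
  by rewrite E; apply: eq_bigr => k _; rewrite !mxE mulrC.
have z : row_mx F1 F2 *m (row_mx F2 (- F1))^T = 0.
  by rewrite tr_row_mx mul_row_col linearN /= mulmxN sym subrr.
have := mulmx0_rank_max z; rewrite mxrank_tr (eqP free).
have -> : row_mx F2 (- F1) = row_mx F1 F2 *m block_mx 0 (- 1%:M) 1%:M 0.
  by rewrite mul_row_block !mulmx0 mulmxN !mulmx1 add0r addr0.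
rewrite mxrankMfree ?(eqP free); first by move=> ?; lia.
rewrite row_free_unit; suff : block_mx 0 (- 1%:M) 1%:M 0 *m block_mx 0 1%:M (- 1%:M) 0 = 1%:M :> 'M[C]_(m + m).
  by case/mulmx1_unit.
rewrite mulmx_block !mulmx0 !mul0mx mulmxN mulNmx opprK !mulmx1 !addr0 !add0r.
by rewrite -scalar_mx_block.
Qed.

Section Dimension.
Variables (C : fieldType) (n : nat) (v w : 'I_n -> nat).
Variable p : framed_rep C v w.
Hypothesis mu0 : forall i, moment_map p i = 0.
Hypothesis stab : stable p.

Let I : finType := {i : 'I_n & ('I_(v i) * 'I_(v i))%type}.
Let J1 : finType := {e : 'I_n * 'I_n & ('I_(v e.2) * 'I_(v e.1))%type}.
Let J2 : finType := {i : 'I_n & ('I_(v i) * 'I_(w i))%type}.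
Let J : finType := (J1 + J2)%type.
Let S : {pred J} := [pred j : J | if j is inl t then arrow (tag t).1 (tag t).2 else true].

Let xi (x : 'rV[C]_#|I|) (i : 'I_n) : 'M[C]_(v i) :=
  \matrix_(a, b) x 0 (enum_rank (Tagged (fun i => ('I_(v i) * 'I_(v i))%type) (a, b) : I)).

Let xi_lin i : linear (xi^~ i).
Proof. by move=> c x y; apply/matrixP=> a b; rewrite !mxE. Qed.

(** [g1] and [g2] are the infinitesimal action of the Lie algebra of G_v at the point, on the
    components (X, A) and (Y, B). The predicate [S] retains the coordinates belonging to actual
    arrows and the framing. *)
Let g1 (x : 'rV[C]_#|I|) (j : J) : C :=
  match j with
  | inl t => (xi x (tag t).2 *m rX p (tag t).1 (tag t).2 -
              rX p (tag t).1 (tag t).2 *m xi x (tag t).1) (tagged t).1 (tagged t).2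
  | inr t => (xi x (tag t) *m rA p (tag t)) (tagged t).1 (tagged t).2
  end.

Let g2 (x : 'rV[C]_#|I|) (j : J) : C :=
  match j with
  | inl t => (xi x (tag t).1 *m rY p (tag t).1 (tag t).2 -
              rY p (tag t).1 (tag t).2 *m xi x (tag t).2) (tagged t).2 (tagged t).1
  | inr t => (- (rB p (tag t) *m xi x (tag t))) (tagged t).2 (tagged t).1
  end.

Let f1 x : 'rV[C]_#|S| := \row_j g1 x (enum_val j).
Let f2 x : 'rV[C]_#|S| := \row_j g2 x (enum_val j).

Let f1_lin : linear f1.
Proof.
move=> c x y; apply/rowP=> j; rewrite !mxE /g1; case: (enum_val j) => t.
  by rewrite !xi_lin mulmxDl mulmxDr -scalemxAl -scalemxAr opprD addrACA -scalerBr !mxE.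
by rewrite xi_lin mulmxDl -scalemxAl !mxE.
Qed.

Let f2_lin : linear f2.
Proof.
move=> c x y; apply/rowP=> j; rewrite !mxE /g2; case: (enum_val j) => t.
  by rewrite !xi_lin mulmxDl mulmxDr -scalemxAl -scalemxAr opprD addrACA -scalerBr !mxE.
by rewrite xi_lin mulmxDr -scalemxAr opprD -scalerN !mxE.
Qed.

(** If an element of the Lie algebra annihilates the point, its kernels contain the image of A and
    are preserved by X and Y; by stability they are the whole spaces. *)
Let f_inj x : f1 x = 0 -> f2 x = 0 -> x = 0.
Proof.
move=> h1 h2.
have G1 j : j \in S -> g1 x j = 0.
  by move=> jS; have /rowP/(_ (enum_rank_in jS j)) := h1; rewrite !mxE enum_rankK_in.
have G2 j : j \in S -> g2 x j = 0.
  by move=> jS; have /rowP/(_ (enum_rank_in jS j)) := h2; rewrite !mxE enum_rankK_in.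
have XA i : xi x i *m rA p i = 0.
  apply/matrixP=> a b; rewrite [RHS]mxE.
  exact: (G1 (inr (Tagged (fun i => ('I_(v i) * 'I_(w i))%type) (a, b)))).
have XX i j : arrow i j -> xi x j *m rX p i j = rX p i j *m xi x i.
  move=> ij; apply/eqP; rewrite -subr_eq0; apply/eqP/matrixP=> a b; rewrite [RHS]mxE.
  exact: (G1 (inl (Tagged (fun e : 'I_n * 'I_n => ('I_(v e.2) * 'I_(v e.1))%type) ((a, b) : 'I_(v (i, j).2) * 'I_(v (i, j).1))))).
have XY i j : arrow i j -> xi x i *m rY p i j = rY p i j *m xi x j.
  move=> ij; apply/eqP; rewrite -subr_eq0; apply/eqP/matrixP=> a b; rewrite [RHS]mxE.
  exact: (G2 (inl (Tagged (fun e : 'I_n * 'I_n => ('I_(v e.2) * 'I_(v e.1))%type) ((b, a) : 'I_(v (i, j).2) * 'I_(v (i, j).1))))).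
pose K i : {vspace 'cV[C]_(v i)} := lker (linfun (mulmx (xi x i))).
have KE i u : (u \in K i) = (xi x i *m u == 0) by rewrite memv_ker lfunE.
have K1 i (u : 'cV[C]_(w i)) : rA p i *m u \in K i.
  by rewrite KE mulmxA XA mul0mx.
have K2 i j : arrow i j ->
    (forall u, u \in K i -> rX p i j *m u \in K j) /\ (forall u, u \in K j -> rY p i j *m u \in K i).
  move=> ij; split=> u; rewrite !KE => /eqP u0; rewrite mulmxA ?XX ?XY //.
    by rewrite -mulmxA u0 mulmx0.
  by rewrite -mulmxA u0 mulmx0.
have K3 := stab K1 K2.
have x0 i : xi x i = 0.
  apply/matrixP=> a b; have := memvf (delta_mx b 0 : 'cV[C]_(v i)).
  by rewrite -(K3 i) KE -colE => /eqP /matrixP /(_ a 0); rewrite !mxE.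
apply/rowP=> j; rewrite [RHS]mxE -(enum_valK j); case: (enum_val j) => i [a b].
by have /matrixP/(_ a b) := x0 i; rewrite !mxE.
Qed.

Let pairing_tr x y : \sum_(j in S) g1 x j * g2 y j =
  \sum_(e : 'I_n * 'I_n | arrow e.1 e.2)
     \tr ((xi x e.2 *m rX p e.1 e.2 - rX p e.1 e.2 *m xi x e.1) *m
          (xi y e.1 *m rY p e.1 e.2 - rY p e.1 e.2 *m xi y e.2))
  + \sum_i \tr (xi x i *m rA p i *m (- (rB p i *m xi y i))).
Proof.
rewrite big_sumType /=; congr (_ + _).
  rewrite (eq_bigl (fun t : J1 => arrow (tag t).1 (tag t).2 && true)); last by move=> t; rewrite andbT.
  rewrite -(sig_big_dep (fun e : 'I_n * 'I_n => arrow e.1 e.2) (fun _ _ => true)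
    (fun e (ab : 'I_(v e.2) * 'I_(v e.1)) =>
     (xi x e.2 *m rX p e.1 e.2 - rX p e.1 e.2 *m xi x e.1) ab.1 ab.2 *
     (xi y e.1 *m rY p e.1 e.2 - rY p e.1 e.2 *m xi y e.2) ab.2 ab.1)) /=.
  apply: eq_bigr => e _; rewrite /mxtrace.
  under [RHS]eq_bigr => a _ do rewrite mxE.
  by rewrite pair_bigA.
rewrite -(sig_big_dep xpredT (fun _ _ => true)
    (fun i (ab : 'I_(v i) * 'I_(w i)) =>
     (xi x i *m rA p i) ab.1 ab.2 * (- (rB p i *m xi y i)) ab.2 ab.1)) /=.
apply: eq_bigr => e _; rewrite /mxtrace.
under [RHS]eq_bigr => a _ do rewrite mxE.
by rewrite pair_bigA.
Qed.

(** By cyclicity of the trace, the symplectic pairing of two tangent vectors to the orbit is the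
    pairing of the moment map with the commutator, which is 0 on the zero fiber. *)
Let f_iso x y : f1 x *m (f2 y)^T = f1 y *m (f2 x)^T.
Proof.
have E x' y' : f1 x' *m (f2 y')^T = (\sum_(j in S) g1 x' j * g2 y' j)%:M.
  apply/matrixP=> a b; rewrite !ord1 !mxE eqxx mulr1n [RHS]big_enum_val.
  by apply: eq_bigr => j _; rewrite !mxE.
rewrite !E; congr (_%:M); rewrite !pairing_tr; apply/eqP; rewrite -subr_eq0 opprD addrACA -!sumrB.
pose br i := xi x i *m xi y i - xi y i *m xi x i.
have trE (e : 'I_n * 'I_n) :
   \tr ((xi x e.2 *m rX p e.1 e.2 - rX p e.1 e.2 *m xi x e.1) *m
          (xi y e.1 *m rY p e.1 e.2 - rY p e.1 e.2 *m xi y e.2)) -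
   \tr ((xi y e.2 *m rX p e.1 e.2 - rX p e.1 e.2 *m xi y e.1) *m
          (xi x e.1 *m rY p e.1 e.2 - rY p e.1 e.2 *m xi x e.2))
   = \tr (rX p e.1 e.2 *m rY p e.1 e.2 *m br e.2) - \tr (rY p e.1 e.2 *m rX p e.1 e.2 *m br e.1).
  rewrite /br; set X := rX _ _ _; set Y := rY _ _ _; set a2 := xi x e.2; set a1 := xi x e.1.
  set b2 := xi y e.2; set b1 := xi y e.1.
  rewrite !(mulmxBl, mulmxBr) !raddfB /= !mulmxA.
  have c1 : \tr (a2 *m X *m b1 *m Y) = \tr (X *m b1 *m Y *m a2) by rewrite [RHS]mxtrace_mulC !mulmxA.
  have c2 : \tr (b2 *m X *m a1 *m Y) = \tr (X *m a1 *m Y *m b2) by rewrite [RHS]mxtrace_mulC !mulmxA.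
  have c3 : \tr (a2 *m X *m Y *m b2) = \tr (X *m Y *m b2 *m a2) by rewrite [RHS]mxtrace_mulC !mulmxA.
  have c4 : \tr (b2 *m X *m Y *m a2) = \tr (X *m Y *m a2 *m b2) by rewrite [RHS]mxtrace_mulC !mulmxA.
  have c5 : \tr (X *m a1 *m b1 *m Y) = \tr (Y *m X *m a1 *m b1) by rewrite mxtrace_mulC !mulmxA.
  have c6 : \tr (X *m b1 *m a1 *m Y) = \tr (Y *m X *m b1 *m a1) by rewrite mxtrace_mulC !mulmxA.
  by rewrite c1 c2 c3 c4 c5 c6; ring.
have trF i : \tr (xi x i *m rA p i *m (- (rB p i *m xi y i))) - \tr (xi y i *m rA p i *m (- (rB p i *m xi x i)))
   = \tr (rA p i *m rB p i *m br i).
  rewrite /br !mulmxN mulmxBr !raddfB !raddfN /= !mulmxA.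
  have c1 : \tr (xi x i *m rA p i *m rB p i *m xi y i) = \tr (rA p i *m rB p i *m xi y i *m xi x i).
    by rewrite [RHS]mxtrace_mulC !mulmxA.
  have c2 : \tr (xi y i *m rA p i *m rB p i *m xi x i) = \tr (rA p i *m rB p i *m xi x i *m xi y i).
    by rewrite [RHS]mxtrace_mulC !mulmxA.
  by rewrite c1 c2; ring.
under eq_bigr => e _ do rewrite trE.
under [X in _ + X == _]eq_bigr => i _ do rewrite trF.
rewrite sumrB.
have -> : \sum_(e : 'I_n * 'I_n | arrow e.1 e.2) \tr (rX p e.1 e.2 *m rY p e.1 e.2 *m br e.2)
   = \sum_i \tr ((\sum_(j | arrow j i) rX p j i *m rY p j i) *m br i).
  rewrite -(pair_big_dep xpredT (fun i j => arrow i j) (fun i j => \tr (rX p i j *m rY p i j *m br j))) /=.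
  rewrite (exchange_big_dep xpredT) //=; apply: eq_bigr => i _.
  by rewrite mulmx_suml linear_sum.
have -> : \sum_(e : 'I_n * 'I_n | arrow e.1 e.2) \tr (rY p e.1 e.2 *m rX p e.1 e.2 *m br e.1)
   = \sum_i \tr ((\sum_(j | arrow i j) rY p i j *m rX p i j) *m br i).
  rewrite -(pair_big_dep xpredT (fun i j => arrow i j) (fun i j => \tr (rY p i j *m rX p i j *m br i))) /=.
  by apply: eq_bigr => i _; rewrite mulmx_suml linear_sum.
rewrite -sumrB -big_split /= big1 // => i _.
by rewrite -linearB -linearD /= -mulmxBl -mulmxDl -/(moment_map p i) mu0 mul0mx linear0.
Qed.

(** The tangent space of the orbit is an isotropic copy of the Lie algebra of G_v in the cotangent
    space of Rep, so its dimension is at most that of Rep. *)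
Lemma quiver_dim_le :
  (\sum_i v i * v i <= \sum_(e : 'I_n * 'I_n | arrow e.1 e.2) v e.1 * v e.2 + \sum_i v i * w i)%N.
Proof.
pose L1 : {linear 'rV[C]_#|I| -> 'rV[C]_#|S|} := HB.pack f1 (GRing.isLinear.Build _ _ _ _ _ f1_lin).
pose L2 : {linear 'rV[C]_#|I| -> 'rV[C]_#|S|} := HB.pack f2 (GRing.isLinear.Build _ _ _ _ _ f2_lin).
have := @isotropic_dim _ _ _ L1 L2 f_inj f_iso.
have -> : #|I| = (\sum_i v i * v i)%N.
  rewrite card_tagged sumnE big_map big_enum /=; apply: eq_bigr => i _.
  by rewrite card_prod !card_ord.
suff -> : #|S| = (\sum_(e : 'I_n * 'I_n | arrow e.1 e.2) v e.1 * v e.2 + \sum_i v i * w i)%N by [].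
rewrite -sum1_card big_sumType /=; congr (_ + _)%N.
  rewrite (eq_bigl (fun t : J1 => arrow (tag t).1 (tag t).2 && true)); last by move=> t; rewrite andbT.
  rewrite -(sig_big_dep (fun e : 'I_n * 'I_n => arrow e.1 e.2) (fun _ _ => true) (fun e (ab : 'I_(v e.2) * 'I_(v e.1)) => 1%N)) /=.
  by apply: eq_bigr => e _; rewrite sum1_card card_prod !card_ord mulnC.
rewrite -(sig_big_dep xpredT (fun _ _ => true) (fun i (ab : 'I_(v i) * 'I_(w i)) => 1%N)) /=.
by apply: eq_bigr => e _; rewrite sum1_card card_prod !card_ord.
Qed.

End Dimension.

(** * Sums over integers attached to the vertices *)

Definition upd (n : nat) (T : Type) (F : 'I_n -> T) (i : 'I_n) (x : T) : 'I_n -> T :=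
  fun j => if j == i then x else F j.

Section NodeSums.
Variables (K : fieldType) (n M N : nat).
Hypothesis N_gt0 : (0 < N)%N.

Definition nodeval (f : {ffun 'I_n * 'I_M -> 'I_N}) (i : 'I_n) : nat -> nat :=
  extz (fun j => f (i, j)).

(** The integers at i occupy the first v i places of a row of fixed length [M], padded by 0: the
    index type must not depend on v, which changes in the recursion. *)
Definition node_ok (v d : 'I_n -> nat) (f : {ffun 'I_n * 'I_M -> 'I_N}) : bool :=
  [forall i, [forall j : 'I_M, (v i <= j)%N ==> (f (i, j) == 0 :> nat)%N]] &&
  [forall i, \sum_j (f (i, j) : nat) == d i]%N.

Definition node_sum (v d : 'I_n -> nat) (G : ('I_n -> nat -> nat) -> K) : K :=
  \sum_(f | node_ok v d f) G (nodeval f).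

Definition node_ext (G : ('I_n -> nat -> nat) -> K) : Prop :=
  forall p p', (forall j a, p j a = p' j a) -> G p = G p'.

(** Isolates the integers at i as an inner sum over compositions, the form in which the duality
    acts; the outer sum has no place left at i. *)
Lemma node_sum_split v d i G : (v i <= M)%N -> node_ext G ->
  node_sum v d G = node_sum (upd v i 0%N) (upd d i 0%N)
    (fun p => csum N (v i) (d i) (fun g => G (upd p i g))).
Proof.
move=> vM Gext; pose z0 : 'I_N := Ordinal N_gt0.
pose clr (f : {ffun 'I_n * 'I_M -> 'I_N}) : {ffun 'I_n * 'I_M -> 'I_N} :=
  [ffun x => if x.1 == i then z0 else f x].
pose rw (f : {ffun 'I_n * 'I_M -> 'I_N}) : {ffun 'I_(v i) -> 'I_N} :=
  [ffun a => f (i, widen_ord vM a)].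
pose cmb (p : {ffun 'I_n * 'I_M -> 'I_N} * {ffun 'I_(v i) -> 'I_N}) : {ffun 'I_n * 'I_M -> 'I_N} :=
  [ffun x => if x.1 == i then
     (if insub (nat_of_ord x.2) is Some a then p.2 a else z0) else p.1 x].
rewrite /node_sum /csum pair_big_dep /=.
have sumi (f : {ffun 'I_n * 'I_M -> 'I_N}) : (forall j : 'I_M, (v i <= j)%N -> f (i, j) = 0%N :> nat) ->
    (\sum_j (f (i, j) : nat) = \sum_(a < v i) (f (i, widen_ord vM a) : nat))%N.
  move=> f0; pose F (a : nat) : nat := if insub a is Some j then f (i, j) else 0%N.
  rewrite (eq_bigr (fun j : 'I_M => F j)); last by move=> j _; rewrite /F valK.
  rewrite [RHS](eq_bigr (fun a : 'I_(v i) => F a)); last first.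
    move=> a _; rewrite /F; case: insubP => [b _ eb|]; last by rewrite (leq_trans (ltn_ord a) vM).
    by congr (f (_, _) : nat); apply: val_inj; rewrite /= eb.
  rewrite (big_ord_widen M F vM) [RHS]big_mkcond /=; apply: eq_bigr => j _.
  by case: ltnP => // /f0; rewrite /F valK.
have cmbE p a : cmb p (i, widen_ord vM a) = p.2 a.
  rewrite ffunE /= eqxx; case: insubP => [b _ eb|]; last by rewrite ltn_ord.
  by congr (p.2 _); apply: val_inj.
have cmb0 p (j : 'I_M) : (v i <= j)%N -> cmb p (i, j) = 0%N :> nat.
  by move=> vj; rewrite ffunE /= eqxx insubF // ltnNge vj.
have cmbN p j a : j != i -> cmb p (j, a) = p.1 (j, a).
  by move=> /negPf ji; rewrite ffunE /= ji.
rewrite [RHS](reindex_onto (fun f => (clr f, rw f)) cmb) /=; last first.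
  move=> [f g] /= /andP[/andP[/forallP h1 _] _]; congr (_, _); apply/ffunP=> x; rewrite ffunE /=.
    rewrite ffunE; case: x => j a /=; case: eqP => [->|//].
    have /forallP/(_ a) := h1 i; rewrite /upd eqxx leq0n /= => /eqP e.
    by apply: val_inj; rewrite /= e.
  by rewrite cmbE.
have clrN f j a : j != i -> clr f (j, a) = f (j, a) by move=> /negPf ji; rewrite ffunE /= ji.
apply: eq_big => [f|f /andP[/forallP h1 /forallP h2]].
  apply/idP/idP => [/andP[/forallP h1 /forallP h2]|].
    have f0 : forall j : 'I_M, (v i <= j)%N -> f (i, j) = 0%N :> nat.
      by move=> j vj; have /forallP/(_ j) := h1 i; rewrite vj => /eqP.
    apply/andP; split; [apply/andP; split; [apply/andP; split|]|].
    - apply/forallP => j; apply/forallP => a; apply/implyP; rewrite /upd ffunE /=.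
      by case: (eqVneq j i) => //= _; have /forallP/(_ a)/implyP := h1 j.
    - apply/forallP => j; rewrite /upd; case: (eqVneq j i) => [->|ji].
        by rewrite big1 // => a _; rewrite ffunE /= eqxx.
      by rewrite -(eqP (h2 j)); apply/eqP/eq_bigr => a _; rewrite clrN.
    - rewrite -(eqP (h2 i)) sumi //; apply/eqP/eq_bigr => a _.
      by rewrite ffunE.
    - apply/eqP/ffunP=> -[j a]; case: (eqVneq j i) => [->|ji]; last by rewrite cmbN // clrN.
      rewrite ffunE /= eqxx; case: insubP => /= [b bv eb|].
        by rewrite ffunE; congr (f (_, _)); apply: val_inj.
      by rewrite -leqNgt => /f0 e; apply: val_inj; rewrite /= e.
  move=> /andP[/andP[/andP[/forallP h1 /forallP h2] /eqP h3] /eqP e].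
  have f0 : forall j : 'I_M, (v i <= j)%N -> f (i, j) = 0%N :> nat.
    by move=> j vj; rewrite -e cmb0.
  apply/andP; split; apply/forallP => j.
    apply/forallP => a; apply/implyP; case: (eqVneq j i) => [-> vj|ji]; first by rewrite f0.
    by have /forallP/(_ a)/implyP := h1 j; rewrite /upd (negPf ji) clrN.
  case: (eqVneq j i) => [->|ji].
    by rewrite sumi // -h3; apply/eqP/eq_bigr => a _; rewrite ffunE.
  have := h2 j; rewrite /upd (negPf ji) => /eqP <-.
  by apply/eqP/eq_bigr => a _; rewrite clrN.
apply: Gext => j a; rewrite /upd /nodeval; case: (eqVneq j i) => [->|ji]; last first.
  by apply: extz_ext => b; rewrite clrN.
rewrite /extz; case: insubP => [b bM eb|]; case: insubP => [c cv ec|] //=.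
- by rewrite ffunE; congr (f (_, _) : nat); apply: val_inj; rewrite /= eb ec.
- rewrite -leqNgt -eb => vb; have /forallP/(_ b) := h1 i.
  by rewrite vb => /eqP.
- by rewrite -ec; move: cv; rewrite -ec => cv; rewrite (leq_trans cv vM).
Qed.

Lemma node_sum_eq v d G G' : (forall p, (forall i a, (v i <= a)%N -> p i a = 0%N) ->
    (forall i, (v i <= M)%N -> \sum_(a < v i) p i a = d i)%N -> G p = G' p) ->
  node_sum v d G = node_sum v d G'.
Proof.
move=> e; apply: eq_bigr => f /andP[/forallP h1 /forallP h2]; apply: e => i.
  move=> a va; rewrite /nodeval /extz; case: insubP => // b bM eb.
  by have /forallP/(_ b) := h1 i; rewrite eb va => /eqP.
move=> vM; rewrite -(eqP (h2 i)).
rewrite (eq_bigr (fun j : 'I_M => nodeval f i j)); last by move=> j _; rewrite /nodeval extzE.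
rewrite (big_ord_widen M (nodeval f i) vM) big_mkcond /=; apply: eq_bigr => j _.
case: ltnP => // vj; have /forallP/(_ j) := h1 i; rewrite vj => /eqP.
by rewrite /nodeval extzE.
Qed.

Lemma node_sumZ v d c G : c * node_sum v d G = node_sum v d (fun p => c * G p).
Proof. by rewrite /node_sum mulr_sumr. Qed.

Lemma node_sum_sum v d (J : finType) (P : pred J) (G : J -> ('I_n -> nat -> nat) -> K) :
  node_sum v d (fun p => \sum_(j | P j) G j p) = \sum_(j | P j) node_sum v d (G j).
Proof. by rewrite /node_sum exchange_big. Qed.

End NodeSums.

Section Degrees.
Variable n : nat.

Lemma arrow_irr (i : 'I_n) : arrow i i = false.
Proof. rewrite /arrow; apply/negbTE/negP => /orP[/andP[_ /eqP]|/andP[/eqP h1 /eqP h2]]; lia. Qed.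

Definition indeg (i : 'I_n) (d : 'I_n -> nat) : nat := (\sum_(j | arrow j i) d j)%N.
Definition outdeg (i : 'I_n) (d : 'I_n -> nat) : nat := (\sum_(j | arrow i j) d j)%N.
Definition nbrdeg i d := (indeg i d + outdeg i d)%N.

(* The exponent of q/hbar by which a monomial z^d is rescaled under the simple
   reflection at i; here v is the dimension vector after the reflection. *)
Definition reflexp (v : 'I_n -> nat) (i : 'I_n) (d : 'I_n -> nat) : int :=
  (d i)%:Z - (indeg i d)%:Z + a_coef v i * ((nbrdeg i d)%:Z - (d i)%:Z *+ 2).

Lemma nbr_upd i (v : 'I_n -> nat) x :
  indeg i (upd v i x) = indeg i v /\ outdeg i (upd v i x) = outdeg i v.
Proof.
by split; apply: eq_bigr => j ij; rewrite /upd; case: eqP ij => // ->; rewrite arrow_irr.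
Qed.

Lemma a_coefE v i : a_coef v i = (v i)%:Z - (outdeg i v)%:Z.
Proof. by rewrite /a_coef /outdeg (big_morph Posz PoszD (erefl _)). Qed.

End Degrees.

(** * The recursion for the vertex function *)

Section VertexRecursion.
Variables (K : fieldType) (q h : K).
Hypothesis q0 : q != 0.
Hypothesis h0 : h != 0.
Hypothesis hq_inj : forall a b c d, h ^+ a * q ^+ b = h ^+ c * q ^+ d -> a = c /\ b = d.

Variables (n : nat) (k : 'I_n) (ex : 'I_n -> nat -> nat).

Local Notation U := (zpochq q h).

(** The weight of a labelling without the power of q / hbar; [ex i a] is the hbar-exponent of the
    a-th cell at i, counted from 0. *)
Definition node_wt (v : 'I_n -> nat) (p : 'I_n -> nat -> nat) : K :=
  (\prod_(a < v k) U (h ^+ ex k a) (p k a)) *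
  (\prod_(e : 'I_n * 'I_n | arrow e.1 e.2) \prod_(a < v e.1) \prod_(b < v e.2)
     U (h ^+ ex e.2 b / h ^+ ex e.1 a) ((p e.2 b)%:Z - (p e.1 a)%:Z)) *
  \prod_(j : 'I_n) \prod_(a < v j) \prod_(b < v j)
     (U (h ^+ ex j b / h ^+ ex j a) ((p j b)%:Z - (p j a)%:Z))^-1.

Definition rest_wt (i : 'I_n) (v : 'I_n -> nat) (p : 'I_n -> nat -> nat) : K :=
  (if i == k then 1 else \prod_(a < v k) U (h ^+ ex k a) (p k a)) *
  (\prod_(e : 'I_n * 'I_n | arrow e.1 e.2 && (e.1 != i) && (e.2 != i)) \prod_(a < v e.1) \prod_(b < v e.2)
     U (h ^+ ex e.2 b / h ^+ ex e.1 a) ((p e.2 b)%:Z - (p e.1 a)%:Z)) *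
  \prod_(j | j != i) \prod_(a < v j) \prod_(b < v j)
     (U (h ^+ ex j b / h ^+ ex j a) ((p j b)%:Z - (p j a)%:Z))^-1.

(** The framing acts as a neighbour of weight 1 and value 0. Cells across an outgoing arrow have
    their exponent raised by one, as the reversal of their symbols by [zpochq_rev] requires. *)
Definition ylist (v : 'I_n -> nat) (i : 'I_n) (p : 'I_n -> nat -> nat) : seq (nat * nat) :=
  (if i == k then [:: (0, 0)] else [::])%N ++
  flatten [seq [seq (ex j b, p j b) | b <- iota 0 (v j)] | j <- enum 'I_n & arrow j i] ++
  flatten [seq [seq ((ex j b).+1, p j b) | b <- iota 0 (v j)] | j <- enum 'I_n & arrow i j].

Lemma big_ylist (R : Type) (idx : R) (op : Monoid.com_law idx) v i p (F : nat * nat -> R) :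
  \big[op/idx]_(y <- ylist v i p) F y =
  op (if i == k then F (0, 0)%N else idx)
    (op (\big[op/idx]_(j | arrow j i) \big[op/idx]_(b < v j) F (ex j b, p j b))
        (\big[op/idx]_(j | arrow i j) \big[op/idx]_(b < v j) F ((ex j b).+1, p j b))).
Proof.
rewrite /ylist !big_cat /=; congr (op _ (op _ _)).
- by case: ifP => _; rewrite ?big_seq1 ?big_nil.
- rewrite big_flatten big_map big_filter big_enum_cond /=; apply: eq_bigr => j _.
  by rewrite big_map -{1}[v j]subn0 -/(index_iota 0 (v j)) big_mkord.
- rewrite big_flatten big_map big_filter big_enum_cond /=; apply: eq_bigr => j _.
  by rewrite big_map -{1}[v j]subn0 -/(index_iota 0 (v j)) big_mkord.
Qed.

Let r0 : q / h != 0. Proof. by rewrite mulf_neq0 ?invr_eq0. Qed.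

Lemma node_wt_split v i p (g : nat -> nat) :
  node_wt v (upd p i g) = rest_wt i v p *
    (q / h) ^ ((\sum_(j | arrow i j) v j)%N%:Z * (\sum_(a < v i) g a)%N%:Z
               - (v i)%:Z * (\sum_(j | arrow i j) \sum_(b < v j) p j b)%N%:Z) *
    Gwt q h (ex i) (v i) (ylist v i p) g.
Proof.
have ui a : upd p i g i a = g a by rewrite /upd eqxx.
have uj j a : j != i -> upd p i g j a = p j a by rewrite /upd => /negPf->.
pose E e := \prod_(a < v e.1) \prod_(b < v e.2)
     U (h ^+ ex e.2 b / h ^+ ex e.1 a) ((upd p i g e.2 b)%:Z - (upd p i g e.1 a)%:Z) : K.
have arrowE : \prod_(e : 'I_n * 'I_n | arrow e.1 e.2) E e =
  (\prod_(e : 'I_n * 'I_n | arrow e.1 e.2 && (e.1 != i) && (e.2 != i)) E e) *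
  ((\prod_(j | arrow j i) E (j, i)) * \prod_(j | arrow i j) E (i, j)).
  rewrite (bigID (fun e : 'I_n * 'I_n => e.1 != i)) /=.
  rewrite (bigID (fun e : 'I_n * 'I_n => e.2 != i)) /= -mulrA; congr (_ * (_ * _)).
  - rewrite (reindex_onto (fun j => (j, i)) (fun e => e.1)) /=; last first.
      by move=> [a b] /= /andP[_ /negPn/eqP->].
    apply: eq_bigl => j; rewrite !eqxx andbT /= andbT.
    by case: (eqVneq j i) => [->|_]; rewrite ?arrow_irr ?andbT.
  - rewrite (reindex_onto (fun j => (i, j)) (fun e => e.2)) /=; last first.
      by move=> [a b] /= /andP[_ /negPn/eqP->].
    by apply: eq_bigl => j; rewrite !eqxx /= !andbT.
rewrite /node_wt -/(\prod_(e : 'I_n * 'I_n | arrow e.1 e.2) E e) arrowE.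
have -> : \prod_(e : 'I_n * 'I_n | arrow e.1 e.2 && (e.1 != i) && (e.2 != i)) E e
   = \prod_(e : 'I_n * 'I_n | arrow e.1 e.2 && (e.1 != i) && (e.2 != i)) \prod_(a < v e.1) \prod_(b < v e.2)
     U (h ^+ ex e.2 b / h ^+ ex e.1 a) ((p e.2 b)%:Z - (p e.1 a)%:Z).
  apply: eq_bigr => e /andP[/andP[_ e1] e2]; apply: eq_bigr => a _; apply: eq_bigr => b _.
  by rewrite !uj.
have -> : \prod_(j | arrow j i) E (j, i) = \prod_(a < v i) \prod_(j | arrow j i) \prod_(b < v j)
     U (h ^+ ex i a / h ^+ ex j b) ((g a)%:Z - (p j b)%:Z).
  rewrite [RHS]exchange_big /=; apply: eq_bigr => j ji; rewrite /E /= exchange_big /=.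
  apply: eq_bigr => a _; apply: eq_bigr => b _; rewrite ui uj //.
  by apply: contraTneq ji => ->; rewrite arrow_irr.
have -> : \prod_(j | arrow i j) E (i, j) =
   (q / h) ^ ((\sum_(j | arrow i j) v j)%N%:Z * (\sum_(a < v i) g a)%N%:Z
               - (v i)%:Z * (\sum_(j | arrow i j) \sum_(b < v j) p j b)%N%:Z) *
   \prod_(a < v i) \prod_(j | arrow i j) \prod_(b < v j)
     U (h ^+ ex i a / h ^+ (ex j b).+1) ((g a)%:Z - (p j b)%:Z).
  have -> : (\sum_(j | arrow i j) v j)%N%:Z * (\sum_(a < v i) g a)%N%:Z
               - (v i)%:Z * (\sum_(j | arrow i j) \sum_(b < v j) p j b)%N%:Z
    = \sum_(j | arrow i j) \sum_(a < v i) \sum_(b < v j) ((g a)%:Z - (p j b)%:Z).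
    have -> : \sum_(j | arrow i j) \sum_(a < v i) \sum_(b < v j) ((g a)%:Z - (p j b)%:Z)
       = \sum_(j | arrow i j) ((v j)%:Z * (\sum_(a < v i) g a)%N%:Z - (v i)%:Z * (\sum_(b < v j) p j b)%N%:Z).
      apply: eq_bigr => j _; rewrite (eq_bigr (fun a : 'I_(v i) => (v j)%:Z * (g a)%:Z - (\sum_(b < v j) p j b)%N%:Z)).
        rewrite sumrB -mulr_sumr sumr_const card_ord -[_ *+ _]mulr_natl natz.
        by congr (_ * _ - _); rewrite (big_morph Posz PoszD (erefl _)).
      move=> a _; rewrite sumrB sumr_const card_ord -[_ *+ _]mulr_natl natz.
      by rewrite (big_morph Posz PoszD (erefl _)).
    by rewrite sumrB -mulr_suml -mulr_sumr !(big_morph Posz PoszD (erefl _)).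
  rewrite [X in _ = _ * X]exchange_big (expz_sum _ _ _ r0) -big_split /=; apply: eq_bigr => j ij.
  have ji : j != i by apply: contraTneq ij => ->; rewrite arrow_irr.
  rewrite (expz_sum _ _ _ r0) -big_split /=; apply: eq_bigr => a _.
  rewrite (expz_sum _ _ _ r0) -big_split /=; apply: eq_bigr => b _.
  rewrite ui uj // -[(p j b)%:Z - _]opprB zpochq_rev ?mulf_neq0 ?invr_eq0 ?expf_neq0 //.
  congr (_ * zpochq _ _ _ _); rewrite exprS; field; rewrite ?h0 ?expf_neq0 //.
rewrite [X in _ * X = _](bigD1 i) //=.
have -> : \prod_(j | j != i) \prod_(a < v j) \prod_(b < v j)
     (U (h ^+ ex j b / h ^+ ex j a) ((upd p i g j b)%:Z - (upd p i g j a)%:Z))^-1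
   = \prod_(j | j != i) \prod_(a < v j) \prod_(b < v j)
     (U (h ^+ ex j b / h ^+ ex j a) ((p j b)%:Z - (p j a)%:Z))^-1.
  by apply: eq_bigr => j ji; apply: eq_bigr => a _; apply: eq_bigr => b _; rewrite !uj.
have -> : \prod_(a < v i) \prod_(b < v i)
     (U (h ^+ ex i b / h ^+ ex i a) ((upd p i g i b)%:Z - (upd p i g i a)%:Z))^-1
   = \prod_(a < v i) \prod_(b < v i) (U (h ^+ ex i b / h ^+ ex i a) ((g b)%:Z - (g a)%:Z))^-1.
  by apply: eq_bigr => a _; apply: eq_bigr => b _; rewrite !ui.
rewrite /Gwt; under [X in _ = _ * (X * _)]eq_bigr => a _ do rewrite big_ylist /=.
rewrite [X in _ = _ * (X * _)]big_split /= [X in _ = _ * (_ * X * _)]big_split /=.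
have -> : \prod_(a < v k) U (h ^+ ex k a) (upd p i g k a) =
   (if i == k then 1 else \prod_(a < v k) U (h ^+ ex k a) (p k a)) *
   \prod_(a < v i) (if i == k then U (h ^+ ex i a / h ^+ 0) ((g a)%:Z - 0%:Z) else 1).
  case: (eqVneq i k) => [<-|ik].
    by rewrite mul1r; apply: eq_bigr => a _; rewrite ui expr0 divr1 subr0.
  by rewrite big1_eq mulr1; apply: eq_bigr => a _; rewrite uj // eq_sym.
rewrite /rest_wt.
have regroup (c F A I Z O S R : K) : c * F * (A * (I * (Z * O))) * (S * R) = c * A * R * Z * (F * (I * O) * S) by ring.
exact: regroup.
Qed.

Definition Nexp (v d : 'I_n -> nat) : int := \sum_j b_coef k v j * (d j)%:Z.

Variables (M N : nat).
Hypothesis N_gt0 : (0 < N)%N.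

Definition vertexN (v d : 'I_n -> nat) : K :=
  (q / h) ^ Nexp v d * node_sum M N v d (node_wt v).

Lemma node_wt_ext v : node_ext (node_wt v).
Proof.
move=> p p' e; rewrite /node_wt; congr (_ * _ * _).
- by apply: eq_bigr => a _; rewrite e.
- by apply: eq_bigr => x _; apply: eq_bigr => a _; apply: eq_bigr => b _; rewrite !e.
- by apply: eq_bigr => j _; apply: eq_bigr => a _; apply: eq_bigr => b _; rewrite !e.
Qed.

Lemma rest_wt_upd i v x p : rest_wt i (upd v i x) p = rest_wt i v p.
Proof.
have uj j : j != i -> upd v i x j = v j by rewrite /upd => /negPf->.
rewrite /rest_wt; congr (_ * _ * _).
- by case: (eqVneq i k) => // ik; rewrite uj // eq_sym.
- by apply: eq_bigr => e /andP[/andP[_ e1] e2]; rewrite !uj.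
- by apply: eq_bigr => j ji; rewrite uj.
Qed.

Lemma ylist_upd i v x p : ylist (upd v i x) i p = ylist v i p.
Proof.
have uj j : j != i -> upd v i x j = v j by rewrite /upd => /negPf->.
rewrite /ylist; congr (_ ++ (flatten _ ++ flatten _)); apply/eq_in_map => j.
  by rewrite mem_filter => /andP[ij _]; rewrite uj //; apply: contraTneq ij => ->; rewrite arrow_irr.
by rewrite mem_filter => /andP[ij _]; rewrite uj //; apply: contraTneq ij => ->; rewrite arrow_irr.
Qed.

Lemma vertexN_split v i d : (forall j, (v j <= M)%N) ->
  vertexN v d = (q / h) ^ (Nexp v d + (outdeg i v)%:Z * (d i)%:Z - (v i)%:Z * (outdeg i d)%:Z) *
    node_sum M N (upd v i 0%N) (upd d i 0%N)
      (fun p => rest_wt i v p * csum N (v i) (d i) (Gwt q h (ex i) (v i) (ylist v i p))).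
Proof.
move=> vM; rewrite /vertexN -addrA expfzDr // -mulrA; congr (_ * _).
rewrite (node_sum_split N_gt0 d (vM i) (node_wt_ext v)) node_sumZ; set E := (_ * _ - _ * _).
apply: node_sum_eq => p _ pd.
have po : (\sum_(j | arrow i j) \sum_(b < v j) p j b)%N = outdeg i d.
  apply: eq_bigr => j ij; have ji : j != i by apply: contraTneq ij => ->; rewrite arrow_irr.
  by have := pd j; rewrite /upd (negPf ji); apply.
rewrite /csum !mulr_sumr; apply: eq_bigr => g /eqP sg; rewrite node_wt_split po.
rewrite (eq_bigr (fun a : 'I_(v i) => g a : nat)); last by move=> a _; rewrite extzE.
by rewrite sg -/(outdeg i v) -/E mulrAC mulrC.
Qed.

Lemma b_coefE v j : b_coef k v j = (indeg j v)%:Z - (outdeg j v)%:Z + (j == k)%:Z.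
Proof. by rewrite /b_coef /indeg /outdeg !(big_morph Posz PoszD (erefl _)). Qed.

Lemma Nexp_upd_l v i d :
  Nexp (upd v i (v i).+1) d = Nexp v d + (outdeg i d)%:Z - (indeg i d)%:Z.
Proof.
have sumb (P : pred 'I_n) x : \sum_(l | P l) (upd v i (v i).+1 l)%:Z * x
    = \sum_(l | P l) (v l)%:Z * x + (P i)%:Z * x.
  case Pi: (P i); last first.
    rewrite mul0r addr0; apply: eq_bigr => l Pl; rewrite /upd; case: eqP => // e.
    by rewrite -e Pl in Pi.
  rewrite (bigD1 i) //= [in RHS](bigD1 i) //= {1}/upd eqxx -addn1 PoszD mulrDl.
  rewrite -!addrA; congr (_ + _); rewrite [RHS]addrC; congr (_ + _).
  by apply: eq_bigr => l /andP[_ /negPf li]; rewrite /upd li.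
have bE j : b_coef k (upd v i (v i).+1) j = b_coef k v j + (arrow i j)%:Z - (arrow j i)%:Z.
  rewrite /b_coef; have := sumb (fun l => arrow l j) 1; have := sumb (fun l => arrow j l) 1.
  rewrite -!mulr_suml !mulr1 => -> ->.
  by ring.
rewrite /Nexp (eq_bigr (fun j => b_coef k v j * (d j)%:Z + ((arrow i j)%:Z * (d j)%:Z - (arrow j i)%:Z * (d j)%:Z))); last first.
  by move=> j _; rewrite bE; ring.
rewrite big_split /= sumrB addrA /outdeg /indeg !(big_morph Posz PoszD (erefl _)).
have bm (P : pred 'I_n) : \sum_(l | P l) (d l)%:Z = \sum_l (P l)%:Z * (d l)%:Z.
  by rewrite big_mkcond; apply: eq_bigr => l _; case: ifP => _; rewrite ?mul1r ?mul0r.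
by rewrite !bm.
Qed.

Lemma Nexp_upd_r v i d x : Nexp v (upd d i x) = Nexp v d + b_coef k v i * (x%:Z - (d i)%:Z).
Proof.
rewrite /Nexp (bigD1 i) //= [in RHS](bigD1 i) //= {1}/upd eqxx.
rewrite (eq_bigr (fun j => b_coef k v j * (d j)%:Z)); first by ring.
by move=> j /negPf ji; rewrite /upd ji.
Qed.

(** The duality is applied inside the outer sum, for each choice of the other integers. The powers
    of q / hbar coming from [Nexp], from the reversed arrows and from the duality combine into
    [a_coef] and [reflexp]. *)
Lemma vertexN_rec v i d : (forall a, (ex i a < ex i a.+1)%N) ->
  (forall j, (v j <= M)%N) -> (v i < M)%N ->
  (forall p, exists A B, perm_eq (ylist v i p) (nbrs (ex i) (v i) A B)) ->
  (d i < N)%N -> (nbrdeg i d + d i < N)%N ->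
  let v1 := upd v i (v i).+1 in
  vertexN v1 d = \sum_(j < (d i).+1 | (d i <= nbrdeg i d + j)%N)
     let d' := upd d i (nbrdeg i d + j - d i)%N in
     pochq q h 1 j * (q / h) ^ (a_coef v1 i * j%:Z + reflexp v1 i d') * vertexN v d'.
Proof.
move=> e_lt vM viM loc diN nN v1; set m := v i in v1 viM *.
have v1i : v1 i = m.+1 by rewrite /v1 /upd eqxx.
have v1M j : (v1 j <= M)%N by rewrite /v1 /upd; case: eqP.
have v10 : upd v1 i 0%N = upd v i 0%N by apply/funext=> j; rewrite /v1 /upd; case: eqP.
(* Counting the neighbours gives (mu_v, alpha_i) = 1, in the form that eliminates the in-degree from
   the exponents. *)
have cnt : ((i == k) + nbrdeg i v = m.*2.+1)%N.
  have [A [B yP]] := loc (fun _ _ => 0%N).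
  have : (\sum_(y <- ylist v i (fun _ _ => 0%N)) 1 = \sum_(y <- nbrs (ex i) m A B) 1)%N by apply: perm_big.
  rewrite big_nbrs big_ylist /= !sum_nat_const !card_ord !muln1.
  under eq_bigr => j _ do rewrite sum_nat_const card_ord muln1.
  under [X in (_ + (_ + X))%N]eq_bigr => j _ do rewrite sum_nat_const card_ord muln1.
  by rewrite addSn addnn => <-; case: (i == k).
rewrite (vertexN_split i d v1M) v10 v1i.
transitivity ((q / h) ^ (Nexp v1 d + (outdeg i v1)%:Z * (d i)%:Z - m.+1%:Z * (outdeg i d)%:Z) *
  node_sum M N (upd v i 0%N) (upd d i 0%N) (fun p => \sum_(j < (d i).+1 | (d i <= nbrdeg i d + j)%N)
     ((h / q) ^+ (m * j) * pochq q h 1 j *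
     (q / h) ^ (m.*2.+1%:Z * (nbrdeg i d + j - d i)%N%:Z - m%:Z * (nbrdeg i d)%N%:Z)) *
     (rest_wt i v p * csum N m (nbrdeg i d + j - d i) (Gwt q h (ex i) m (ylist v i p))))).
  congr (_ * _); apply: node_sum_eq => p _ pd; rewrite /v1 rest_wt_upd ylist_upd.
  have [A [B yP]] := loc p.
  have pj j : j != i -> (\sum_(b < v j) p j b)%N = d j.
    by move=> ji; have := pd j; rewrite /upd (negPf ji); apply.
  have Y : (\sum_(y <- ylist v i p) y.2 = nbrdeg i d)%N.
    rewrite big_ylist /= if_same add0n; congr (_ + _)%N; apply: eq_bigr => j ij; apply: pj.
      by apply: contraTneq ij => ->; rewrite arrow_irr.
    by apply: contraTneq ij => ->; rewrite arrow_irr.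
  rewrite (local_duality q0 h0 hq_inj e_lt yP diN) Y // mulr_sumr; apply: eq_bigr => j _.
  by rewrite mulrCA.
rewrite node_sum_sum mulr_sumr; apply: eq_bigr => j le_d.
cbv zeta; set R := (nbrdeg i d + j - d i)%N; set d' := upd d i R.
have d'i : d' i = R by rewrite /d' /upd eqxx.
have d'0 : upd d' i 0%N = upd d i 0%N by apply/funext=> l; rewrite /d' /upd; case: eqP.
rewrite (vertexN_split i d' vM) d'0 d'i -node_sumZ.
have hq_rn : (h / q) ^+ (m * j) = (q / h) ^ (- (m * j)%N%:Z) by rewrite -exprnN -exprVn invf_div.
move: (pochq q h 1 j) => F; set S := node_sum _ _ _ _ _; rewrite hq_rn !mulrA; congr (_ * S).
have assoc (x1 x2 x3 y1 y2 : int) : x1 + (x2 + x3) = y1 + y2 ->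
    (q / h) ^ x1 * (q / h) ^ x2 * F * (q / h) ^ x3 = F * (q / h) ^ y1 * (q / h) ^ y2.
  by move=> e; rewrite -[RHS]mulrA -[X in _ = _ * X]expfzDr // -e !expfzDr //; ring.
apply: assoc; rewrite (Nexp_upd_l v i d) /d' Nexp_upd_r /reflexp /nbrdeg.
rewrite !(nbr_upd i v _).2 !(nbr_upd i d _).1 !(nbr_upd i d _).2 a_coefE v1i !(nbr_upd i v _).2.
rewrite {1 2}/upd eqxx b_coefE.
have -> : (indeg i v)%:Z = m.*2.+1%:Z - (outdeg i v)%:Z - (i == k)%:Z by rewrite /nbrdeg in cnt; lia.
have -> : R%:Z = (indeg i d)%:Z + (outdeg i d)%:Z + j%:Z - (d i)%:Z by rewrite /R /nbrdeg; rewrite /nbrdeg in le_d; lia.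
rewrite -addnn !PoszD PoszM -[m.+1]addn1 -[(m + m).+1]addn1 !PoszD.
by ring.
Qed.

End VertexRecursion.

(** * Reflection of power series *)

Section MonomialSeries.
Variables (n : nat) (K : fieldType).
Implicit Types (f : fps n K) (d b : 'X_{1..n}) (g : nat -> K).

(** The series of the monomials g s z^(s b). For nonzero b the exponents s beyond the degree cannot
    contribute. *)
Definition mono_series b g : fps n K :=
  fun d => \sum_(s < (mdeg d).+1) g s * (d == (b *+ s)%MM)%:R.

Lemma mdeg_muln_ge b s : b != 0%MM -> (s <= mdeg (b *+ s)%MM)%N.
Proof. by rewrite -mdeg_eq0 mdegMn -lt0n; case: (mdeg b) => // m _; rewrite mulSn leq_addr. Qed.

Lemma mono_series_coefM b g f d N : b != 0%MM -> (mdeg d < N)%N ->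
  (mono_series b g * f) d = \sum_(s < N | (b *+ s <= d)%MM) g s * f (d - b *+ s)%MM.
Proof.
move=> b0 dN; pose p : {mpoly K[n]} := \sum_(s < N) g s *: 'X_[(b *+ s)%MM].
have pE m : (mdeg m < N)%N -> p@_m = mono_series b g m.
  move=> mN; rewrite /p raddf_sum /= /mono_series.
  rewrite (big_ord_widen N (fun s => g s * (m == (b *+ s)%MM)%:R) mN) [RHS]big_mkcond /=.
  apply: eq_bigr => s _; rewrite mcoeffZ mcoeffX eq_sym; case: ltnP => // ms.
  case: eqP => [e|_]; last by rewrite mulr0.
  by have := mdeg_muln_ge s b0; rewrite -e leqNgt ms.
rewrite [LHS](@fps_mulE _ _ N _ _ p (fps_trunc N f)) //; last exact: fps_truncE.
rewrite /p mulr_suml raddf_sum /= [RHS]big_mkcond /=; apply: eq_bigr => s _.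
rewrite -scalerAl mcoeffZ; case: ifP => [le|/negP nle].
  have -> : ('X_[b *+ s] * fps_trunc N f)@_d = (fps_trunc N f * 'X_[b *+ s])@_(b *+ s + (d - b *+ s))%MM.
    by rewrite mulrC addmC submK.
  rewrite mcoeffMX fps_truncE // (leq_ltn_trans _ dN) // -[X in (_ <= mdeg X)%N](submK le).
  by rewrite mdegD leq_addr.
rewrite mcoeffM big1 ?mulr0 // => k /eqP dk; rewrite mcoeffX; case: eqP => [e|_]; last by rewrite mul0r.
by case: nle; rewrite dk -e; apply: lem_addr.
Qed.

Variables (c : K) (v : 'I_n -> nat) (i : 'I_n).
Hypothesis c0 : c != 0.

(** The simple reflection at i in coordinates of simple roots. On the cone [in_cone] the reflected
    exponents stay nonnegative and the truncated subtraction is faithful. *)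
Definition reflm d : 'X_{1..n} := [multinom (if j == i then nbrdeg i d - d i else d j)%N | j < n].
Definition in_cone d : bool := (d i <= nbrdeg i d)%N.
Definition cone_supp f : Prop := forall d, ~~ in_cone d -> f d = 0.
(** The substitution of z_i^(-1) for z_i and of z_j z_i for z_j at the neighbours j of i, up to a
    rescaling by powers of [c]. *)
Definition reflect_series f : fps n K :=
  fun d => if in_cone d then c ^ reflexp v i (reflm d) * f (reflm d) else 0.

Lemma deg_ext (F G : 'I_n -> nat) : (forall j, j != i -> F j = G j) ->
  (indeg i F = indeg i G) * (outdeg i F = outdeg i G).
Proof. by move=> FG; split; apply: eq_bigr => j ij; apply: FG; apply: contraTneq ij => ->; rewrite arrow_irr. Qed.

Lemma deg_reflm d : (indeg i (reflm d) = indeg i d) * (outdeg i (reflm d) = outdeg i d).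
Proof. by apply: deg_ext => j /negPf ji; rewrite mnmE ji. Qed.

Lemma nbrdeg_reflm d : nbrdeg i (reflm d) = nbrdeg i d.
Proof. by rewrite /nbrdeg !(deg_reflm d). Qed.

Lemma reflm_i d : reflm d i = (nbrdeg i d - d i)%N.
Proof. by rewrite mnmE eqxx. Qed.

Lemma reflmK d : in_cone d -> reflm (reflm d) = d.
Proof.
move=> cd; apply/mnmP=> j; rewrite mnmE nbrdeg_reflm reflm_i.
by case: eqP => [->|/eqP/negPf ji]; rewrite ?subKn // mnmE ji.
Qed.

Lemma reflm_cone d : in_cone (reflm d).
Proof. by rewrite /in_cone nbrdeg_reflm reflm_i leq_subr. Qed.

Lemma degD d d' : (indeg i (d + d')%MM = (indeg i d + indeg i d')%N) *
  (outdeg i (d + d')%MM = (outdeg i d + outdeg i d')%N).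
Proof. by split; rewrite -big_split; apply: eq_bigr => j _; apply: mnmDE. Qed.

Lemma nbrdegD d d' : nbrdeg i (d + d')%MM = (nbrdeg i d + nbrdeg i d')%N.
Proof. by rewrite /nbrdeg !(degD d d') addnACA. Qed.

Lemma coneD d d' : in_cone d -> in_cone d' -> in_cone (d + d')%MM.
Proof. by rewrite /in_cone nbrdegD => *; rewrite mnmDE; apply: leq_add. Qed.

Lemma cone_muln d s : in_cone d -> in_cone (d *+ s)%MM.
Proof.
move=> cd; elim: s => [|s IHs]; last by rewrite mulmS; apply: coneD.
by rewrite mulm0n /in_cone mnm0E.
Qed.

Lemma reflmD d d' : in_cone d -> in_cone d' -> reflm (d + d')%MM = (reflm d + reflm d')%MM.
Proof.
rewrite /in_cone => cd cd'; apply/mnmP=> j; rewrite mnmDE !mnmE nbrdegD.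
by case: eqP => _ //; lia.
Qed.

Lemma reflm_muln d s : in_cone d -> reflm (d *+ s)%MM = (reflm d *+ s)%MM.
Proof.
move=> cd; elim: s => [|s IHs]; last by rewrite !mulmS reflmD ?IHs // cone_muln.
rewrite !mulm0n; apply/mnmP=> j; rewrite mnmE !mnm0E.
suff -> : nbrdeg i (0%MM : 'X_{1..n}) = 0%N by case: eqP.
by rewrite /nbrdeg /indeg /outdeg !big1 // => l _; rewrite mnm0E.
Qed.

Lemma reflexpD d d' : reflexp v i (d + d')%MM = reflexp v i d + reflexp v i d'.
Proof. by rewrite /reflexp nbrdegD !(degD d d') mnmDE !PoszD; ring. Qed.

Lemma reflexp0 : reflexp v i (0%MM : 'X_{1..n}) = 0.
Proof. by have := reflexpD 0%MM 0%MM; rewrite addm0 => e; apply: (addrI (reflexp v i (0%MM : 'X_{1..n}))); rewrite addr0. Qed.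

Lemma reflexp_muln d s : reflexp v i (d *+ s)%MM = reflexp v i d * s%:Z.
Proof.
elim: s => [|s IHs]; first by rewrite mulm0n reflexp0 mulr0.
by rewrite mulmS reflexpD IHs -addn1 PoszD mulrDr mulr1 addrC.
Qed.

Lemma cone_supp1 : cone_supp 1.
Proof.
move=> d cd; rewrite fps_coef1; case: eqP => // d0; case/negP: cd.
by rewrite d0 /in_cone mnm0E.
Qed.

Lemma reflect_series1 : reflect_series 1 = 1.
Proof.
apply/funext=> d; rewrite /reflect_series fps_coef1.
have r0 : reflm 0%MM = 0%MM by have := reflm_muln 0 (reflm_cone 0%MM); rewrite !mulm0n.
case: (boolP (in_cone d)) => [cd|/cone_supp1 <-]; last by [].
rewrite fps_coef1; case: (eqVneq d 0%MM) => [->|d0]; first by rewrite r0 eqxx reflexp0 expr0z mulr1.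
by case: eqP => [e|]; rewrite ?mulr0 //; case/eqP: d0; rewrite -(reflmK cd) e r0.
Qed.

(** On the cone [reflm] and [reflexp] are additive, so the terms correspond one to one; those with
    an exponent outside the cone vanish on both sides. *)
Lemma reflect_mono_series b g f : b != 0%MM -> in_cone b -> cone_supp f ->
  cone_supp (mono_series b g * f) /\
  reflect_series (mono_series b g * f) =
    mono_series (reflm b) (fun s => g s * c ^ (reflexp v i b * s%:Z)) * reflect_series f.
Proof.
move=> b0 cb sf; have rb0 : reflm b != 0%MM.
  apply: contra b0 => /eqP e; have r0 : reflm 0%MM = 0%MM by have := reflm_muln 0 (reflm_cone 0%MM); rewrite !mulm0n.
  by rewrite -(reflmK cb) e r0.
split=> [d cd|].
  rewrite (mono_series_coefM _ _ b0 (ltnSn (mdeg d))) big1 // => s le.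
  rewrite sf ?mulr0 //; apply: contra cd => ce.
  by rewrite -(submK le); apply: coneD => //; apply: cone_muln.
apply/funext=> d; pose N := (maxn (mdeg d) (mdeg (reflm d))).+1.
rewrite (@mono_series_coefM _ _ _ _ N rb0) ?ltnS ?leq_maxl //.
rewrite {1}/reflect_series; case: ifP => [cd|/negbT cd]; last first.
  rewrite big1 // => s le; rewrite /reflect_series; case: ifP => [ce|_]; last by rewrite mulr0.
  case/negP: cd; rewrite -(submK le); apply: coneD => //.
  by apply/cone_muln/reflm_cone.
rewrite (@mono_series_coefM _ _ _ _ N b0) ?ltnS ?leq_maxr // mulr_sumr big_mkcond [RHS]big_mkcond.
apply: eq_bigr => s _ /=.
case: (boolP (b *+ s <= reflm d)%MM) => [le|nle].
  have [ce|nce] := boolP (in_cone (reflm d - b *+ s)%MM).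
    set e := (reflm d - b *+ s)%MM in ce *.
    have dE : d = (reflm e + reflm b *+ s)%MM.
      by rewrite -(reflmK cd) -(submK le) reflmD ?cone_muln // reflm_muln.
    have le' : (reflm b *+ s <= d)%MM by rewrite dE; apply: lem_addl.
    rewrite le'; have -> : (d - reflm b *+ s)%MM = reflm e by rewrite {1}dE addmK.
    rewrite /reflect_series reflm_cone (reflmK ce) -{1}(submK le) reflexpD reflexp_muln.
    by rewrite expfzDr // -/e; move: (f e) (c ^ _) (c ^ _) (g s) => x1 x2 x3 x4; ring.
  rewrite sf // !mulr0; case: ifP => // le'; rewrite /reflect_series; case: ifP => [ce'|_]; last by rewrite mulr0.
  case/negP: nce; set e' := (d - reflm b *+ s)%MM in ce'.
  have -> : reflm d = (reflm e' + b *+ s)%MM.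
    by rewrite -(submK le') reflmD // ?reflm_muln ?reflmK //; [apply/reflm_cone | apply/cone_muln/reflm_cone].
  by rewrite addmK; apply: reflm_cone.
case: ifP => // le'; rewrite /reflect_series; case: ifP => [ce'|_]; last by rewrite mulr0.
case/negP: nle; set e' := (d - reflm b *+ s)%MM in ce'.
have -> : reflm d = (reflm e' + b *+ s)%MM.
  by rewrite -(submK le') reflmD // ?reflm_muln ?reflmK //; [apply/reflm_cone | apply/cone_muln/reflm_cone].
exact: lem_addl.
Qed.

Lemma reflect_prod (T : finType) (P : pred T) (b : T -> 'X_{1..n}) (g : T -> nat -> K) :
  (forall t, P t -> b t != 0%MM /\ in_cone (b t)) ->
  cone_supp (\prod_(t | P t) mono_series (b t) (g t)) /\
  reflect_series (\prod_(t | P t) mono_series (b t) (g t)) =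
   \prod_(t | P t) mono_series (reflm (b t)) (fun s => g t s * c ^ (reflexp v i (b t) * s%:Z)).
Proof.
move=> hb; apply: (big_rec2 (fun y x => cone_supp x /\ reflect_series x = y)) => [|t y x Pt [sx <-]].
  by split; [apply: cone_supp1 | apply: reflect_series1].
by have [bt0 ct] := hb t Pt; apply: reflect_mono_series.
Qed.

End MonomialSeries.

(** * Roots of type D *)

Section Roots.
Variable n : nat.
Hypothesis n_gt1 : (1 < n)%N.
Implicit Types (x y : 'rV[rat]_n) (i j : 'I_n).

Lemma pairingC x y : pairing x y = pairing y x.
Proof. by apply: eq_bigr => j _; rewrite mulrC. Qed.

Lemma pairingDl x x' y : pairing (x + x') y = pairing x y + pairing x' y.
Proof. by rewrite -big_split; apply: eq_bigr => j _; rewrite mxE mulrDl. Qed.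

Lemma pairingNl x y : pairing (- x) y = - pairing x y.
Proof. by rewrite -sumrN; apply: eq_bigr => j _; rewrite mxE mulNr. Qed.

Lemma pairingBl x x' y : pairing (x - x') y = pairing x y - pairing x' y.
Proof. by rewrite pairingDl pairingNl. Qed.

Lemma pairingZl a x y : pairing (a *: x) y = a * pairing x y.
Proof. by rewrite mulr_sumr; apply: eq_bigr => j _; rewrite mxE mulrA. Qed.

Lemma pairing_suml (I : Type) (r : seq I) (P : pred I) (F : I -> 'rV[rat]_n) y :
  pairing (\sum_(l <- r | P l) F l) y = \sum_(l <- r | P l) pairing (F l) y.
Proof.
apply: (big_morph (fun z => pairing z y)) => [a b|]; first exact: pairingDl.
by rewrite /pairing big1 // => j _; rewrite mxE mul0r.
Qed.

Lemma pairing_eps a b : (0 < a <= n)%N -> pairing (eps n a) (eps n b) = (a == b)%:R.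
Proof.
case: a => // a /andP[_ an]; rewrite /pairing (bigD1 (Ordinal an)) //= !mxE eqxx mul1r.
rewrite big1 ?addr0 // => j ja; rewrite mxE eqSS.
suff /negPf-> : (j : nat) != a by rewrite mul0r.
by apply: contra ja => /eqP e; apply/eqP/val_inj.
Qed.

Lemma pairingBr x y y' : pairing x (y - y') = pairing x y - pairing x y'.
Proof. by rewrite ![pairing x _]pairingC pairingBl. Qed.

Lemma pairingDr x y y' : pairing x (y + y') = pairing x y + pairing x y'.
Proof. by rewrite ![pairing x _]pairingC pairingDl. Qed.

Lemma pairingZr a x y : pairing x (a *: y) = a * pairing x y.
Proof. by rewrite ![pairing x _]pairingC pairingZl. Qed.

Lemma pairing_simple i j : pairing (simple_root i) (simple_root j) =
  (i == j)%:R *+ 2 - (arrow i j)%:R - (arrow j i)%:R.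
Proof.
have ni := ltn_ord i; have nj := ltn_ord j.
rewrite /simple_root -val_eqE /arrow /=.
case: ltnP => hi; case: ltnP => hj;
  rewrite ?(pairingBl, pairingDl) ?(pairingBr, pairingDr) !pairing_eps; try lia.
all: rewrite ?mulr2n !pmulrn -?(intrB, intrD); congr (_%:~R); lia.
Qed.

Definition refl i x : 'rV[rat]_n := x - pairing x (simple_root i) *: simple_root i.

Lemma pairing_refl i x y : pairing (refl i x) (refl i y) = pairing x y.
Proof.
have a2 : pairing (simple_root i) (simple_root i) = 2.
  by rewrite pairing_simple eqxx arrow_irr !subr0.
rewrite /refl pairingBl !pairingBr !pairingZl !pairingZr a2 [pairing (simple_root i) y]pairingC.
by ring.
Qed.

Lemma reflD i x y : refl i (x + y) = refl i x + refl i y.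
Proof. by rewrite /refl pairingDl scalerDl opprD addrACA. Qed.

Lemma reflN i x : refl i (- x) = - refl i x.
Proof. by rewrite /refl pairingNl scaleNr opprB opprK addrC. Qed.

Definition root_of (t : 'I_n * 'I_n * bool) : 'rV[rat]_n :=
  if t.2 then eps n t.1.1.+1 + eps n t.1.2.+1 else eps n t.1.1.+1 - eps n t.1.2.+1.

Definition root_idx (t : 'I_n * 'I_n * bool) : bool := (t.1.1 < t.1.2)%N.

Lemma big_positive_roots (R : comNzRingType) (P : pred 'rV[rat]_n) (F : 'rV[rat]_n -> R) :
  \prod_(a <- positive_roots n | P a) F a = \prod_(t | root_idx t && P (root_of t)) F (root_of t).
Proof.
pose G (s : bool) (a b : nat) : R :=
  let z := (if s then eps n a + eps n b else eps n a - eps n b) in if P z then F z else 1.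
have E s : \prod_(a <- [seq (if s then eps n a + eps n b else eps n a - eps n b) | a <- iota 1 n, b <- iota a.+1 (n - a)] | P a) F a
    = \prod_(xy : 'I_n * 'I_n | (xy.1 < xy.2)%N) G s xy.1.+1 xy.2.+1.
  rewrite big_mkcond big_allpairs_dep /=.
  have -> : iota 1 n = index_iota 1 n.+1 by rewrite /index_iota subSS subn0.
  rewrite big_add1 /= big_mkord.
  rewrite -(pair_big_dep xpredT (fun k l : 'I_n => (k < l)%N) (fun k l => G s k.+1 l.+1)) /=.
  apply: eq_bigr => x _.
  have -> : iota x.+2 (n - x.+1) = index_iota x.+2 n.+1 by rewrite /index_iota subSS.
  by rewrite big_add1 /= big_geq_mkord.
rewrite /positive_roots big_cat /= (E false) (E true) /G /= [RHS]big_mkcondr /=.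
have -> : \prod_(t | root_idx t) (if P (root_of t) then F (root_of t) else 1)
   = \prod_(xy : 'I_n * 'I_n | (xy.1 < xy.2)%N) \prod_(s : bool) (if P (root_of (xy, s)) then F (root_of (xy, s)) else 1).
  rewrite pair_big_dep /=; apply: eq_big => [[xy s]|[xy s] _] //=.
  by rewrite andbT.
rewrite -big_split /=; apply: eq_bigr => xy _.
by rewrite /= big_bool mulrC.
Qed.

(** For the labels i < n the reflection exchanges eps_i and eps_(i+1); for i = n it exchanges
    eps_(n-1) and -eps_n. The map [sg] is the induced involution on indices. *)
Lemma refl_index i : exists t0 (sg : 'I_n * 'I_n * bool -> 'I_n * 'I_n * bool),
  [/\ root_idx t0, root_of t0 = simple_root i &
   forall t, root_idx t -> t != t0 ->
     [/\ root_idx (sg t), sg t != t0, sg (sg t) = t & root_of (sg t) = refl i (root_of t)]].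
Proof.
have ni := ltn_ord i.
have [hi|hi] := ltnP i.+1 n.
  pose i' : 'I_n := Ordinal hi.
  have ii' : i != i' by apply/eqP => /(congr1 val) /=; lia.
  pose tau (x : 'I_n) := if x == i then i' else if x == i' then i else x.
  have tauK (x : 'I_n) : tau (tau x) = x.
    rewrite /tau; have [->|xi] := eqVneq x i; first by rewrite eq_sym (negPf ii') eqxx.
    by have [->|xi'] := eqVneq x i'; rewrite ?eqxx // (negPf xi) (negPf xi').
  have taulen (x y : 'I_n) : (x < y)%N -> ~~ (tau x < tau y)%N -> x = i /\ y = i'.
    move=> h1; rewrite /tau -!val_eqE /= => h2.
    suff [e1 e2] : (x : nat) = i /\ (y : nat) = i.+1 by split; apply/val_inj.
    by move: h2; do !case: ifP => /=; lia.
  (* The exchange keeps two indices increasing except for the pair (i, i'), where the root with the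
     plus sign is fixed. *)
  pose sg (t : 'I_n * 'I_n * bool) := if (tau t.1.1 < tau t.1.2)%N then (tau t.1.1, tau t.1.2, t.2) else t.
  have al : simple_root i = eps n i.+1 - eps n i'.+1 by rewrite /simple_root hi.
  have re (x : 'I_n) : refl i (eps n x.+1) = eps n (tau x).+1.
    have nx := ltn_ord x; rewrite /refl al pairingBr !pairing_eps ?ltn_ord //; try lia.
    rewrite /tau !eqSS -!val_eqE /=; case: (eqVneq (x : nat) i) => [->|xi].
      have -> : (i == i.+1 :> nat) = false by apply/eqP; lia.
      by rewrite subr0 scale1r opprB addrC subrK.
    case: (eqVneq (x : nat) i.+1) => [->|xi'].
      by rewrite sub0r scaleN1r opprK addrC subrK.
    by rewrite subrr scale0r subr0.
  exists (i, i', false), sg; split; [exact: ltnSn | by rewrite al |].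
  case=> [[x y] s]; rewrite /root_idx /= => xy ne.
  have sgE : (tau x < tau y)%N \/ [/\ x = i, y = i' & s].
    have [|nlt] := boolP (tau x < tau y)%N; first by left.
    right; have [ex ey] := taulen _ _ xy nlt; split=> //.
    by move: ne; rewrite ex ey; case: s => //; rewrite eqxx.
  case: sgE => [lt|[-> -> st]].
    rewrite /sg /= lt /= !tauK xy; split=> //.
      apply/negP => /eqP [] e1 e2 _; move: xy.
      by rewrite -(tauK x) -(tauK y) e1 e2 /tau eqxx [i' == i]eq_sym (negPf ii') eqxx /=; lia.
    by rewrite /root_of /=; case: s {ne}; rewrite ?reflD ?reflN !re.
  have e : (tau i < tau i')%N = false.
    by rewrite /tau eqxx [i' == i]eq_sym (negPf ii') eqxx /=; lia.
  rewrite /sg /= e /= e st; split=> //; first by rewrite xpair_eqE andbF.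
  have ti : tau i = i' by rewrite /tau eqxx.
  have ti' : tau i' = i by rewrite /tau eq_sym (negPf ii') eqxx.
  by rewrite /root_of reflD (re i) (re i') ti ti' addrC.
have lp : (n.-2 < n)%N by lia.
pose p : 'I_n := Ordinal lp.
have pi : p != i by apply/eqP => /(congr1 val) /=; lia.
pose tau (x : 'I_n) := if x == p then i else if x == i then p else x.
have tauK (x : 'I_n) : tau (tau x) = x.
  rewrite /tau; have [->|xp] := eqVneq x p; first by rewrite eq_sym (negPf pi) eqxx.
  by have [->|xi] := eqVneq x i; rewrite ?eqxx // (negPf xp) (negPf xi).
(* The sign flips when exactly one of the last two coordinates [p] and [i] occurs, necessarily in
   second position. The root eps_(n-1) - eps_n is orthogonal to the simple root and stays fixed. *)
pose sg (t : 'I_n * 'I_n * bool) :=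
  if (t.1.2 == p) || (t.1.2 == i) && (t.1.1 != p) then (t.1.1, tau t.1.2, ~~ t.2) else t.
have al : simple_root i = eps n p.+1 + eps n i.+1.
  have -> : p.+1 = n.-1 by rewrite /=; lia.
  by rewrite /simple_root ltnNge hi /=; congr (_ + eps n _); lia.
have re (x : 'I_n) : refl i (eps n x.+1) = if (x == p) || (x == i) then - eps n (tau x).+1 else eps n x.+1.
  have nx := ltn_ord x; rewrite /refl al pairingDr !pairing_eps ?ltn_ord //; try lia.
  rewrite /tau !eqSS -!val_eqE /=; case: (eqVneq (x : nat) n.-2) => [->|xp] /=.
    rewrite [n.-2 == i :> nat](_ : _ = false) ?addr0 ?scale1r; last by apply/eqP; lia.
    by rewrite opprD addrA subrr sub0r.
  case: (eqVneq (x : nat) i) => [->|xi] /=.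
    by rewrite add0r scale1r opprD addrCA subrr addr0.
  by rewrite addr0 scale0r subr0.
exists (p, i, true), sg; split; [by rewrite /root_idx /=; lia | by rewrite al |].
case=> [[x y] s]; rewrite /root_idx /= => xy ne; have ny := ltn_ord y.
have [cond|ncond] := boolP ((y == p) || (y == i) && (x != p)).
  have xp : (x < n.-2)%N.
    move: cond; rewrite -!val_eqE /=; lia.
  have [xp' xi'] : x != p /\ x != i by rewrite -!val_eqE /=; lia.
  have typ : (tau y == p) || (tau y == i).
    by rewrite /tau; case: (eqVneq y p) cond => [->|_] /=; [rewrite eqxx orbT | case/andP => -> _; rewrite eqxx].
  have c2 : (tau y == p) || (tau y == i) && (x != p) by rewrite xp' andbT.
  rewrite /sg /= cond /= c2 tauK negbK; split=> //.
  - by case/orP: typ => /eqP -> /=; lia.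
  - by apply/negP => /eqP [] e; rewrite e eqxx in xp'.
  - have yc : (y == p) || (y == i) by case/orP: cond => [->|/andP[-> _]]; rewrite ?orbT.
    by rewrite /root_of /=; case: s {ne}; rewrite ?reflD ?reflN !re (negPf xp') (negPf xi') yc ?opprK.
rewrite /sg /= (negPf ncond) /= (negPf ncond); split=> //.
case: (boolP ((x == p) && (y == i))) => [/andP[/eqP ex /eqP ey]|nxy].
  have tp : tau p = i by rewrite /tau eqxx.
  have ti : tau i = p by rewrite /tau eq_sym (negPf pi) eqxx.
  move: ne; rewrite ex ey; case: s => [|_]; first by rewrite eqxx.
  by rewrite /root_of reflD reflN (re p) (re i) ti tp eqxx [i == i]eqxx orbT opprK [RHS]addrC.
have [yp yi] : y != p /\ y != i.
  move: ncond nxy; rewrite -!val_eqE /=; lia.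
have [xp xi] : x != p /\ x != i by move: yp yi; rewrite -!val_eqE /=; lia.
by rewrite /root_of /=; case: s {ne}; rewrite ?reflD ?reflN !re (negPf xp) (negPf xi) (negPf yp) (negPf yi).
Qed.

End Roots.

Section Monomials.
Variables (n : nat) (K : fieldType).

Definition fps_mono (x : K) (b : 'X_{1..n}) : fps n K := fun d => x * (d == b)%:R.

Lemma fps_monoM x y b b' : fps_mono x b * fps_mono y b' = fps_mono (x * y) (b + b')%MM.
Proof.
have E z (e d : 'X_{1..n}) : (z *: 'X_[e] : {mpoly K[n]})@_d = fps_mono z e d.
  by rewrite mcoeffZ mcoeffX eq_sym.
apply/funext=> d.
rewrite [LHS](@fps_mulE _ _ (mdeg d).+1 _ _ (x *: 'X_[b]) (y *: 'X_[b'])) //; [|by move=> d' _; rewrite E..].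
by rewrite -scalerAl -scalerAr scalerA -mpolyXD E.
Qed.

Lemma fps_mono1 : fps_mono 1 0%MM = 1.
Proof. by apply/funext=> d; rewrite /fps_mono mul1r fps_coef1. Qed.

Lemma fps_monoX x b s : fps_mono x b ^+ s = fps_mono (x ^+ s) (b *+ s)%MM.
Proof.
elim: s => [|s IHs]; first by rewrite !expr0 mulm0n fps_mono1.
by rewrite !exprS IHs fps_monoM mulmS.
Qed.

Lemma fps_mono_prod (I : Type) (r : seq I) (x : I -> K) (b : I -> 'X_{1..n}) :
  \prod_(j <- r) fps_mono (x j) (b j) = fps_mono (\prod_(j <- r) x j) (\sum_(j <- r) b j)%MM.
Proof.
elim: r => [|j r IHr]; first by rewrite !big_nil fps_mono1.
by rewrite !big_cons IHr fps_monoM.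
Qed.

Lemma fps_comp_mono (F : fps 1 K) x b :
  fps_comp F (fps_mono x b) = mono_series b (fun s => F (U_(ord0) *+ s)%MM * x ^+ s).
Proof.
apply/funext=> d; rewrite /fps_comp /mono_series; apply: eq_bigr => s _.
by rewrite fps_monoX /fps_mono mulrA.
Qed.

End Monomials.

(** * The product over the roots and its recursion *)

Section RootFactors.
Variables (n : nat) (k : 'I_n).
Hypothesis n_gt1 : (1 < n)%N.
Implicit Types (v : 'I_n -> nat) (i j : 'I_n) (a : 'rV[rat]_n).

Local Notation c := (qv / hv).

Definition rootm a : 'X_{1..n} := [multinom root_coef a j | j < n].

(** The exponent of q / hbar in e^alpha, for alpha with simple coordinates [b]. *)
Definition kappa v (b : 'X_{1..n}) : int := \sum_j a_coef v j * (b j)%:Z.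

Definition root_series v a : fps n Qqh :=
  mono_series (rootm a) (fun s => pochq qv hv 1 s * c ^ (kappa v (rootm a) * s%:Z)).

Let c0 : c != 0 :> Qqh. Proof. exact: mulf_neq0 qv_neq0 (invr_neq0 hv_neq0). Qed.

Lemma exp_rootE v a : exp_root v a = fps_mono (c ^ kappa v (rootm a)) (rootm a).
Proof.
rewrite /exp_root.
have E j : (fpsC (c ^ a_coef v j) * fpsX Qqh j) ^+ root_coef a j =
   fps_mono (c ^ (a_coef v j * (rootm a j)%:Z)) (U_(j) *+ root_coef a j)%MM.
  have -> : fpsC (c ^ a_coef v j) = fps_mono (c ^ a_coef v j) (0%MM : 'X_{1..n}) :> fps n Qqh.
    by apply/funext=> d; rewrite /fpsC /fps_mono; case: eqP => _; rewrite ?mulr1 ?mulr0.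
  have -> : fpsX Qqh j = fps_mono 1 U_(j)%MM by apply/funext=> d; rewrite /fpsX /fps_mono mul1r.
  by rewrite fps_monoM mulr1 add0m fps_monoX mnmE exprnP -exprz_exp.
rewrite (eq_bigr _ (fun j _ => E j)) fps_mono_prod; congr fps_mono.
  by rewrite /kappa -expz_sum.
apply/mnmP=> j; rewrite mnm_sumE (bigD1 j) //= big1 ?addn0 => [|l lj].
  by rewrite mulmnE mnm1E eqxx mul1n mnmE.
by rewrite mulmnE mnm1E (negPf lj).
Qed.

Lemma fps_comp_root v a : fps_comp Fprod (exp_root v a) = root_series v a.
Proof.
rewrite exp_rootE fps_comp_mono /root_series; congr mono_series; apply/funext=> s.
by rewrite Fprod_coef exprnP exprz_exp.
Qed.

Lemma root_of_pos (t : 'I_n * 'I_n * bool) : root_idx t -> root_of t \in positive_roots n.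
Proof.
case: t => [[x y] s]; rewrite /root_idx /= => xy; have nx := ltn_ord x; have ny := ltn_ord y.
rewrite mem_cat /root_of /=; case: s; apply/orP; [right|left]; apply/allpairsPdep;
  by exists x.+1, y.+1; rewrite !mem_iota; split=> //; lia.
Qed.

Lemma root_of_neq0 (t : 'I_n * 'I_n * bool) : root_idx t -> root_of t != 0.
Proof.
case: t => [[x y] s]; rewrite /root_idx /= => xy; apply/eqP => /matrixP/(_ 0 x).
have -> : (root_of (x, y, s)) 0 x = 1.
  have e : (x.+1 == y.+1) = false by apply/eqP; lia.
  by rewrite /root_of /=; case: s; rewrite !mxE eqxx e ?oppr0 addr0.
by rewrite mxE => /eqP; rewrite oner_eq0.
Qed.

Lemma simple_coord (m : 'I_n -> rat) j :
  ((\sum_i m i *: simple_root i) *m invmx (simple_mx n)) 0 j = m j.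
Proof.
have -> : \sum_i m i *: simple_root i = (\row_i m i) *m simple_mx n.
  by rewrite mulmx_sum_row; apply: eq_bigr => i _; rewrite rowK mxE.
by rewrite mulmxK ?simple_mx_unit // mxE.
Qed.

Lemma root_pairing a i : a \in positive_roots n ->
  pairing a (simple_root i) = (rootm a i)%:R *+ 2 - (nbrdeg i (rootm a))%:R.
Proof.
move=> ha; rewrite [in LHS](positive_rootE n_gt1 ha) pairing_suml.
set b := rootm a.
have -> : \sum_j pairing ((root_coef a j)%:R *: simple_root j) (simple_root i) =
  \sum_j (b j)%:R * (j == i)%:R *+ 2 - \sum_j (b j)%:R * (arrow j i)%:R - \sum_j (b j)%:R * (arrow i j)%:R.
  rewrite -!sumrB; apply: eq_bigr => j _; rewrite pairingZl pairing_simple // mnmE.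
  by rewrite !mulrBr [_ * (_ *+ 2)]mulrnAr.
have S (P : pred 'I_n) : \sum_j (b j)%:R * (P j)%:R = (\sum_(j | P j) b j)%N%:R :> rat.
  by rewrite natr_sum [RHS]big_mkcond; apply: eq_bigr => j _; case: (P j); rewrite ?mulr1 ?mulr0.
rewrite sumrMnl (S (fun j => j == i)) (S (fun j => arrow j i)) (S (arrow i)) big_pred1_eq.
by rewrite /nbrdeg natrD opprD addrA.
Qed.

(** The reflected root being positive, its coordinate at i is nonnegative; this is the cone
    condition. *)
Lemma rootm_refl a i : a \in positive_roots n -> refl i a \in positive_roots n ->
  in_cone i (rootm a) /\ rootm (refl i a) = reflm i (rootm a).
Proof.
move=> ha hr; set b := rootm a; set b' := rootm (refl i a).
have E j : (b' j)%:R = (b j)%:R - pairing a (simple_root i) * (j == i)%:R :> rat.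
  pose f (x : 'rV[rat]_n) l := (x *m invmx (simple_mx n)) 0 l.
  have fE x l : x \in positive_roots n -> f x l = (rootm x l)%:R.
    by move=> hx; rewrite /f {1}(positive_rootE n_gt1 hx) simple_coord mnmE.
  rewrite -(fE _ _ ha) -(fE _ _ hr) /f /refl mulmxBl -scalemxAl !mxE; congr (_ - _ * _).
  have -> : simple_root i = \sum_l (l == i)%:R *: simple_root l.
    by rewrite (bigD1 i) //= eqxx scale1r big1 ?addr0 // => l /negPf->; rewrite scale0r.
  have -> : \sum_j0 (\sum_l (l == i)%:R *: simple_root l) 0 j0 * invmx (simple_mx n) j0 j =
    ((\sum_l (l == i)%:R *: simple_root l) *m invmx (simple_mx n)) 0 j by rewrite mxE.
  by rewrite simple_coord.
have Ei : (b' i + b i)%N = nbrdeg i b.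
  apply/eqP; rewrite -(eqr_nat rat) natrD E eqxx mulr1 (root_pairing _ ha) -/b.
  by apply/eqP; rewrite mulr2n; ring.
split; first by rewrite /in_cone -Ei leq_addl.
apply/mnmP=> j; rewrite [RHS]mnmE; case: eqVneq => [->|ji]; first by rewrite -Ei addnK.
by apply/eqP; rewrite -(eqr_nat rat) E (negPf ji) mulr0 subr0.
Qed.

Lemma rootm_simple i : rootm (simple_root i) = U_(i)%MM.
Proof.
apply/mnmP=> j; rewrite mnmE mnm1E /root_coef.
have -> : simple_root i = \sum_l (l == i)%:R *: simple_root l.
  by rewrite (bigD1 i) //= eqxx scale1r big1 ?addr0 // => l /negPf->; rewrite scale0r.
by rewrite simple_coord natrK eq_sym.
Qed.

Lemma rootm_neq0 a : a \in positive_roots n -> a != 0 -> rootm a != 0%MM.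
Proof.
move=> ha; apply: contra => /eqP e; rewrite (positive_rootE n_gt1 ha) big1 // => j _.
have -> : root_coef a j = rootm a j by rewrite mnmE.
by rewrite e mnm0E scale0r.
Qed.

(** The identity that dictates the formula for [reflexp]: the rescaling must turn the factor of
    alpha for v into the factor of s_i alpha for v + delta_i. *)
Lemma kappa_reflm v i b : in_cone i b -> let v1 := upd v i (v i).+1 in
  kappa v1 (reflm i b) = kappa v b + reflexp v1 i b.
Proof.
move=> cb v1; rewrite /kappa.
have aE j : a_coef v1 j = a_coef v j + (j == i)%:Z - (arrow j i)%:Z.
  rewrite /a_coef {1}/v1 {1}/upd.
  have -> : \sum_(l | arrow j l) (v1 l)%:Z = \sum_(l | arrow j l) (v l)%:Z + (arrow j i)%:Z.
    have [ji|nji] := boolP (arrow j i).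
      rewrite (bigD1 i) //= [in RHS](bigD1 i) //= {1}/v1 /upd eqxx.
      rewrite (eq_bigr (fun l => (v l)%:Z)) => [|l /andP[_ /negPf li]]; first by rewrite -addn1 PoszD; ring.
      by rewrite /v1 /upd li.
    rewrite addr0; apply: eq_bigr => l jl; rewrite /v1 /upd; case: eqP => // e.
    by rewrite -e jl in nji.
  case: eqP => [->|_]; last by rewrite addr0 opprD addrA addrAC -addrA; ring.
  by rewrite -addn1 PoszD /=; ring.
rewrite (bigD1 i) //= reflm_i [in RHS](bigD1 i) //=.
have -> : \sum_(j | j != i) a_coef v1 j * (reflm i b j)%:Z =
  \sum_(j | j != i) a_coef v j * (b j)%:Z - (indeg i b)%:Z.
  rewrite /indeg (big_morph Posz PoszD (erefl _)).
  have -> : \sum_(j | arrow j i) (b j)%:Z = \sum_(j | j != i) (arrow j i)%:Z * (b j)%:Z.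
    rewrite big_mkcond [RHS]big_mkcond; apply: eq_bigr => j _.
    by case: eqVneq => [->|_]; rewrite ?arrow_irr //; case: arrow; rewrite ?mul1r ?mul0r.
  rewrite -sumrB; apply: eq_bigr => j ji; rewrite aE (negPf ji) mnmE (negPf ji) /=; ring.
rewrite -subzn // /reflexp !aE eqxx arrow_irr /=; ring.
Qed.

Definition weight_mu v : 'rV[rat]_n := fund_weight k - \sum_i (v i)%:R *: simple_root i.

Lemma weight_mu_pairing v i : pairing (weight_mu v) (simple_root i) =
  (i == k)%:R + (nbrdeg i v)%:R - (v i)%:R *+ 2.
Proof.
rewrite /weight_mu pairingBl pairing_fund_weight // pairing_suml.
have -> : \sum_j pairing ((v j)%:R *: simple_root j) (simple_root i) =
  \sum_j (v j)%:R * (j == i)%:R *+ 2 - \sum_j (v j)%:R * (arrow j i)%:R - \sum_j (v j)%:R * (arrow i j)%:R.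
  rewrite -!sumrB; apply: eq_bigr => j _; rewrite pairingZl pairing_simple //.
  by rewrite !mulrBr [_ * (_ *+ 2)]mulrnAr.
have S (P : pred 'I_n) : \sum_j (v j)%:R * (P j)%:R = (\sum_(j | P j) v j)%N%:R :> rat.
  by rewrite natr_sum [RHS]big_mkcond; apply: eq_bigr => j _; case: (P j); rewrite ?mulr1 ?mulr0.
rewrite sumrMnl (S (fun j => j == i)) (S (fun j => arrow j i)) (S (arrow i)) big_pred1_eq.
by rewrite /nbrdeg natrD eq_sym mulr2n; ring.
Qed.

Lemma weight_mu_upd v i : weight_mu (upd v i (v i).+1) = weight_mu v - simple_root i.
Proof.
rewrite /weight_mu -addrA -opprD; congr (_ - _).
rewrite (bigD1 i) //= [in RHS](bigD1 i) //= {1}/upd eqxx -[(v i).+1]addn1 natrD scalerDl scale1r.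
rewrite (eq_bigr (fun j => (v j)%:R *: simple_root j)) => [|j /negPf ji]; last by rewrite /upd ji.
by rewrite addrAC.
Qed.

Definition root_prod v : fps n Qqh :=
  \prod_(t | root_idx t && (pairing (weight_mu v) (root_of t) < 0)) root_series v (root_of t).

Lemma big_root_prod v :
  \prod_(a <- positive_roots n | pairing (weight_mu v) a < 0) fps_comp Fprod (exp_root v a) = root_prod v.
Proof. by rewrite big_positive_roots //; apply: eq_bigr => t _; rewrite fps_comp_root. Qed.

(** Since (s_i mu, alpha_i) = -1, the positive roots negative on s_i mu are alpha_i and the
    reflections of those negative on mu. The root alpha_i supplies the first factor. *)
Lemma root_prod_reflect v i : pairing (weight_mu v) (simple_root i) = 1 ->
  let v1 := upd v i (v i).+1 in
  root_prod v1 = mono_series U_(i)%MM (fun s => pochq qv hv 1 s * c ^ (a_coef v1 i * s%:Z))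
                 * reflect_series c v1 i (root_prod v).
Proof.
move=> mui v1; have [t0 [sg [t0i t0E sgP]]] := refl_index n_gt1 i.
have mu1 : weight_mu v1 = refl i (weight_mu v) by rewrite /refl mui scale1r weight_mu_upd.
have nz t : root_idx t && (pairing (weight_mu v) (root_of t) < 0) -> t != t0.
  case/andP=> _; apply: contraTneq => ->.
  by rewrite t0E mui ltr10.
have F t : root_idx t && (pairing (weight_mu v) (root_of t) < 0) ->
    rootm (root_of t) != 0%MM /\ in_cone i (rootm (root_of t)).
  move=> ht; have [i1 _ _ e] := sgP t (andP ht).1 (nz t ht); case/andP: ht => ti _.
  split; first exact: rootm_neq0 (root_of_pos ti) (root_of_neq0 ti).
  by apply: (rootm_refl (root_of_pos ti) _).1; rewrite -e; apply: root_of_pos.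
have [_ ->] := reflect_prod v1 c0 (fun t s => pochq qv hv 1 s * c ^ (kappa v (rootm (root_of t)) * s%:Z)) F.
rewrite /root_prod (bigD1 t0) /=; last first.
  rewrite t0i t0E mu1 /=.
  have e1 : simple_root i = - refl i (simple_root i).
    by rewrite /refl pairing_simple // eqxx arrow_irr !subr0 mulr2n scalerDl scale1r opprB addrK.
  by rewrite e1 pairingC pairingNl pairingC pairing_refl // mui ltrN10.
congr (_ * _).
  rewrite /root_series t0E rootm_simple; congr mono_series; apply/funext=> s.
  congr (_ * _ ^ (_ * _)); rewrite /kappa (bigD1 i) //= mnm1E eqxx mulr1 big1 ?addr0 // => j ji.
  by rewrite mnm1E eq_sym (negPf ji) mulr0.
rewrite (reindex_onto sg sg) /=; last first.
  by move=> t /andP[/andP[ti _] tt]; have [] := sgP t ti tt.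
have pr t : pairing (weight_mu v1) (refl i (root_of t)) = pairing (weight_mu v) (root_of t).
  by rewrite mu1 pairing_refl.
have sgK t : root_idx (sg t) -> sg t != t0 -> sg (sg t) = t ->
    [/\ root_idx t, t != t0 & root_of (sg t) = refl i (root_of t)].
  move=> ti tt sK; have [i1 n1 _ _] := sgP _ ti tt; rewrite sK in i1 n1.
  by have [_ _ _ e] := sgP t i1 n1.
apply: eq_big => [t|t /andP[/andP[/andP[ti lt] tt] /eqP sK]].
  apply/idP/idP.
    case/andP=> /andP[/andP[ti lt] tt] /eqP sK.
    by have [i1 _ e] := sgK t ti tt sK; rewrite i1 /= -pr -e.
  move=> ht; have [i1 n1 sK e] := sgP t (andP ht).1 (nz t ht).
  by rewrite i1 n1 e pr sK eqxx (andP ht).2.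
have [i1 _ e] := sgK t ti tt sK.
have rp : refl i (root_of t) \in positive_roots n by rewrite -e root_of_pos.
have [ct rE] := rootm_refl (root_of_pos i1) rp.
rewrite /root_series e rE; congr mono_series; apply/funext=> s.
by rewrite -mulrA -expfzDr // -mulrDl kappa_reflm.
Qed.

(** Shaped to agree term by term with [vertexN_rec]; j is the power of e^(alpha_i) taken from the
    factor of alpha_i. *)
Lemma root_prod_rec v i d : pairing (weight_mu v) (simple_root i) = 1 ->
  let v1 := upd v i (v i).+1 in
  root_prod v1 d = \sum_(j < (d i).+1 | (d i <= nbrdeg i d + j)%N)
     let d' := upd d i (nbrdeg i d + j - d i)%N in
     pochq qv hv 1 j * c ^ (a_coef v1 i * j%:Z + reflexp v1 i d') * root_prod v [multinom d' l | l < n].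
Proof.
move=> mui v1; rewrite (root_prod_reflect mui) -/v1.
have U0 : U_(i)%MM != 0%MM :> 'X_{1..n} by rewrite mnm1_eq0.
rewrite (mono_series_coefM _ _ U0 (ltnSn (mdeg d))).
have di : (d i <= mdeg d)%N by rewrite mdegE (bigD1 i) //= leq_addr.
have le s : (U_(i) *+ s <= d)%MM = (s <= d i)%N.
  apply/mnm_lepP/idP => [/(_ i)|sd j]; first by rewrite mulmnE mnm1E eqxx mul1n.
  by rewrite mulmnE mnm1E; case: eqP => [<-|_]; rewrite ?mul1n ?mul0n.
rewrite [RHS](big_ord_widen_cond _ (fun j : nat => (d i <= nbrdeg i d + j)%N) (fun j : nat => let d' := upd d i (nbrdeg i d + j - d i)%N in
     pochq qv hv 1 j * c ^ (a_coef v1 i * j%:Z + reflexp v1 i d') * root_prod v [multinom d' l | l < n]) (di : (d i < (mdeg d).+1)%N)).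
rewrite big_mkcond [RHS]big_mkcond /=; apply: eq_bigr => s _.
rewrite le ltnS; case: leqP => sd; last by rewrite andbF.
rewrite andbT /reflect_series.
have nE : nbrdeg i (d - U_(i) *+ s)%MM = nbrdeg i d.
  rewrite /nbrdeg; congr (_ + _)%N; apply: eq_bigr => j ij; rewrite mnmBE mulmnE mnm1E.
    by case: eqP ij => [->|_]; rewrite ?arrow_irr // mul0n subn0.
  by case: eqP ij => [->|_]; rewrite ?arrow_irr // mul0n subn0.
have iE : (d - U_(i) *+ s)%MM i = (d i - s)%N by rewrite mnmBE mulmnE mnm1E eqxx mul1n.
have rE : reflm i (d - U_(i) *+ s)%MM = [multinom upd d i (nbrdeg i d + s - d i)%N l | l < n].
  apply/mnmP=> j; rewrite mnmE /reflm mnmE nE iE /upd; have [_|ji] := eqVneq j i.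
    by rewrite subnBA.
  by rewrite mnmBE mulmnE mnm1E eq_sym (negPf ji) mul0n subn0.
rewrite /in_cone nE iE rE leq_subLR addnC; case: ifP => _; last by rewrite mulr0.
rewrite mulrA -[X in X * _ = _]mulrA -expfzDr //.
congr (_ * _ ^ (_ + reflexp _ _ _) * _).
by apply/funext=> l; rewrite mnmE.
Qed.

(** For v = 0 the weight is omega_k, which is dominant, so no positive root is negative on it. *)
Lemma root_prod0 : root_prod (fun=> 0%N) = 1.
Proof.
rewrite /root_prod big_pred0 // => t; apply/negbTE/negP => /andP[/root_of_pos ht].
rewrite [root_of t](positive_rootE n_gt1 ht) pairingC pairing_suml ltNge.
rewrite sumr_ge0 // => j _; rewrite pairingZl pairingC /weight_mu pairingBl pairing_fund_weight //.
rewrite pairing_suml big1 => [|l _]; last by rewrite scale0r /pairing big1 // => m _; rewrite mxE mul0r.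
by rewrite subr0 mulr_ge0 ?ler0n.
Qed.

End RootFactors.

(** * Dimension vectors of nonempty quiver varieties *)

Local Close Scope ring_scope.

(** Serves at the fork of the diagram, where cells alternate by parity. *)
Lemma perm_iota_parity (T : eqType) (f : nat -> T) M :
  perm_eq [seq f c | c <- iota 0 M]
    ([seq f (a.*2) | a <- iota 0 (uphalf M)] ++ [seq f (a.*2.+1) | a <- iota 0 M./2]).
Proof.
have uE m : iota 0 m.+1 = iota 0 m ++ [:: m] by rewrite -addn1 iotaD.
apply/seq.permP => P; elim: M => // M; rewrite count_cat => IHM.
rewrite uE map_cat !count_cat IHM.
have [Mo|Me] := boolP (odd M).
  have [-> -> eM] : [/\ uphalf M.+1 = uphalf M, M.+1./2 = M./2.+1 & M = M./2.*2.+1].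
    by have := odd_double_half M; have := uphalf_half M; have := uphalf_half M.+1; rewrite /= Mo; split; lia.
  by rewrite [in RHS]uE map_cat count_cat /= -eM; lia.
have [-> -> eM] : [/\ uphalf M.+1 = (uphalf M).+1, M.+1./2 = M./2 & M = (uphalf M).*2].
  by have := odd_double_half M; have := uphalf_half M; have := uphalf_half M.+1; rewrite /= (negPf Me); split; lia.
by rewrite [in RHS]uE map_cat count_cat /= -eM; lia.
Qed.

Lemma perm_filter_or (T : eqType) (P a b : pred T) s :
  (forall x, P x = a x || b x /\ ~~ (a x && b x)) ->
  perm_eq (filter P s) (filter a s ++ filter b s).
Proof.
move=> h; apply/seq.permP=> Q; rewrite count_cat !count_filter.
elim: s => //= x s ->; have [-> ] := h x; rewrite /predI /=.
by case: (a x); case: (b x) => //= _; case: (Q x); lia.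
Qed.

Section Labels.
Variables (n : nat).

(** Indexes by the labels 1..n with a default elsewhere; the value at 0 stands for the missing
    predecessor of the first vertex. *)
Definition lab (T : Type) (x0 : T) (F : 'I_n -> T) (l : nat) : T :=
  if l is l'.+1 then oapp F x0 (insub l') else x0.

Lemma labE T (x0 : T) F (i : 'I_n) : lab x0 F i.+1 = F i.
Proof. by rewrite /lab valK. Qed.

Lemma lab_out T (x0 : T) F l : (n < l)%N -> lab x0 F l = x0.
Proof. by case: l => //= l nl; rewrite insubF //; apply/negbTE; rewrite -leqNgt. Qed.

Lemma sum_lab (P : pred 'I_n) (v : 'I_n -> nat) L : (forall j, P j = (j.+1 == L)) ->
  (\sum_(j | P j) v j)%N = lab 0%N v L.
Proof.
case: L => [|L] PL; first by rewrite big_pred0 // => j; rewrite PL.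
have [Ln|nL] := ltnP L n.
  rewrite (big_pred1 (Ordinal Ln)) => [|j]; last by rewrite PL eqSS.
  by rewrite -[L.+1]/((Ordinal Ln).+1) labE.
by rewrite lab_out // big_pred0 // => j; rewrite PL eqSS; apply/negbTE; rewrite neq_ltn (leq_trans (ltn_ord j)).
Qed.

Lemma flatten_lab (T : Type) (P : pred 'I_n) (F : 'I_n -> seq T) L : (forall j, P j = (j.+1 == L)) ->
  flatten [seq F j | j <- enum 'I_n & P j] = lab [::] F L.
Proof.
have none : (forall j, P j = false) -> flatten [seq F j | j <- enum 'I_n & P j] = [::].
  by move=> h; rewrite (eq_filter h) filter_pred0.
case: L => [|L] PL; first by rewrite none // => j; rewrite PL.
have [Ln|nL] := ltnP L n.
  rewrite (@eq_filter _ _ (pred1 (Ordinal Ln))) => [|j]; last by rewrite PL eqSS.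
  by rewrite -[L.+1]/((Ordinal Ln).+1) labE filter_pred1_uniq ?enum_uniq ?mem_enum //= cats0.
by rewrite lab_out // none // => j; rewrite PL eqSS; apply/negbTE; rewrite neq_ltn (leq_trans (ltn_ord j)).
Qed.

Lemma flatten_lab2 (T : eqType) (P : pred 'I_n) (F : 'I_n -> seq T) L L' : L != L' ->
  (forall j, P j = (j.+1 == L) || (j.+1 == L')) ->
  perm_eq (flatten [seq F j | j <- enum 'I_n & P j]) (lab [::] F L ++ lab [::] F L').
Proof.
move=> LL PL; rewrite -(@flatten_lab _ (fun j => j.+1 == L)) // -(@flatten_lab _ (fun j => j.+1 == L')) //.
rewrite -flatten_cat -map_cat; apply/perm_flatten/perm_map.
by apply: perm_filter_or => j; rewrite PL; case: eqP => // ->; rewrite (negPf LL).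
Qed.

End Labels.

Arguments lab : simpl never.

Local Open Scope ring_scope.

Lemma sum_sq_telescope (V : nat -> int) m : V 0%N = 0 ->
  \sum_(l < m.+1) (V l.+1 - V l) ^+ 2 =
  (\sum_(l < m.+1) V l.+1 ^+ 2) *+ 2 - (\sum_(l < m) V l.+1 * V l.+2) *+ 2 - V m.+1 ^+ 2.
Proof.
move=> V0; elim: m => [|m IHm]; first by rewrite !big_ord1 big_ord0 V0 mulr2n; ring.
rewrite big_ord_recr /= {}IHm [in RHS]big_ord_recr /= [X in _ = _ - X *+ 2 - _]big_ord_recr /=.
by rewrite !mulr2n; ring.
Qed.

(** An odd sum rules out the zero vector, and a nonzero integral vector of square length at most 1
    is a signed unit vector. *)
Lemma sum_sq_le1 (z : nat -> int) N (t : int) : \sum_(l < N) z l ^+ 2 <= 1 ->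
  \sum_(l < N) z l = 1 - t *+ 2 ->
  exists j s, [/\ (j < N)%N, s = 1 \/ s = -1 & forall l, (l < N)%N -> z l = if l == j then s else 0].
Proof.
move=> sq odd.
have [j zj|all0] := pickP (fun j : 'I_N => z j != 0); last first.
  by move: odd; rewrite big1 => [|l _]; [lia | apply/eqP/negbNE; rewrite all0].
have sq1 : 1 <= z j ^+ 2 by move: zj; rewrite expr2; nia.
move: sq; rewrite (bigD1 j) //= => sq.
have pos : 0 <= \sum_(l < N | l != j) z l ^+ 2 by apply: sumr_ge0 => l _; rewrite sqr_ge0.
have s0 : \sum_(l < N | l != j) z l ^+ 2 == 0
  by rewrite eq_le pos andbT -(lerD2l (z j ^+ 2)) addr0 (le_trans sq).
exists (j : nat), (z j); split=> //.
  have : z j ^+ 2 <= 1 by apply: le_trans sq; rewrite lerDl.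
  rewrite expr2 => zz; have : -1 <= z j <= 1 by nia.
  by move: zj; lia.
move=> l lN; case: eqVneq => [->|lj] //.
move: s0; rewrite psumr_eq0 => [/allP/(_ (Ordinal lN))|q _]; last by rewrite sqr_ge0.
rewrite mem_index_enum -val_eqE /= lj /= => /(_ isT); by rewrite sqrf_eq0 => /eqP.
Qed.

(** * The shape of the admissible dimension vectors *)

Section Admissible.
Variables (n : nat) (k : 'I_n).
Hypothesis n4 : (4 <= n)%N.
Implicit Types (v : 'I_n -> nat) (i j : 'I_n).

Local Notation V v := (lab 0%N v).

(** The label of the only predecessor of i, and 0 for the first vertex. *)
Definition inlab i : nat := if i.+1 == n then (n - 2)%N else i.

Lemma arrow_inlab i j : arrow j i = (j.+1 == inlab i).
Proof. by rewrite /arrow /inlab; have := ltn_ord i; have := ltn_ord j; case: ifP; lia. Qed.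

Lemma arrow_outlab i j : arrow i j =
  if (i.+1 <= n - 3)%N then j.+1 == i.+2
  else if i.+1 == (n - 2)%N then (j.+1 == n.-1) || (j.+1 == n) else false.
Proof. by rewrite /arrow; have := ltn_ord i; have := ltn_ord j; case: ifP; [|case: ifP]; lia. Qed.

Lemma indeg_lab i v : indeg i v = V v (inlab i).
Proof. by apply: sum_lab => j; rewrite arrow_inlab. Qed.

Lemma outdeg_lab i v : outdeg i v =
  if (i.+1 <= n - 3)%N then V v i.+2
  else if i.+1 == (n - 2)%N then (V v n.-1 + V v n)%N else 0%N.
Proof.
have := arrow_outlab i; rewrite /outdeg; case: ifP => _ ai; first exact: (sum_lab _ ai).
case: eqP ai => _ ai; last by rewrite big_pred0.
rewrite (bigID (fun j : 'I_n => j.+1 == n)) /= addnC; congr (_ + _)%N; apply: sum_lab => j; rewrite ai;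
  have := ltn_ord j; lia.
Qed.

Definition admissible v : bool :=
  (\sum_i v i * v i <= \sum_(e : 'I_n * 'I_n | arrow e.1 e.2) v e.1 * v e.2 + v k)%N.

(** Twice this form is (mu_v, mu_v) - (omega_k, omega_k). *)
Definition qform v : int :=
  \sum_i (v i)%:Z ^+ 2 - \sum_i (v i)%:Z * (outdeg i v)%:Z - (v k)%:Z.

Lemma admissibleE v : admissible v = (qform v <= 0).
Proof.
rewrite /admissible /qform -lez_nat PoszD !(big_morph Posz PoszD (erefl _)).
have -> : \sum_(e : 'I_n * 'I_n | arrow e.1 e.2) (v e.1 * v e.2)%N%:Z = \sum_i (v i)%:Z * (outdeg i v)%:Z.
  rewrite -(pair_big_dep xpredT (fun i j => arrow i j) (fun i j => (v i * v j)%N%:Z)) /=.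
  apply: eq_bigr => i _; rewrite /outdeg (big_morph Posz PoszD (erefl _)) mulr_sumr.
  by apply: eq_bigr => j _; rewrite PoszM.
rewrite subr_le0 lerBlDl; congr (_ <= _); by apply: eq_bigr => i _; rewrite PoszM.
Qed.

(** The increment is 1 - (mu_v, alpha_i), hence 0 for the steps of the induction. *)
Lemma qform_upd v i : qform (upd v i (v i).+1) =
  qform v + (v i)%:Z *+ 2 + 1 - (nbrdeg i v)%:Z - (i == k)%:Z.
Proof.
set v1 := upd v i _.
have S (F : 'I_n -> int) : \sum_j (v1 j)%:Z * F j = \sum_j (v j)%:Z * F j + F i.
  rewrite (bigD1 i) //= [in RHS](bigD1 i) //= {1}/v1 /upd eqxx -addn1 PoszD.
  rewrite (eq_bigr (fun j => (v j)%:Z * F j)) => [|j /negPf ji]; first by ring.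
  by rewrite /v1 /upd ji.
have v1E j : (v1 j)%:Z = (v j)%:Z + (j == i)%:Z.
  by rewrite /v1 /upd; case: eqP => [->|_]; rewrite ?addr0 // -addn1 PoszD.
have oE j : (outdeg j v1)%:Z = (outdeg j v)%:Z + (arrow j i)%:Z.
  have sumb (P : pred 'I_n) : \sum_(l | P l) (l == i)%:Z = (P i)%:Z.
    case Pi: (P i); last by rewrite big1 // => l Pl; case: eqP => // e; rewrite -e Pl in Pi.
    by rewrite (bigD1 i) //= eqxx big1 ?addr0 // => l /andP[_ /negPf->].
  rewrite /outdeg !(big_morph Posz PoszD (erefl _)) -(sumb (arrow j)) -big_split /=.
  by apply: eq_bigr => l _; rewrite v1E.
rewrite /qform v1E [k == i]eq_sym.
have -> : \sum_j (v1 j)%:Z ^+ 2 = \sum_j (v j)%:Z ^+ 2 + (v i)%:Z *+ 2 + 1.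
  under eq_bigr => j _ do rewrite expr2; rewrite (S (fun j => (v1 j)%:Z)).
  under eq_bigr => j _ do rewrite mulrC; rewrite (S (fun j => (v j)%:Z)) v1E eqxx.
  by under [in RHS]eq_bigr => j _ do rewrite expr2; rewrite mulr2n /=; ring.
rewrite (S (fun j => (outdeg j v1)%:Z)) oE arrow_irr.
have -> : \sum_j (v j)%:Z * (outdeg j v1)%:Z = \sum_j (v j)%:Z * (outdeg j v)%:Z + (indeg i v)%:Z.
  rewrite /indeg (big_morph Posz PoszD (erefl _)) [X in _ + X]big_mkcond -big_split /=.
  by apply: eq_bigr => j _; rewrite oE mulrDr; case: (arrow j i); rewrite ?mulr1 ?mulr0.
by rewrite /nbrdeg PoszD /=; ring.
Qed.

Lemma sum_lab_ends (F : nat -> int) : \sum_(i < n) F i.+1 = \sum_(l < n - 2) F l.+1 + F n.-1 + F n.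
Proof.
rewrite -(big_mkord xpredT (fun l => F l.+1)).
have m1 : n = (n - 2).+2 by lia.
rewrite [X in \sum_(0 <= _ < X) _]m1 big_mkord !big_ord_recr /=.
by congr (_ + F _ + F _); lia.
Qed.

(** The squares are those of the coordinates of the sum of the v_i alpha_i in the orthonormal basis
    eps. *)
Lemma qform_lab v : let W l := (V v l)%:Z in qform v *+ 2 =
  \sum_(l < n - 2) (W l.+1 - W l) ^+ 2 + (W n.-1 + W n - W (n - 2)%N) ^+ 2
  + (W n.-1 - W n) ^+ 2 - (v k)%:Z *+ 2.
Proof.
move=> W; have vW i : (v i)%:Z = W i.+1 by rewrite /W labE.
pose O l : int := if (l <= n - 3)%N then W l.+1 else if l == (n - 2)%N then W n.-1 + W n else 0.
have oW i : (outdeg i v)%:Z = O i.+1.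
  by rewrite outdeg_lab /O; case: ifP => // _; case: ifP => // _; rewrite PoszD.
rewrite /qform; under eq_bigr => i _ do rewrite vW.
under [\sum_i (v i)%:Z * _]eq_bigr => i _ do rewrite vW oW.
rewrite (sum_lab_ends (fun l => W l ^+ 2)) (sum_lab_ends (fun l => W l * O l)).
have -> : O n.-1 = 0 by rewrite /O; case: ifP; [|case: ifP]; lia.
have -> : O n = 0 by rewrite /O; case: ifP; [|case: ifP]; lia.
have -> : (n - 2 = (n - 3).+1)%N by lia.
rewrite (sum_sq_telescope _ (erefl : W 0%N = 0)) [\sum_(l < (n - 3).+1) W l.+1 * O _]big_ord_recr /=.
have -> : O (n - 3).+1 = W n.-1 + W n by rewrite /O; case: ifP; [|case: ifP]; lia.
rewrite (eq_bigr (fun l : 'I_(n - 3) => W l.+1 * W l.+2)) => [|l _]; last by rewrite /O ltn_ord.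
by rewrite !mulr2n; ring.
Qed.

Definition other_lab : nat := if k.+1 == n then n.-1 else n.

(** The coordinates of the sum of the v_i alpha_i are 0 or 1, the last one up to sign if k is
    labelled n - 1. Thus all coordinates of mu_v are 1/2 or -1/2. *)
Definition spin_cond v : Prop :=
  [/\ forall l, (l < n - 2)%N -> (V v l <= V v l.+1 <= (V v l).+1)%N,
      (V v (n - 2) <= V v n.-1 + V v n <= (V v (n - 2)).+1)%N &
      (V v other_lab <= v k <= (V v other_lab).+1)%N ].

(** In other words mu_v is eps_(j+1) for t = 0 and -eps_(j+1) for t = 2. *)
Definition vect_cond v : Prop := exists j t : nat,
  [/\ (t = 0 \/ t = 2)%N, (j < n)%N,
      forall l, (0 < l <= n - 2)%N -> V v l = (if j < l then t else 1)%N,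
      V v n.-1 = (if j <= n - 2 then t./2 else t == 0)%N &
      V v n = (if j <= n - 2 then t./2 else t == 2)%N ].

(** The coordinates x add up to 2 v_k, with the last sign as in [spin_cond]. Twice the form is
    therefore the sum of the x^2 - x, which are nonnegative for integral x and 0 only for x = 0 or x
    = 1. *)
Lemma admissible_spin v : (k.+1 == n) || (k.+1 == n.-1) -> admissible v -> spin_cond v.
Proof.
move=> kn; rewrite admissibleE => q0; have := qform_lab v; set W := fun l => (V v l)%:Z => /= qE.
have vk : v k = V v k.+1 by rewrite labE.
pose s := W k.+1 - W other_lab.
have sE : (W n.-1 - W n) ^+ 2 = s ^+ 2.
  rewrite /s /other_lab; case: eqP kn => [-> _|_ /= /eqP ->]; ring.
have s2 : (v k)%:Z *+ 2 = W n.-1 + W n + s.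
  rewrite vk -/(W _) /s /other_lab mulr2n; case: eqP kn => [-> _|_ /= /eqP ->]; ring.
have tel : W (n - 2)%N = \sum_(l < n - 2) (W l.+1 - W l).
  by rewrite -(big_mkord xpredT (fun l => W l.+1 - W l)) telescope_sumr // subr0.
have pos (x : int) : 0 <= x ^+ 2 - x by rewrite expr2; nia.
have one (x : int) : x ^+ 2 - x <= 0 -> 0 <= x <= 1 by rewrite expr2; nia.
set u := W n.-1 + W n - W (n - 2)%N in qE.
have eq : qform v *+ 2 = \sum_(l < n - 2) ((W l.+1 - W l) ^+ 2 - (W l.+1 - W l)) + (u ^+ 2 - u) + (s ^+ 2 - s).
  by rewrite qE sE s2 sumrB -tel /u; ring.
have ps : 0 <= \sum_(l < n - 2) ((W l.+1 - W l) ^+ 2 - (W l.+1 - W l)) by apply: sumr_ge0.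
have [pu pS] := (pos u, pos s).
have q2 : qform v *+ 2 <= 0 by rewrite mulr2n; lia.
split.
- move=> l lm; have : (W l.+1 - W l) ^+ 2 - (W l.+1 - W l) <= 0.
    have : \sum_(l < n - 2) ((W l.+1 - W l) ^+ 2 - (W l.+1 - W l)) <= 0 by lia.
    rewrite (bigD1 (Ordinal lm)) //=; set r := \sum_(_ < _ | _) _.
    have : 0 <= r by apply: sumr_ge0.
    lia.
  by move/one; rewrite /W; lia.
- by have /one : u ^+ 2 - u <= 0 by [lia]; rewrite /u /W; lia.
- by have /one : s ^+ 2 - s <= 0 by [lia]; rewrite vk /s /W; lia.
Qed.

(** Here [z l] is the coordinate of mu_v along eps_(l+1). Admissibility bounds the sum of squares by
    1, and the sum of the coordinates is odd. *)
Lemma admissible_vect v : k.+1 = 1%N -> admissible v -> vect_cond v.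
Proof.
move=> k1; rewrite admissibleE => q0; have := qform_lab v; set W := fun l => (V v l)%:Z => /= qE.
have vk : (v k)%:Z = W 1%N by rewrite /W -k1 labE.
pose W' l := if l == 0%N then 1 else W l.
pose z l := if (l < n - 2)%N then W' l - W' l.+1 else if l == (n - 2)%N then W l - W n.-1 - W n else W n.-1 - W n.
have m1 : (n = (n - 2).+2)%N by lia.
have zl l : (l < n - 2)%N -> z l = W' l - W' l.+1 by rewrite /z => ->.
have zm : z (n - 2)%N = W (n - 2)%N - W n.-1 - W n by rewrite /z ltnn eqxx.
have zm' : z (n - 2).+1 = W n.-1 - W n.
  by rewrite /z ltnNge leqnSn /= (_ : (n - 2).+1 == (n - 2)%N = false) //; apply/eqP; lia.
have zS (F : int -> int) : \sum_(l < n) F (z l) = \sum_(l < n - 2) F (W' l - W' l.+1)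
    + F (W (n - 2)%N - W n.-1 - W n) + F (W n.-1 - W n).
  rewrite -(big_mkord xpredT (fun l => F (z l))) [X in \sum_(0 <= _ < X) _]m1 big_mkord !big_ord_recr /=.
  rewrite zm zm'.
  by congr (_ + _ + _); apply: eq_bigr => l _; rewrite zl.
have m2 : (n - 2 = (n - 3).+1)%N by lia.
have sq : \sum_(l < n) z l ^+ 2 <= 1.
  rewrite (zS (fun x => x ^+ 2)) /=.
  have -> : \sum_(l < n - 2) (W' l - W' l.+1) ^+ 2 = \sum_(l < n - 2) (W l.+1 - W l) ^+ 2 + 1 - W 1%N *+ 2.
    rewrite m2 !big_ord_recl /= (eq_bigr (fun l : 'I_(n - 3) => (W l.+2 - W l.+1) ^+ 2)) => [|l _].
      by rewrite /W' /= (_ : W 0%N = 0) // mulr2n; ring.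
    by rewrite /W' /bump /= -sqrrN opprB.
  have -> : (W (n - 2)%N - W n.-1 - W n) ^+ 2 = (W n.-1 + W n - W (n - 2)%N) ^+ 2 by ring.
  rewrite vk in qE.
  have q2 : qform v *+ 2 <= 0 by rewrite mulr2n; lia.
  by rewrite qE in q2; rewrite -subr_le0; apply: le_trans q2; rewrite le_eqVlt; apply/orP; left; apply/eqP; ring.
have sm : \sum_(l < n) z l = 1 - W n *+ 2.
  rewrite (zS id) /= -(big_mkord xpredT (fun l => W' l - W' l.+1)).
  rewrite (@telescope_sumr_eq _ _ _ (fun l => - W' l)) // => [|l _]; last by rewrite opprK addrC.
  by rewrite /W' m2 /= mulr2n; ring.
have [j [s [jn sE zE]]] := sum_sq_le1 sq sm.
have W'E l : (l <= n - 2)%N -> W' l = 1 - (if (j < l)%N then s else 0).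
  elim: l => [|l IHl] lm; first by rewrite subr0.
  have := zl l lm; rewrite zE; last by lia.
  rewrite IHl; last by lia.
  by do 3!case: ifP; lia.
have zn : z n.-1 = W n.-1 - W n by rewrite -zm'; congr z; lia.
have Wm : W (n - 2)%N = W' (n - 2)%N by rewrite /W' m2.
rewrite zE in zm; last by lia.
rewrite zE in zn; last by lia.
rewrite Wm W'E // in zm.
have {zE} V' l : (0 < l <= n - 2)%N -> (V v l)%:Z = 1 - (if (j < l)%N then s else 0).
  by move=> /andP[l0 lm]; rewrite -W'E // /W'; case: eqP => // e; rewrite e in l0.
rewrite /W in zm zn; exists j, (if s == 1 then 0 else 2)%N; case: sE => sE; subst s; split=> //=; try by [left|right].
all: try by move=> l /V'; case: ifP => _; lia.
all: by move: zm zn; do !case: ifP; lia.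
Qed.

End Admissible.

Local Close Scope ring_scope.

Lemma nbrs_perm e m A B : perm_eq (nbrs e m A B)
  ([seq (e c, A c) | c <- iota 0 m.+1] ++ [seq ((e b).+1, B b) | b <- iota 0 m]).
Proof.
apply/seq.permP=> P.
have cE s : count P s = (\sum_(y <- s) (if P y then 1 else 0))%N by rewrite -sum1_count big_mkcond.
rewrite cE big_nbrs count_cat !cE /=.
have E M (F : nat -> nat * nat) : (\sum_(j <- [seq F b | b <- iota 0 M]) (if P j then 1 else 0) = \sum_(b < M) (if P (F b) then 1 else 0))%N.
  by rewrite big_map -{1}[M]subn0 -/(index_iota 0 M) big_mkord.
by rewrite (E m.+1 (fun c => (e c, A c))) (E m (fun b => ((e b).+1, B b))).
Qed.

Section Descent.
Variables (n : nat) (k : 'I_n).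
Hypothesis n4 : (4 <= n)%N.
Implicit Types (v : 'I_n -> nat) (i : 'I_n).

Local Notation V v := (lab 0%N v).

(** The exponent of the a-th cell, counted from 0, of colour l. Beyond the actual cells the values
    only keep the sequence strictly increasing, as the duality requires; hence the [maxn 1]. *)
Definition exlab (l a : nat) : nat :=
  if k.+1 == 1%N then (a * maxn 1 (n - l - 1))%N
  else if (l <= n - 2)%N then (n - l + a - 1)%N
  else if l == k.+1 then a.*2 else a.*2.+1.

Definition wtexp i a := exlab i.+1 a.

Lemma wtexp_lt i a : (wtexp i a < wtexp i a.+1)%N.
Proof.
have := ltn_ord i; rewrite /wtexp /exlab; case: ifP => _; last by do !case: ifP; lia.
by rewrite mulSn; have := leq_maxl 1 (n - i.+1 - 1); lia.
Qed.

Lemma V0 v : V v 0 = 0%N. Proof. by []. Qed.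

Lemma nbrdeg_lab i v : nbrdeg i v = (V v (inlab i) +
  if (i.+1 <= n - 3)%N then V v i.+2
  else if i.+1 == (n - 2)%N then V v n.-1 + V v n else 0)%N.
Proof. by rewrite /nbrdeg indeg_lab // outdeg_lab. Qed.

Lemma nbrdeg_end i v : (n.-1 <= i.+1)%N -> nbrdeg i v = V v (n - 2).
Proof.
move=> ni; have nn := ltn_ord i; rewrite nbrdeg_lab.
have -> : inlab i = (n - 2)%N by rewrite /inlab; case: ifP; lia.
by do !case: ifP; lia.
Qed.

Hypothesis kmin : minuscule k.

Lemma minuscule_cases : [\/ k.+1 = 1%N, k.+1 = n | k.+1 = n.-1].
Proof.
by move: kmin; rewrite /minuscule !inE => /or3P[] /eqP e; [apply: Or31|apply: Or33|apply: Or32].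
Qed.

(** The equation means (mu_v, alpha_i) = -1, so i is the vertex to remove; it is read off from the
    coordinates of mu_v. *)
Lemma descent v : admissible k v -> (exists i, v i != 0%N) ->
  exists i, (((i == k) + nbrdeg i v).+1 = (v i).*2)%N.
Proof.
move=> av [i0 vi0]; have kn := ltn_ord k.
have n1 : (n.-1 < n)%N by lia.
have n2 : (n - 2 < n)%N by lia.
have spin : (k.+1 == n) || (k.+1 == n.-1) -> exists i, (((i == k) + nbrdeg i v).+1 = (v i).*2)%N.
  move=> kc; have [yl ym yn] := admissible_spin n4 kc av.
  have vk : v k = V v k.+1 by rewrite labE.
  have kk : (v k + V v (other_lab k) = V v n.-1 + V v n)%N.
    by rewrite vk /other_lab; case: eqP kc => [-> _|_ /= /eqP ->]; rewrite // addnC.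
  have [y1|y1] := eqVneq (V v n.-1 + V v n)%N (V v (n - 2)).+1.
    have [y2|y2] := eqVneq (v k) (V v (other_lab k)).+1.
      by exists k; rewrite eqxx nbrdeg_end; lia.
    have on : ((other_lab k).-1 < n)%N by rewrite /other_lab; case: ifP; lia.
    have oS : (other_lab k).-1.+1 = other_lab k by rewrite /other_lab; case: ifP; lia.
    exists (Ordinal on); rewrite nbrdeg_end -?(labE 0%N v (Ordinal on)) /= oS; last first.
      by rewrite /other_lab; case: ifP; lia.
    suff -> : (Ordinal on == k) = false by lia.
    by rewrite -val_eqE /=; apply/eqP; move: oS; rewrite /other_lab; case: ifP; lia.
  (* The coordinate n - 1 of the sum of the v_i alpha_i is now 0. The last 1 before it is followed
     by a 0, and the simple root joining the two places has pairing -1 with mu_v. *)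
  pose P l := (l < n - 2)%N && (V v l.+1 == (V v l).+1).
  have [exP|noP] := pselect (exists l, P l); last first.
    have z l : (l <= n - 2)%N -> V v l = 0%N.
      elim: l => // l IHl lm; have := IHl (ltnW lm); have := yl l lm; have : ~ P l by move=> h; apply: noP; exists l.
      by rewrite /P lm /=; lia.
    have zm := z (n - 2)%N (leqnn _).
    exfalso; move/eqP: vi0; apply; rewrite -(labE 0%N v i0).
    have [i2|i2] := leqP i0.+1 (n - 2); first exact: z.
    have [->|ne] := eqVneq i0.+1 n; first by lia.
    have -> : i0.+1 = n.-1 by have := ltn_ord i0; lia.
    lia.
  have ub l : P l -> (l <= n)%N by case/andP => ? _; lia.
  case: (ex_maxnP exP ub) => l /andP[lm /eqP yl1] mx.
  have ln : (l < n)%N by lia.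
  exists (Ordinal ln); rewrite nbrdeg_lab -(labE 0%N v (Ordinal ln)).
  have -> : (Ordinal ln == k) = false by rewrite -val_eqE /=; apply/eqP; move: kc; lia.
  have -> : inlab (Ordinal ln) = l by rewrite /inlab /=; case: eqP => //; lia.
  rewrite [nat_of_ord _]/=; case: ifP => l3.
    have l1m : (l.+1 < n - 2)%N by lia.
    have := yl l.+1 l1m; have := mx l.+1; rewrite /P l1m /=.
    by case: eqP => [_ /(_ isT)|]; lia.
  have l2 : l.+1 = (n - 2)%N by lia.
  by rewrite l2 eqxx; rewrite l2 in yl1; lia.
case: minuscule_cases => [k1|/eqP kc|/eqP kc]; [|by apply: spin; rewrite kc|by apply: spin; rewrite kc orbT].
have [j [t [tE jn hV hn1 hn]]] := admissible_vect n4 k1 av.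
have main L : (0 < L <= n)%N -> (forall i, i.+1 = L -> ((i == k) + nbrdeg i v).+1 = (v i).*2)%N ->
    exists i, (((i == k) + nbrdeg i v).+1 = (v i).*2)%N.
  case: L => // L Ln h; exists (Ordinal (Ln : (L < n)%N)); exact: h.
(* For mu_v = eps_(j+1) the vertex is labelled j, where j = 0 would mean v = 0; for mu_v =
   -eps_(j+1) it is labelled j + 1. *)
have [t0|t2] := eqVneq t 0%N.
  have j0 : (0 < j)%N.
    rewrite lt0n; apply: contra vi0 => /eqP j0; rewrite -(labE 0%N v i0).
    have [i2|i2] := leqP i0.+1 (n - 2); first by rewrite hV // j0 t0.
    have [e|ne] := eqVneq i0.+1 n; first by rewrite e hn j0 t0.
    have -> : i0.+1 = n.-1 by have := ltn_ord i0; lia.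
    by rewrite hn1 j0 t0.
  apply: (main j); first by lia.
  move=> i ij; rewrite nbrdeg_lab -(labE 0%N v i) /inlab -val_eqE /= !ij.
  have e0 : i = j.-1 :> nat by lia.
  have hj := hV j; have hj1 := hV j.-1; have hj2 := hV j.+1; have h2 := hV (n - 2)%N.
  move: hn hn1; rewrite e0.
  have [j1|j1] := eqVneq j 1%N.
    by move: hj hj2; rewrite j1 /= ?V0 t0; do !case: ifP => ?; rewrite ?V0; lia.
  move: hj hj1 hj2 h2; rewrite t0; have [e|ne] := eqVneq j n.-1; first by rewrite !e; do !case: ifP => ?; rewrite ?V0; lia.
  by do !case: ifP => ?; rewrite ?V0; lia.
have {}t2 : t = 2 by case: tE t2 => ->.
apply: (main j.+1); first by lia.
move=> i [ij]; rewrite nbrdeg_lab -(labE 0%N v i) /inlab -val_eqE /= !ij.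
rewrite t2 in hV hn hn1 => {main tE spin av i0 vi0 t2}.
have vj L : (0 < L <= j)%N -> (L <= n - 2)%N -> V v L = 1%N.
  by move=> Lj Lm; rewrite hV; [case: ltnP; lia | lia].
have vj' L : (j < L <= n - 2)%N -> V v L = 2.
  by move=> Lj; rewrite hV; [case: ltnP; lia | lia].
have [e|ne] := eqVneq j n.-1.
  have c1 : (n.-1 <= n - 2)%N = false by lia.
  have -> : (j.+1 == n) = true by lia.
  have -> : (j < n - 3)%N = false by lia.
  have -> : (j.+1 == n - 2)%N = false by lia.
  have -> : (j == k :> nat) = false by lia.
  have v2 := vj (n - 2)%N; move: hn; rewrite e c1 (_ : n.-1.+1 = n); last by lia.
  by move=> ->; rewrite v2; lia.
have jm : (j <= n - 2)%N by lia.
rewrite jm in hn hn1; have -> : (j.+1 == n) = false by lia.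
have j1 : ((j == k) + V v j = 1)%N.
  by case: (posnP j) => [->|jp]; [rewrite V0 | rewrite vj]; lia.
case: ltnP => j3; first by have := vj' j.+1; have := vj' j.+2; lia.
have [e|ne'] := eqVneq j.+1 (n - 2)%N; first by have := vj' j.+1; move: hn hn1 => /=; lia.
by rewrite (_ : j.+1 = n.-1); [move: hn hn1 => /= |]; lia.
Qed.

End Descent.

Lemma perm_eq_map (T T' : eqType) (f g : T -> T') s : f =1 g -> perm_eq (map f s) (map g s).
Proof. by move/eq_map->. Qed.

(** * The neighbours of a vertex interlace *)

Section LocalStructure.
Variables (n : nat) (k : 'I_n).
Hypothesis n4 : (4 <= n)%N.
Hypothesis kmin : minuscule k.
Variables (v : 'I_n -> nat) (i : 'I_n) (p : 'I_n -> nat -> nat).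

Local Notation V := (lab 0%N v).
Local Notation P := (lab (fun=> 0%N) p).
Local Notation ex := (wtexp k).
Local Notation m := (v i).

Let S (s L : nat) : seq (nat * nat) := [seq ((exlab k L b + s)%N, P L b) | b <- iota 0 (V L)].

Lemma lab_map s L : lab [::] (fun j => [seq ((ex j b + s)%N, p j b) | b <- iota 0 (v j)]) L = S s L.
Proof.
rewrite /S; case: L => [|L] //; have [Ln|nL] := ltnP L n; last by rewrite !lab_out.
by rewrite -[L.+1]/((Ordinal Ln).+1) !labE.
Qed.

Lemma ylist_perm : perm_eq (ylist k ex v i p)
  ((if i == k then [:: (0, 0)] else [::])%N ++ S 0 (inlab i) ++
   if (i.+1 <= n - 3)%N then S 1 i.+2
   else if i.+1 == (n - 2)%N then S 1 n.-1 ++ S 1 n else [::]).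
Proof.
rewrite /ylist perm_cat2l; apply: perm_cat.
  rewrite (@flatten_lab _ _ (fun j => arrow j i) _ (inlab i)) => [|j]; last by rewrite arrow_inlab.
  have -> : (fun j => [seq (ex j b, p j b) | b <- iota 0 (v j)]) =
            (fun j => [seq ((ex j b + 0)%N, p j b) | b <- iota 0 (v j)]).
    by apply/funext=> j; apply: eq_map => b; rewrite addn0.
  by rewrite lab_map.
have -> : (fun j => [seq ((ex j b).+1, p j b) | b <- iota 0 (v j)]) =
          (fun j => [seq ((ex j b + 1)%N, p j b) | b <- iota 0 (v j)]).
  by apply/funext=> j; apply: eq_map => b; rewrite addn1.
have := arrow_outlab n4 i; case: ifP => _ a.
  by rewrite (flatten_lab _ a) lab_map.
move: a; case: eqP => _ a.
  by rewrite (perm_trans (flatten_lab2 _ _ a)) ?lab_map //; lia.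
by rewrite (eq_filter a) filter_pred0.
Qed.

Hypothesis av : admissible k v.
Hypothesis pair1 : ((i == k) + nbrdeg i v = m.*2.+1)%N.

Let goalE A B :
  perm_eq ((if i == k then [:: (0, 0)] else [::])%N ++ S 0 (inlab i) ++
   if (i.+1 <= n - 3)%N then S 1 i.+2
   else if i.+1 == (n - 2)%N then S 1 n.-1 ++ S 1 n else [::])
   ([seq (ex i c, A c) | c <- iota 0 m.+1] ++ [seq ((ex i b).+1, B b) | b <- iota 0 m]) ->
  exists A B, perm_eq (ylist k ex v i p) (nbrs (ex i) m A B).
Proof.
move=> h; exists A, B; apply: (perm_trans ylist_perm); apply: (perm_trans h).
by rewrite perm_sym; apply: nbrs_perm.
Qed.

Let SE s L M (f : nat -> nat * nat) : V L = M ->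
  (forall b, (b < M)%N -> ((exlab k L b + s)%N, P L b) = f b) -> S s L = [seq f b | b <- iota 0 M].
Proof.
move=> <- h; apply/eq_in_map => b; rewrite mem_iota => /andP[_ bM]; exact: h.
Qed.

(** Before the fork, the v_i cells preceding i give the upper bounds and the v_i + 1 cells following
    it give the lower bounds, with exponents matching by the shape of the weights. *)
Lemma local_spin : (k.+1 == n) || (k.+1 == n.-1) ->
  exists A B, perm_eq (ylist k ex v i p) (nbrs (ex i) m A B).
Proof.
move=> kc; have [yl ym yn] := admissible_spin n4 kc av.
have ni := ltn_ord i; have k1 : (k.+1 == 1%N) = false by lia.
have mV : m = V i.+1 by rewrite labE.
have exl l a : (l <= n - 2)%N -> exlab k l a = (n - l + a - 1)%N by rewrite /exlab k1 => ->.
have exk a : exlab k k.+1 a = a.*2 by rewrite /exlab k1 eqxx; case: ifP; lia.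
have exo L a : (n.-1 <= L)%N -> L != k.+1 -> exlab k L a = a.*2.+1.
  by rewrite /exlab k1 => h /negPf ->; case: ifP; lia.
have [i3|i3] := leqP i.+1 (n - 3).
  have ik : (i == k) = false by rewrite -val_eqE /=; lia.
  have il : inlab i = i by rewrite /inlab; case: ifP; lia.
  move: pair1; rewrite ik nbrdeg_lab // il i3 => p1.
  have y1 := yl i; have y2 := yl i.+1.
  have [Vi Vi2] : V i = m /\ V i.+2 = m.+1 by lia.
  apply: (@goalE (P i.+2) (P i)); rewrite ik il i3 /= perm_catC.
  rewrite (SE (f := fun b => ((ex i b).+1, P i b)) Vi) => [|b _]; last first.
    by rewrite /wtexp !exl; [congr pair; lia|lia..].
  rewrite (SE (f := fun b => (ex i b, P i.+2 b)) Vi2) // => b _.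
  by rewrite /wtexp !exl; [congr pair; lia|lia..].
have [i2|i2] := eqVneq i.+1 (n - 2)%N.
  have ik : (i == k) = false by rewrite -val_eqE /=; lia.
  have il : inlab i = i by rewrite /inlab; case: ifP; lia.
  have i3' : (i < n - 3)%N = false by lia.
  move: pair1; rewrite ik nbrdeg_lab // il i3' i2 eqxx => p1.
  have y1 := yl i; rewrite -i2 in ym.
  have [Vi Vs] : V i = m /\ (V n.-1 + V n = m.+1)%N by lia.
  have vk : v k = V k.+1 by rewrite labE.
  have ko : (other_lab k != k.+1) && (n.-1 <= other_lab k)%N.
    by rewrite /other_lab; case: ifP kc; lia.
  have kk : (V k.+1 + V (other_lab k) = m.+1)%N.
    by rewrite -Vs /other_lab; case: eqP kc => [-> _|_ /= /eqP ->]; rewrite // addnC.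
  have [Vk Vo] : V k.+1 = uphalf m.+1 /\ V (other_lab k) = m.+1./2 by lia.
  (* At the vertex n - 2 the lower bounds come alternately from the two end vertices, beginning with
     k. *)
  pose A c := if odd c then P (other_lab k) c./2 else P k.+1 c./2.
  apply: (@goalE A (P i)); rewrite ik il i3' i2 eqxx [[::] ++ _]/= perm_catC.
  rewrite (SE (f := fun b => ((ex i b).+1, P i b)) Vi) => [|b _]; last first.
    by rewrite /wtexp !exl; [congr pair; lia|lia..].
  rewrite perm_cat2r.
  have -> : perm_eq (S 1 n.-1 ++ S 1 n) =1 perm_eq (S 1 k.+1 ++ S 1 (other_lab k)).
    apply/permPl; rewrite /other_lab; case: eqP kc => [-> _|_ /= /eqP ->] //.
    by rewrite perm_catC.
  rewrite perm_sym; apply: (perm_trans (perm_iota_parity (fun c => (ex i c, A c)) m.+1)).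
  rewrite (SE (f := fun b => (ex i b.*2, A b.*2)) Vk) => [|b _]; last first.
    by rewrite exk /wtexp exl; [rewrite /A odd_double doubleK; congr pair; lia|lia].
  rewrite (SE (f := fun b => (ex i b.*2.+1, A b.*2.+1)) Vo) // => b _.
  case/andP: ko => ko1 ko2; rewrite exo // /wtexp exl; last by lia.
  by rewrite /A oddS odd_double /= uphalf_double; congr pair; lia.
have i1 : (n.-1 <= i.+1)%N by lia.
have il : inlab i = (n - 2)%N by rewrite /inlab; case: ifP; lia.
have i3' : (i < n - 3)%N = false by lia.
have i2' : (i.+1 == n - 2)%N = false by lia.
move: pair1; rewrite nbrdeg_end //.
(* An end vertex sees the cells at n - 2 alternately as lower and upper bounds. For i = k the
   framing supplies the first lower bound, 0. *)
have [ik|ik] := eqVneq i k => p1.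
  have ikT : (i == k) = true by rewrite ik eqxx.
  have Vm : V (n - 2) = m.*2 by lia.
  pose f b := (exlab k (n - 2) b, P (n - 2) b).
  pose A c := if c is c'.+1 then P (n - 2) c'.*2.+1 else 0%N.
  apply: (@goalE A (fun b => P (n - 2) b.*2)); rewrite ikT il i3' i2' cats0.
  rewrite (SE (f := f) Vm) => [|b _]; last by rewrite addn0.
  have e0 : ex i 0 = 0%N by rewrite /wtexp ik exk.
  rewrite -[iota 0 m.+1]/(0%N :: iota 1 m) map_cons /= e0 perm_cons; apply: (perm_trans (perm_iota_parity _ _)).
  rewrite uphalf_double doubleK perm_catC -[iota 1 m]/(iota (1 + 0) m) iotaDl -map_comp; apply: perm_cat.
    apply: perm_eq_map => b /=.
    by rewrite /wtexp ik exk /f exl // add1n; congr pair; lia.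
  apply: perm_eq_map => b /=.
  by rewrite /wtexp ik exk /f exl //; congr pair; lia.
have Vm : V (n - 2) = m.*2.+1 by lia.
pose f b := (exlab k (n - 2) b, P (n - 2) b).
apply: (@goalE (fun b => P (n - 2) b.*2) (fun b => P (n - 2) b.*2.+1)); rewrite (negPf ik) il i3' i2' cats0 cat0s.
have ik' : i.+1 != k.+1 by rewrite eqSS.
rewrite (SE (f := f) Vm) => [|b _]; last by rewrite addn0.
apply: (perm_trans (perm_iota_parity _ _)).
rewrite (_ : uphalf m.*2.+1 = m.+1); last by lia.
rewrite (_ : m.*2.+1./2 = m); last by lia.
apply: perm_cat.
  apply: perm_eq_map => b /=.
  by rewrite /wtexp exo // /f exl //; congr pair; lia.
apply: perm_eq_map => b /=.
by rewrite /wtexp exo // /f exl //; congr pair; lia.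
Qed.

(** Here v_i is 0 or 1. For v_i = 1 the two cells following i supply the upper bound and the second
    lower bound; at the fork both have exponent 1 and are interchangeable. *)
Lemma local_vect : k.+1 = 1%N ->
  exists A B, perm_eq (ylist k ex v i p) (nbrs (ex i) m A B).
Proof.
move=> k1; have [j [t [tE jn hV hn1 hn]]] := admissible_vect n4 k1 av.
have ni := ltn_ord i.
have mV : m = V i.+1 by rewrite labE.
have exE l a : exlab k l a = (a * maxn 1 (n - l - 1))%N by rewrite /exlab k1.
have S1 s L : V L = 1%N -> S s L = [:: (s, P L 0)] by rewrite /S => -> /=; rewrite exE.
have S0 s L : V L = 0%N -> S s L = [::] by rewrite /S => ->.
(* the pair contributed either by the framing or by the preceding vertex *)
pose a0 := if i == k then 0%N else P (inlab i) 0.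
have key : (V (inlab i) + (i == k) = 1)%N /\
    (m = 0 /\ (if (i.+1 <= n - 3) then V i.+2 else if i.+1 == n - 2 then V n.-1 + V n else 0) = 0 \/
     m = 1 /\ (if (i.+1 <= n - 3) then V i.+2 = 2 else i.+1 = n - 2 /\ V n.-1 = 1 /\ V n = 1))%N.
  move: pair1; rewrite nbrdeg_lab // mV -val_eqE /=.
  have [ij|ij] := leqP i.+1 (n - 2); last first.
    have -> : inlab i = (n - 2)%N by rewrite /inlab; case: ifP; lia.
    have -> : (i < n - 3)%N = false by lia.
    have -> : (i.+1 == n - 2)%N = false by lia.
    have := hV (n - 2)%N; have -> : V i.+1 = (if j <= n - 2 then t./2 else if i.+1 == n then t == 2 else t == 0)%N.
      by have [->|ne] := eqVneq i.+1 n; [rewrite hn | rewrite (_ : i.+1 = n.-1) ?hn1; [|lia]].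
    by case: tE => ->; do !case: ifP; lia.
  have -> : inlab i = i by rewrite /inlab; case: ifP; lia.
  have h1 := hV i.+1; have h2 := hV i.+2.
  have h0 : (V i + (i == k :> nat) = if (0 < i)%N then (if j < i then t else 1) else 1)%N.
    by case: posnP => [->|ip]; [rewrite V0 | rewrite hV]; lia.
  move: h0; rewrite h1; last by lia.
  have [i3|i3] := leqP i.+1 (n - 3).
    rewrite h2; last by lia.
    by case: tE => ->; do !case: ifP; lia.
  have i2 : i.+1 = (n - 2)%N by lia.
  rewrite i2 eqxx hn hn1; case: tE => ->; do !case: ifP; lia.
have [Vin out] := key.
have frameE : (if i == k then [:: (0, 0)] else [::])%N ++ S 0 (inlab i) = [:: (0%N, a0)].
  by rewrite /a0; case: eqP Vin => _ Vin; [rewrite S0 | rewrite S1] => //; lia.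
case: out => [[m0 out0]|[m1 out1]].
  apply: (@goalE (fun=> a0) (fun=> a0)); rewrite catA frameE m0 /= /wtexp exE mul0n.
  have -> : (if (i < n - 3)%N then S 1 i.+2 else if i.+1 == (n - 2)%N then S 1 n.-1 ++ S 1 n else [::]) = [::].
    by move: out0; case: ifP => _; [move=> /S0->|case: ifP => // _; move=> h; rewrite !S0 //; lia].
  by [].
have [i3|i3] := leqP i.+1 (n - 3).
  rewrite i3 in out1.
  apply: (@goalE (fun c => if c is 0 then a0 else P i.+2 1)%N (fun=> P i.+2 0)).
  rewrite catA frameE m1 i3 /S out1 /= /wtexp !exE !mul0n !mul1n.
  rewrite (_ : (maxn 1 (n - i.+2 - 1) + 1 = maxn 1 (n - i.+1 - 1))%N); last by lia.
  rewrite perm_cons; exact: (permEl (perm_catC [:: _] [:: _])).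
have i3' : (i < n - 3)%N = false by lia.
rewrite i3' in out1; case: out1 => i2 [vn1 vn].
apply: (@goalE (fun c => if c is 0 then a0 else P n 0)%N (fun=> P n.-1 0)).
rewrite catA frameE m1 i3' i2 eqxx !S1 //= /wtexp !exE !mul0n !mul1n i2.
rewrite (_ : maxn 1 (n - (n - 2) - 1) = 1)%N; last by lia.
rewrite perm_cons; exact: (permEl (perm_catC [:: _] [:: _])).
Qed.

Lemma local_structure : exists A B, perm_eq (ylist k ex v i p) (nbrs (ex i) m A B).
Proof.
case: (minuscule_cases kmin) => [|/eqP kc|/eqP kc]; [exact: local_vect|..].
- by apply: local_spin; rewrite kc.
- by apply: local_spin; rewrite kc orbT.
Qed.

End LocalStructure.

(** * From reverse plane partitions to sums over the vertices *)

Local Open Scope ring_scope.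

(** The cells of one colour form a row that is a chain, numbered from 1, so a down-set meets it in
    an initial segment. The index [row] of the row differs from the colour when n - 1 and n are
    exchanged. *)
Record compatible (n : nat) (k : 'I_n) (D : cwposet n) (row : 'I_n -> nat) (v : 'I_n -> nat) : Prop := {
  colorE : forall x (i : 'I_n), x \in elems D -> (color D x == i.+1) = (x.1 == row i :> nat);
  color_ex : forall x, x \in elems D -> exists i : 'I_n, color D x = i.+1;
  elem_gt0 : forall x, x \in elems D -> (0 < x.2)%N;
  cell_elem : forall i a, (a < v i)%N ->
    exists x, [/\ x \in elems D, x.1 = row i :> nat, x.2 = a.+1 :> nat & wexp D x = wtexp k i a];
  gens_closed : forall x y (i j : 'I_n), x \in elems D -> y \in elems D -> gens D x y ->
    color D x = i.+1 -> color D y = j.+1 -> (y.2 <= v j)%N -> (x.2 <= v i)%N;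
  gens_wexp : forall x y (i j : 'I_n), x \in elems D -> y \in elems D -> gens D x y ->
    color D x = i.+1 -> color D y = j.+1 ->
    arrow i j /\ wexp D x = wexp D y \/ arrow j i /\ wexp D y = (wexp D x).+1;
  row_chain : forall x, x \in elems D -> (1 < x.2)%N ->
    exists y, [/\ y \in elems D, y.1 = x.1, x.2 = y.2.+1 :> nat & poset_le D y x] }.

Section Ideal.
Variables (n : nat) (k : 'I_n) (D : cwposet n) (row : 'I_n -> nat) (v : 'I_n -> nat).
Hypothesis H : compatible k D row v.

Definition rcell (i : 'I_n) (a : nat) : cell n := (inord (row i), inord a.+1).

Lemma rcellP i a : (a < v i)%N -> [/\ rcell i a \in elems D, (rcell i a).1 = row i :> nat,
  (rcell i a).2 = a.+1 :> nat, wexp D (rcell i a) = wtexp k i a & color D (rcell i a) = i.+1].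
Proof.
move=> av; have [x [xD x1 x2 xw]] := cell_elem H av.
have xE : rcell i a = x.
  by rewrite /rcell -x1 -x2 !inord_val; case: x {xD x1 x2 xw}.
by rewrite xE; split=> //; apply/eqP; rewrite (colorE H) // x1.
Qed.

Lemma rcellE x (i : 'I_n) : x \in elems D -> color D x = i.+1 -> x = rcell i (x.2).-1.
Proof.
move=> xD /eqP; rewrite (colorE H) // => /eqP x1.
rewrite /rcell prednK ?(elem_gt0 H) // -x1 !inord_val; by case: x {xD x1}.
Qed.

Definition rideal : {set cell n} :=
  [set x in elems D | [forall i : 'I_n, (color D x == i.+1) ==> (x.2 <= v i)%N]].

Lemma in_rideal x (i : 'I_n) : x \in elems D -> color D x = i.+1 -> (x \in rideal) = (x.2 <= v i)%N.
Proof.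
move=> xD xi; rewrite inE xD; apply/forallP/idP => [/(_ i)|xv j]; first by rewrite xi eqxx.
by rewrite xi eqSS; apply/implyP => /eqP/val_inj <-.
Qed.

Lemma rcell_in i a : (a < v i)%N -> rcell i a \in rideal.
Proof. by move=> av; have [xD _ x2 _ xc] := rcellP av; rewrite (in_rideal xD xc) x2. Qed.

Lemma connect_ideal (Q : {set cell n}) x y :
  (forall x y, x \in elems D -> y \in elems D -> gens D x y -> y \in Q -> x \in Q) ->
  poset_le D x y -> y \in Q -> x \in Q.
Proof.
move=> cl /connectP[s + ->]; elim: s x => //= z s IHs x /andP[/and3P[xD zD xz] zs] lQ.
by apply: cl xz _ => //; apply: IHs.
Qed.

Lemma rideal_order : order_ideal D rideal.
Proof.
apply/andP; split; first by apply/subsetP => x; rewrite inE => /andP[].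
apply/forallP=> x; apply/forallP=> y; apply/implyP=> /andP[yP xy].
apply: connect_ideal xy yP => {}x {}y xD yD xy.
have [i xi] := color_ex H xD; have [j yj] := color_ex H yD.
rewrite (in_rideal xD xi) (in_rideal yD yj); exact: (gens_closed H xD yD xy xi yj).
Qed.

Lemma rideal_color (i : 'I_n) :
  [set x in rideal | color D x == i.+1] = [set rcell i a | a : 'I_(v i)].
Proof.
apply/setP=> x; rewrite inE; apply/andP/imsetP => [[xP /eqP xi]|[a _ ->]].
  have xD : x \in elems D by move: xP; rewrite inE => /andP[].
  have x0 := elem_gt0 H xD; rewrite (in_rideal xD xi) in xP.
  have lt : (x.2.-1 < v i)%N by rewrite prednK.
  by exists (Ordinal lt) => //; apply: rcellE.
by have [_ _ _ _ ->] := rcellP (ltn_ord a); rewrite rcell_in.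
Qed.

Lemma rcell_inj (i : 'I_n) : injective (fun a : 'I_(v i) => rcell i a).
Proof.
move=> a b e; apply/val_inj; have [_ _ ea _ _] := rcellP (ltn_ord a).
by have [_ _ eb _ _] := rcellP (ltn_ord b); move: ea; rewrite e eb => -[].
Qed.

Lemma rideal_dim : has_dim D v rideal.
Proof.
apply/forallP=> i; rewrite rideal_color card_imset; last exact: rcell_inj.
by rewrite card_ord.
Qed.

(** Rows being chains, a cell of a down-set at position x.2 brings x.2 cells of its colour with it;
    so x.2 is at most v i, and equality of the cardinalities concludes. *)
Lemma ideal_unique (Q : {set cell n}) : order_ideal D Q -> has_dim D v Q -> Q = rideal.
Proof.
move=> /andP[/subsetP QD oQ] /forallP hQ.
have down x y : poset_le D x y -> y \in Q -> x \in Q.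
  by move=> xy yQ; move/forallP: oQ => /(_ x) /forallP /(_ y); rewrite yQ xy.
have sub : {subset Q <= rideal}.
  move=> x xQ; have xD := QD _ xQ; have [i xi] := color_ex H xD.
  rewrite (in_rideal xD xi) -(eqP (hQ i)).
  have low b : (b < x.2)%N -> exists y, [/\ y \in Q, y.1 = x.1 & (y.2 + b = x.2)%N].
    elim: b => [|b IHb] bx; first by exists x; rewrite addn0.
    have [y [yQ y1 y2]] := IHb (ltnW bx).
    have [|z [zD z1 z2 zy]] := row_chain H (QD _ yQ); first by lia.
    by exists z; rewrite (down _ _ zy yQ) z1 y1; split=> //; lia.
  pose A := [set a : 'I_n.+1 | (0 < a <= x.2)%N].
  have cA : #|A| = x.2.
    have lt (a : 'I_(x.2)) : (a.+1 < n.+1)%N by rewrite ltnS (leq_trans (ltn_ord a)) // -ltnS.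
    rewrite -[RHS]card_ord -cardsT -(card_imset setT (f := fun a : 'I_(x.2) => Ordinal (lt a))); last first.
      by move=> a b [] /val_inj.
    congr #|pred_of_set _|; apply/setP=> a; rewrite inE; apply/idP/imsetP => [/andP[a0 av]|[b _ ->]] /=.
      have av' : (a.-1 < x.2)%N by rewrite prednK.
      by exists (Ordinal av') => //; apply/val_inj; rewrite /= prednK.
    by rewrite ltn_ord.
  rewrite -cA; apply: leq_trans (leq_imset_card (fun y : cell n => y.2) _); apply/subset_leq_card/subsetP=> a.
  rewrite inE => /andP[a0 ax]; have [|y [yQ y1 y2]] := low (x.2 - a)%N; first by lia.
  have ya : (y.2 : nat) = a by move: y2 ax; move: (y.2 : nat) (x.2 : nat) (a : nat) => *; lia.
  apply/imsetP; exists y; last exact/val_inj/esym.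
  by rewrite inE yQ (colorE H) ?QD // y1 -(colorE H) // xi eqxx.
apply/eqP; rewrite eqEsubset; apply/andP; split; apply/subsetP => // x xP.
have xD : x \in elems D by move: xP; rewrite inE => /andP[].
have [i xi] := color_ex H xD.
have /eqP e : [set x in Q | color D x == i.+1] == [set x in rideal | color D x == i.+1].
  rewrite eqEcard (eqP (hQ i)) (eqP (forallP rideal_dim i)) leqnn andbT.
  by apply/subsetP=> z; rewrite !inE => /andP[/sub]; rewrite inE => -> ->.
have : x \in [set x in rideal | color D x == i.+1] by rewrite inE xP xi eqxx.
by rewrite -e inE => /andP[].
Qed.

End Ideal.

Section Bridge.
Variables (n : nat) (k : 'I_n) (row : 'I_n -> nat) (v : 'I_n -> nat).
Local Notation D := (minuscule_poset k).
Hypothesis H : compatible k D row v.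

Lemma ideal_ofE : ideal_of k v = rideal D v.
Proof.
rewrite /ideal_of; case: pickP => [Q /andP[oQ dQ]|/(_ (rideal D v))] /=; first exact: (ideal_unique H).
by rewrite (rideal_order H) (rideal_dim H).
Qed.

Local Notation P := (ideal_of k v).
Local Notation elt := {x : cell n | x \in P}.
Local Notation rc := (rcell row).

Definition onc (T : Type) (t : T) (pi : elt -> T) (x : cell n) : T := oapp pi t (insub x).

Lemma oncE (T : Type) (t : T) (pi : elt -> T) (x : elt) : onc t pi (val x) = pi x.
Proof. by rewrite /onc valK. Qed.

Lemma big_elt (R : Type) (idx : R) (op : Monoid.com_law idx) (F : cell n -> R) (i : 'I_n) :
  \big[op/idx]_(x : elt | color D (val x) == i.+1) F (val x) = \big[op/idx]_(a < v i) F (rc i a).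
Proof.
rewrite -(big_sub_cond (mem P) (fun x => color D x == i.+1) F) /=.
rewrite (eq_bigl (fun x => x \in [set rc i a | a : 'I_(v i)])) => [|x]; last first.
  by rewrite -(rideal_color H) -ideal_ofE inE.
by rewrite big_imset //= => a b _ _; apply: (rcell_inj H).
Qed.

Local Notation c := (qv / hv).
Local Notation U := (zpochq qv hv).
Local Notation pc pi := (onc 0%N (fun x => nat_of_ord (pi x))).

Lemma prod_elt2 (i j : 'I_n) (W : elt -> elt -> Qqh) (G : cell n -> cell n -> Qqh) :
  (forall x y, W x y = G (val x) (val y)) ->
  \prod_(x : elt | color D (val x) == i.+1) \prod_(y : elt | color D (val y) == j.+1) W x y =
  \prod_(a < v i) \prod_(b < v j) G (rc i a) (rc j b).
Proof.
move=> WG; rewrite -(big_elt _ (fun x => \prod_(b < v j) G x (rc j b))); apply: eq_bigr => x _.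
by rewrite -(big_elt _ (G (val x))); apply: eq_bigr => y _; apply: WG.
Qed.

Let mul4E (R : comNzRingType) (a a' b b' x x' y y' : R) :
  a = a' -> b = b' -> x = x' -> y = y' -> a * b * x * y = a' * (b' * x' * y').
Proof. by move=> -> -> -> ->; rewrite !mulrA. Qed.

Lemma rpp_weightE (pi : elt -> nat) p : (forall i a, (a < v i)%N -> p i a = onc 0%N pi (rc i a)) ->
  rpp_weight pi = c ^ rpp_N pi * node_wt qv hv k (wtexp k) v p.
Proof.
move=> pE; pose w x := hv ^+ wexp D x; pose f := onc 0%N pi.
have wE i a : (a < v i)%N -> w (rc i a) = hv ^+ wtexp k i a by move=> /(rcellP H)[_ _ _ e _]; rewrite /w e.
apply: mul4E.
- exact: erefl.
- transitivity (\prod_(x : elt | color D (val x) == k.+1) U (w (val x)) (f (val x))).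
    by apply: eq_bigr => x _; rewrite /f oncE.
  rewrite (big_elt _ (fun x => U (w x) (f x))); apply: eq_bigr => a _.
  by rewrite wE // pE.
- apply: eq_bigr => e _.
  rewrite (@prod_elt2 _ _ _ (fun x y => U (w y / w x) ((f y)%:Z - (f x)%:Z))); last first.
    by move=> x y; rewrite /f !oncE.
  by apply: eq_bigr => a _; apply: eq_bigr => b _; rewrite !wE // !pE.
apply: eq_bigr => i _.
rewrite (@prod_elt2 _ _ _ (fun x y => (U (w y / w x) ((f y)%:Z - (f x)%:Z))^-1)); last first.
  by move=> x y; rewrite /f !oncE /zpochq invf_div.
by apply: eq_bigr => a _; apply: eq_bigr => b _; rewrite !wE // !pE.
Qed.

(** A path of generating relations that ends in a down-set stays inside it, so the inequalities can
    be chained. *)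
Lemma rpp_gens (pi : elt -> nat) :
  (forall x y, x \in P -> y \in P -> gens D x y -> (onc 0%N pi x <= onc 0%N pi y)%N) -> is_rpp pi.
Proof.
move=> hg; apply/forallP=> x; apply/forallP=> y; apply/implyP=> xy.
rewrite -(oncE 0%N pi x) -(oncE 0%N pi y).
have oP := rideal_order H; rewrite -ideal_ofE in oP.
have down z t : poset_le D z t -> t \in P -> z \in P.
  by move=> zt tP; case/andP: oP => _ /forallP /(_ z) /forallP /(_ t); rewrite tP zt.
move: xy (valP y); move: (val x) (val y) => {}x {}y /connectP[s + ->].
elim: s x => //= z s IHs x /andP[xz zs] lP.
have zP : z \in P by apply: down lP; apply/connectP; exists s.
have xP : x \in P by apply: down zP; apply: connect1.
by apply: leq_trans (IHs z zs lP); apply: hg => //; case/and3P: xz.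
Qed.

(** A generating relation x <= y goes along an arrow between cells of equal weight, or against an
    arrow with one more hbar at y. If it is violated, the factor of that arrow is one of the zeros
    of [zpochq_eq0]. *)
Lemma node_wt_rpp (pi : elt -> nat) p : (forall i a, (a < v i)%N -> p i a = onc 0%N pi (rc i a)) ->
  node_wt qv hv k (wtexp k) v p != 0 -> is_rpp pi.
Proof.
move=> pE; rewrite /node_wt !mulf_eq0 !negb_or => /andP[/andP[_ nz] _].
apply: rpp_gens => x y xP yP xy; rewrite leqNgt; apply/negP => lt.
have xR : x \in rideal D v by rewrite -ideal_ofE.
have yR : y \in rideal D v by rewrite -ideal_ofE.
have xD : x \in elems D by move: xR; rewrite inE => /andP[].
have yD : y \in elems D by move: yR; rewrite inE => /andP[].
have [i xi] := color_ex H xD; have [j yj] := color_ex H yD.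
have x0 := elem_gt0 H xD; have y0 := elem_gt0 H yD.
have xv : (x.2.-1 < v i)%N by rewrite prednK // -(in_rideal v xD xi).
have yv : (y.2.-1 < v j)%N by rewrite prednK // -(in_rideal v yD yj).
have [_ _ _ wx _] := rcellP H xv; have [_ _ _ wy _] := rcellP H yv.
have xE := rcellE H xD xi; have yE := rcellE H yD yj.
rewrite -xE in wx; rewrite -yE in wy.
have px := pE _ _ xv; have py := pE _ _ yv; rewrite -xE in px; rewrite -yE in py.
have z (s t : cell n) e : (wexp D t)%:Z - (wexp D s)%:Z = e ->
    (e = -1 /\ 0 < (onc 0%N pi t)%:Z - (onc 0%N pi s)%:Z) \/
    (e = 0 /\ (onc 0%N pi t)%:Z - (onc 0%N pi s)%:Z < 0) ->
    U (hv ^+ wexp D t / hv ^+ wexp D s) ((onc 0%N pi t)%:Z - (onc 0%N pi s)%:Z) = 0.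
  move=> wE h; rewrite (hdiv hv_neq0) wE; exact: (zpochq_eq0 qv_neq0 hv_neq0 h).
have [[aij w]|[aji w]] := gens_wexp H xD yD xy xi yj.
  move/prodf_neq0: nz => /(_ (i, j) aij) /prodf_neq0 /(_ (Ordinal xv) isT) /prodf_neq0 /(_ (Ordinal yv) isT).
  move/negP; apply; apply/eqP; rewrite [LHS]/= -wx -wy px py; apply: (z _ _ 0).
    by rewrite w subrr.
  by right; split; [exact: erefl | rewrite subr_lt0].
move/prodf_neq0: nz => /(_ (j, i) aji) /prodf_neq0 /(_ (Ordinal yv) isT) /prodf_neq0 /(_ (Ordinal xv) isT).
move/negP; apply; apply/eqP; rewrite [LHS]/= -wx -wy px py; apply: (z _ _ (-1)).
  by rewrite w -addn1 PoszD opprD addrA subrr sub0r.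
by left; split; [exact: erefl | rewrite subr_gt0].
Qed.

(** The labellings absent from [vertex] violate an order relation and have weight 0. A larger box
    adds nothing, since the degree bounds every value. *)
Theorem vertex_vertexN M N (d : 'X_{1..n}) : (forall i, (v i <= M)%N) -> (mdeg d <= N)%N ->
  vertex k v d = vertexN qv hv k (wtexp k) M N.+1 v d.
Proof.
move=> vM dN.
pose h' (pi : {ffun elt -> 'I_(mdeg d).+1}) : {ffun 'I_n * 'I_M -> 'I_N.+1} :=
  [ffun ia : 'I_n * 'I_M => inord (if (ia.2 < v ia.1)%N then pc pi (rc ia.1 ia.2) else 0%N)].
pose ci (x : cell n) : 'I_n := odflt k [pick i : 'I_n | color D x == i.+1].
have ciE x (i : 'I_n) : color D x = i.+1 -> ci x = i.
  rewrite /ci => xi; case: pickP => [j|/(_ i)]; last by rewrite xi eqxx.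
  by rewrite xi eqSS => /eqP/val_inj ->.
pose hh (f : {ffun 'I_n * 'I_M -> 'I_N.+1}) : {ffun elt -> 'I_(mdeg d).+1} :=
  [ffun x : elt => inord (nodeval f (ci (val x)) (val x).2.-1)].
have h'E pi i (a : 'I_M) : h' pi (i, a) = (if (a < v i)%N then pc pi (rc i a) else 0%N) :> nat.
  rewrite ffunE /= inordK //; case: ifP => // _; rewrite /onc; case: insub => //= x.
  by apply: leq_trans (ltn_ord _) _.
have pE pi i a : (a < v i)%N -> nodeval (h' pi) i a = pc pi (rc i a).
  move=> av; have aM := leq_trans av (vM i).
  by rewrite -[a]/(nat_of_ord (Ordinal aM)) /nodeval extzE h'E /= av.
have degE (pi : {ffun elt -> 'I_(mdeg d).+1}) : (rpp_deg (fun x => pi x) == d) = node_ok v d (h' pi).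
  have sE i : rpp_deg (fun x => pi x) i = (\sum_j (h' pi (i, j) : nat))%N.
    rewrite mnmE; transitivity (\sum_(a < v i) pc pi (rc i a))%N.
      by rewrite -(big_elt _ (pc pi)); apply: eq_bigr => x _; rewrite oncE.
    rewrite (big_ord_widen M (fun a => pc pi (rc i a)) (vM i)) big_mkcond.
    by apply: eq_bigr => j _; rewrite h'E.
  rewrite /node_ok; have -> /= : [forall i, [forall j : 'I_M, (v i <= j)%N ==> (h' pi (i, j) == 0 :> nat)%N]].
    by apply/forallP=> i; apply/forallP=> j; apply/implyP => vj; rewrite h'E ltnNge vj.
  by apply/eqP/forallP => [<- i|h]; [rewrite sE | apply/mnmP=> i; rewrite sE; apply/eqP].
transitivity (\sum_(pi : {ffun elt -> 'I_(mdeg d).+1} | rpp_deg (fun x => pi x) == d)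
    (c ^ Nexp k v d * node_wt qv hv k (wtexp k) v (nodeval (h' pi)))).
  rewrite /vertex big_mkcond [RHS]big_mkcond; apply: eq_bigr => pi _.
  have e := rpp_weightE (pE pi).
  case: (eqVneq (rpp_deg (fun x => pi x)) d) => [dE|]; last by rewrite andbF.
  have -> : c ^ Nexp k v d * node_wt qv hv k (wtexp k) v (nodeval (h' pi)) = rpp_weight (fun x => pi x).
    by rewrite e /rpp_N dE.
  rewrite andbT; case: ifPn => // nr; rewrite e.
  have /eqP -> : node_wt qv hv k (wtexp k) v (nodeval (h' pi)) == 0; last by rewrite mulr0.
  by apply: contraNT nr => /(node_wt_rpp (pE pi)).
rewrite -mulr_sumr /vertexN /node_sum; congr (_ * _).
rewrite [RHS](reindex_onto h' hh) /=; last first.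
  move=> f fok; apply/ffunP => -[i a]; apply/val_inj; rewrite [LHS]h'E.
  case/andP: fok => /forallP/(_ i)/forallP/(_ a) f0 /forallP/(_ i)/eqP fd.
  case: ltnP f0 => [av _|_ /= /eqP -> //].
  have aP : rc i a \in P by rewrite ideal_ofE (rcell_in H).
  have [_ _ x2 _ xc] := rcellP H av.
  rewrite /onc insubT /= ffunE /= (ciE _ _ xc) x2 /= /nodeval extzE inordK // ltnS.
  apply: leq_trans (_ : d i <= _)%N; first by rewrite -fd (bigD1 a) //= leq_addr.
  by rewrite mdegE (bigD1 i) //= leq_addr.
apply: eq_bigl => pi; rewrite degE.
have -> : hh (h' pi) == pi; last by rewrite andbT.
apply/eqP/ffunP=> x; rewrite ffunE.
have xR : val x \in rideal D v by rewrite -ideal_ofE; apply: valP.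
have xD : val x \in elems D by move: xR; rewrite inE => /andP[].
have [i xi] := color_ex H xD; have x0 := elem_gt0 H xD.
have xv : ((val x).2.-1 < v i)%N by rewrite prednK // -(in_rideal v xD xi).
by rewrite (ciE _ _ xi) pE // -(rcellE H xD xi) oncE inord_val.
Qed.

End Bridge.

Local Close Scope ring_scope.

(** * The three minuscule posets *)

Section Instances.
Variables (n : nat) (k : 'I_n) (v : 'I_n -> nat).
Hypothesis n4 : (4 <= n)%N.
Hypothesis av : admissible k v.
Local Notation V := (lab 0%N v).

Definition rowlab (i : 'I_n) : nat :=
  if k.+1 == n.-1 then swap_color n i.+1 else i.+1.

Let cl (r j : nat) : cell n := (inord r, inord j).

Let cl1 r j : r <= n -> (cl r j).1 = r :> nat. Proof. by move=> h; rewrite /= inordK. Qed.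
Let cl2 r j : j <= n -> (cl r j).2 = j :> nat. Proof. by move=> h; rewrite /= inordK. Qed.

Let clE (x : cell n) : cl x.1 x.2 = x.
Proof. by rewrite /cl !inord_val; case: x. Qed.

Section Spin.
Variable D : cwposet n.
Hypothesis kc : (k.+1 == n) || (k.+1 == n.-1).
Hypothesis De : forall x, (x \in elems D) = spin_elem n x.1 x.2.
Hypothesis Dg : forall x y, gens D x y = spin_gen n x.1 x.2 y.1 y.2.
Hypothesis Dw : forall x, wexp D x = spin_wexp n x.1 x.2.
Hypothesis Dc : forall x, color D x = if k.+1 == n.-1 then swap_color n x.1 else x.1.

(** The number of cells of row r in the ideal. Row n always carries the colour of k, which treats
    the two spin posets at once. *)
Let R (r : nat) : nat := if r <= n - 2 then V r else if r == n then v k else V (other_lab k).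

Let vR i : v i = R (rowlab i).
Proof.
have ni := ltn_ord i; rewrite -(labE 0 v i) /R /rowlab /swap_color -(labE 0 v k) /other_lab.
have [kn|kn] := eqVneq k.+1 n.-1.
  have -> : (k.+1 == n) = false by lia.
  rewrite kn; have [e|e1] := eqVneq i.+1 (n - 1).
    by rewrite eqxx; have -> : (n <= n - 2) = false; [lia|congr V; lia].
  have [e|e2] := eqVneq i.+1 n; last by have -> : (i.+1 <= n - 2) by lia.
  have -> : (n - 1 <= n - 2) = false by lia.
  by have -> : (n - 1 == n) = false; [lia|congr V; lia].
have kn' : k.+1 = n by lia.
rewrite kn' eqxx; case: leqP => // i2; case: eqP => [->|] // ne; congr V; lia.
Qed.

Let Rrel : [/\ forall r, r < n - 2 -> R r <= R r.+1 <= (R r).+1,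
   R (n - 2) <= R n.-1 + R n <= (R (n - 2)).+1, R n.-1 <= R n <= (R n.-1).+1 & R 0 = 0].
Proof.
have [yl ym yn] := admissible_spin n4 kc av.
have vk : v k = V k.+1 by rewrite labE.
have R2 r : r <= n - 2 -> R r = V r by rewrite /R => ->.
have Rn : R n = v k by rewrite /R eqxx; case: leqP => //; lia.
have Rn1 : R n.-1 = V (other_lab k) by rewrite /R; case: leqP; [lia|case: eqP => //; lia].
split.
- by move=> r rn; rewrite !R2; [exact: yl | lia | lia].
- rewrite Rn Rn1 R2 // vk; move: ym; rewrite /other_lab; case: eqP kc => [-> _|_ /= /eqP ->] //; first by rewrite addnC.
- by rewrite Rn Rn1.
- by rewrite R2.
Qed.

Let Rle r : r <= n - 2 -> R r <= r.
Proof.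
have [yl _ _ R0] := Rrel; elim: r => [|r IHr] rn; first by rewrite R0.
have := yl r; have := IHr; lia.
Qed.

Let edge r j r' j' : spin_elem n r j -> spin_elem n r' j' -> spin_gen n r j r' j' ->
  poset_le D (cl r j) (cl r' j').
Proof.
move=> e e' g; have [rn jn] : r <= n /\ j <= n by move: e; rewrite /spin_elem; lia.
have [rn' jn'] : r' <= n /\ j' <= n by move: e'; rewrite /spin_elem; lia.
by apply: connect1; apply/and3P; rewrite !De Dg !cl1 // !cl2 // e e' g.
Qed.

Lemma compatible_spin : compatible k D rowlab v.
Proof.
have [yl ym yn R0] := Rrel; have kn := ltn_ord k.
have rowE x (i : 'I_n) : x \in elems D -> color D x = i.+1 -> x.1 = rowlab i :> nat.
  have ni := ltn_ord i; rewrite De Dc /spin_elem /rowlab /swap_color => h.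
  by case: ifP => _; [do !case: ifP; lia | move=> ->].
split.
- move=> x i; have ni := ltn_ord i; rewrite De Dc /spin_elem /rowlab /swap_color => h.
  by case: ifP => _ //; apply/eqP/eqP; do !case: ifP; lia.
- move=> x; rewrite De => h; have cn : 0 < color D x <= n.
    by move: h; rewrite Dc /spin_elem /swap_color; do !case: ifP; lia.
  have cn' : (color D x).-1 < n by lia.
  by exists (Ordinal cn'); rewrite /=; lia.
- by move=> x; rewrite De /spin_elem; lia.
- move=> i a; rewrite vR => aR; have ni := ltn_ord i.
  have ri : 0 < rowlab i <= n by rewrite /rowlab /swap_color; do !case: ifP; lia.
  have el : spin_elem n (rowlab i) a.+1.
    move: aR; rewrite /spin_elem; have := @Rle (rowlab i); have := @Rle (n - 2).
    have [e|e1] := eqVneq (rowlab i) n; first by rewrite e; lia.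
    have [e|e2] := eqVneq (rowlab i) n.-1; first by rewrite e; lia.
    lia.
  have an : a.+1 <= n by move: el; rewrite /spin_elem; lia.
  exists (cl (rowlab i) a.+1); rewrite De Dw cl1 ?cl2 //; last by lia.
  split=> //; rewrite /wtexp /exlab /spin_wexp /rowlab /swap_color.
  have -> : (k.+1 == 1) = false by lia.
  have [kn1|kn1] := eqVneq k.+1 n.-1; first by rewrite kn1; do !case: ifP; lia.
  have -> : k.+1 = n by lia.
  by do !case: ifP; lia.
- move=> x y i j xD yD; rewrite Dg => g xi yj; rewrite (vR i) (vR j) -(rowE _ _ xD xi) -(rowE _ _ yD yj).
  rewrite De in xD; rewrite De in yD; move: xD yD g.
  move: (nat_of_ord x.1) (nat_of_ord x.2) (nat_of_ord y.1) (nat_of_ord y.2) => r s r' s'.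
  rewrite /spin_elem /spin_gen => e e' g; have y1 := yl r; have y2 := yl r'.
  case/orP: g => [/and3P[g1 /eqP -> /eqP ->]|]; first by lia.
  case/orP => [/and3P[g1 /eqP e1 /eqP e2]|]; first by rewrite e1 e2; lia.
  case/orP => [/and3P[/eqP -> /eqP e1 /eqP ->]|]; first by rewrite e1 subn1; lia.
  case/orP => [/and3P[/eqP e1 /eqP -> /eqP ->]|]; first by rewrite e1 subn1; lia.
  case/orP => [/and3P[/eqP -> /eqP -> /eqP ->]|]; first by lia.
  by case/and3P=> /eqP -> /eqP -> /eqP ->; lia.
- move=> x y i j xD yD; rewrite Dg !Dw => g xi yj.
  have rl z (l : 'I_n) : z = rowlab l -> (z <= n - 2 -> l.+1 = z) /\ (n.-1 <= z -> n.-1 <= l.+1).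
    by have nl := ltn_ord l; rewrite /rowlab /swap_color => ->; do !case: ifP; lia.
  have := rl _ _ (rowE _ _ xD xi); have := rl _ _ (rowE _ _ yD yj); rewrite /arrow.
  have sw1 r' s' : r' <= n - 2 -> spin_wexp n r' s' = n - r' + s' - 2 by rewrite /spin_wexp => ->.
  have sw2 s' : spin_wexp n (n - 1) s' = 2 * s' - 1.
    by rewrite /spin_wexp eqxx; case: leqP => //; lia.
  have sw3 s' : spin_wexp n n s' = 2 * s' - 2.
    by rewrite /spin_wexp; case: leqP; [lia|case: eqP => //; lia].
  have ni := ltn_ord i; have nj := ltn_ord j.
  rewrite De in xD; rewrite De in yD; move: xD yD g.
  move: (nat_of_ord x.1) (nat_of_ord x.2) (nat_of_ord y.1) (nat_of_ord y.2) => r s r' s' e e' g hj hi.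
  have [s0 s0'] : 0 < s /\ 0 < s' by move: e e'; rewrite /spin_elem; lia.
  move: g; rewrite /spin_gen.
  case/orP => [/and3P[g1 /eqP e1 /eqP e2]|].
    by right; move: hi hj; rewrite e1 e2 !sw1; [split|..]; lia.
  case/orP => [/and3P[g1 /eqP e1 /eqP e2]|].
    by left; move: hi hj; rewrite e1 e2 !sw1; [split|..]; lia.
  case/orP => [/and3P[/eqP e1 /eqP e2 /eqP e3]|].
    by left; move: hi hj; rewrite e1 e2 e3 sw2 sw1; [split|..]; lia.
  case/orP => [/and3P[/eqP e1 /eqP e2 /eqP e3]|].
    by right; move: hi hj; rewrite e1 e2 e3 sw2 sw1; [split|..]; lia.
  case/orP => [/and3P[/eqP e1 /eqP e2 /eqP e3]|].
    by left; move: e hi hj; rewrite e1 e2 e3 sw3 sw1; [split|..]; lia.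
  case/and3P => /eqP e1 /eqP e2 /eqP e3.
  by right; move: hi hj; rewrite e1 e2 e3 sw3 sw1; [split|..]; lia.
(* Up to the row n - 3, consecutive cells of a row are joined through a cell of the next row; on the
   last three rows the path alternates between the row n - 2 and the two end rows. *)
move=> x; rewrite De => e x2; pose r : nat := x.1; pose s : nat := x.2.-1.
have xE : x = cl r s.+1 by rewrite /r /s prednK ?clE //; lia.
have e1 : spin_elem n r s.+1 by move: e; rewrite /r /s prednK //; lia.
have s0 : 0 < s by rewrite /s; lia.
have [rn sn] : 0 < r <= n /\ s.+1 <= n by move: e1; rewrite /spin_elem; lia.
have e0 : spin_elem n r s by move: e1; rewrite /spin_elem; lia.
exists (cl r s); rewrite De !cl1 ?cl2 //; try lia; split=> //.
- by rewrite /cl /r inord_val.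
- by rewrite /s prednK //; lia.
rewrite xE; move: e0 e1; rewrite /poset_le => e0 e1.
clear e x2 xE.
have [r3|r3] := leqP r (n - 3).
  apply: (connect_trans (y := cl r.+1 s.+1)); apply: edge; move: e0 e1; rewrite /spin_elem /spin_gen; lia.
have se1 j : 0 < j <= n - 2 -> spin_elem n (n - 2) j.
  by move=> h; apply/orP; left; apply/andP; split=> //; lia.
have se2 j : 0 < j -> 2 * j <= n - 1 -> spin_elem n (n - 1) j.
  by move=> h h'; apply/orP; right; apply/orP; left; rewrite eqxx h /=; lia.
have se3 j : 0 < j -> 2 * j <= n -> spin_elem n n j.
  by move=> h h'; apply/orP; right; apply/orP; right; rewrite eqxx h /=; lia.
have E3 j : 0 < j -> 2 * j <= n - 1 -> poset_le D (cl (n - 2) (2 * j - 1)) (cl (n - 1) j).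
  move=> h h'; apply: edge; [by apply: se1; lia | exact: se2 |].
  by rewrite /spin_gen !eqxx !orbT.
have E4 j : 0 < j -> 2 * j <= n - 2 -> poset_le D (cl (n - 1) j) (cl (n - 2) (2 * j)).
  move=> h h'; apply: edge; [by apply: se2; lia | by apply: se1; lia |].
  by rewrite /spin_gen !eqxx !orbT.
have E5 j : 1 < j -> 2 * j <= n -> poset_le D (cl (n - 2) (2 * j - 2)) (cl n j).
  move=> h h'; apply: edge; [by apply: se1; lia | by apply: se3; lia |].
  by rewrite /spin_gen !eqxx !orbT.
have E6 j : 0 < j -> 2 * j <= n - 1 -> poset_le D (cl n j) (cl (n - 2) (2 * j - 1)).
  move=> h h'; apply: edge; [by apply: se3; lia | by apply: se1; lia |].
  by rewrite /spin_gen !eqxx !orbT.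
have [r2|r2] := eqVneq r (n - 2).
  have sn2 : s.+1 <= n - 2 by move: e1; rewrite r2 /spin_elem; lia.
  rewrite r2; have [[t st]|[t st]] : (exists t, s = 2 * t - 1 /\ 0 < t) \/ (exists t, s = 2 * t - 2 /\ 1 < t).
  - by have := odd_double_half s; case: odd => h; [left; exists s./2.+1 | right; exists s./2.+1]; lia.
  - have -> : s.+1 = 2 * t by lia.
    by rewrite st.1; apply: connect_trans (E3 _ _ _) (E4 _ _ _); lia.
  have -> : s.+1 = 2 * t - 1 by lia.
  by rewrite st.1; apply: connect_trans (E5 _ _ _) (E6 _ _ _); lia.
have [r1|r1] := eqVneq r (n - 1).
  have sn2 : 2 * s.+1 <= n - 1 by move: e1; rewrite r1 /spin_elem; lia.
  have h5 := E5 s.+1; have h6 := E6 s.+1; have e2 : 2 * s.+1 - 2 = 2 * s by lia.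
  rewrite e2 in h5; rewrite r1.
  apply: connect_trans (E4 s _ _) _; [lia|lia|].
  apply: connect_trans (h5 _ _) _; [lia|lia|].
  by apply: connect_trans (h6 _ _) (E3 _ _ _); lia.
have r0 : r = n by lia.
have sn2 : 2 * s.+1 <= n by move: e1; rewrite r0 /spin_elem; lia.
have h5 := E5 s.+1; have e2 : 2 * s.+1 - 2 = 2 * s by lia.
rewrite e2 in h5; rewrite r0.
apply: connect_trans (E6 s _ _) _; [lia|lia|].
apply: connect_trans (E3 s _ _) _; [lia|lia|].
by apply: connect_trans (E4 s _ _) (h5 _ _); lia.
Qed.

End Spin.
Lemma compatible_vect : k.+1 = 1 -> compatible k (vector_poset n) rowlab v.
Proof.
move=> k1; have [j [t [tE jn hV hn1 hn]]] := admissible_vect n4 k1 av.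
have rowE i : rowlab i = i.+1 by rewrite /rowlab k1; case: eqP => //; lia.
have Vf L : 0 < L <= n -> V L = if L <= n - 2 then (if j < L then t else 1)
    else if j <= n - 2 then t./2 else if L == n then t == 2 else t == 0.
  move=> Ln; case: (leqP L (n - 2)) => L2; first by rewrite hV //; lia.
  by have [->|Ln'] := eqVneq L n; [rewrite hn | have -> : L = n.-1 by [lia]; rewrite hn1].
have De x : (x \in elems (vector_poset n)) = vector_elem n x.1 x.2 by rewrite inE.
split.
- by move=> x i _; rewrite rowE.
- move=> x; rewrite De /vector_elem => h; have cn : (nat_of_ord x.1).-1 < n by lia.
  have e : nat_of_ord x.1 = (nat_of_ord x.1).-1.+1 by lia.
  by exists (Ordinal cn); exact: e.
- by move=> x; rewrite De /vector_elem; lia.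
- move=> i a; have ni := ltn_ord i; rewrite -(labE 0 v i) Vf; last by lia.
  move=> aV; have el : vector_elem n i.+1 a.+1.
    by move: aV; rewrite /vector_elem; case: tE => ->; do !case: ifP; lia.
  have an : a.+1 <= n by move: el; rewrite /vector_elem; lia.
  exists (cl i.+1 a.+1); rewrite De rowE cl1 ?cl2 //; split=> //.
  rewrite /vector_poset [LHS]/= -/(cl _ _) cl1 // cl2 // /vector_wexp /wtexp /exlab k1 eqxx.
  have [a0|[a1 i2]] : a = 0 \/ a = 1 /\ i.+1 <= n - 2 by move: el; rewrite /vector_elem; lia.
    by rewrite a0.
  by rewrite a1 /= mul1n; lia.
- move=> x y i j' xD yD g xi yj.
  rewrite -(labE 0 v i) -(labE 0 v j') -xi -yj; move: xD yD g; rewrite !De [gens _ _ _]/= [color _ x]/= [color _ y]/=.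
  move: (nat_of_ord x.1) (nat_of_ord x.2) (nat_of_ord y.1) (nat_of_ord y.2) => r s r' s' e e' g.
  rewrite !Vf; [|by move: e e'; rewrite /vector_elem; lia ..].
  move: g; rewrite /vector_gen => /or4P[/and4P[g1 /eqP -> /eqP -> /eqP ->]|/and4P[g1 /eqP -> /eqP -> /eqP ->]|/and4P[/eqP -> /eqP -> /eqP -> /eqP ->]|/orP[/and4P[/eqP -> /eqP -> /eqP -> /eqP ->]|/and4P[/eqP -> /eqP -> /eqP -> /eqP ->]]];
    clear Vf hV hn hn1 rowE e e'; case: tE => t0; rewrite ?t0; do ?case: ifP; lia.
- move=> x y i j' xD yD g xi yj; have ni := ltn_ord i; have nj := ltn_ord j'; rewrite /arrow -xi -yj.
  move: xD yD g; rewrite !De [gens _ _ _]/= [color _ x]/= [color _ y]/= [wexp _ x]/= [wexp _ y]/=.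
  move: (nat_of_ord x.1) (nat_of_ord x.2) (nat_of_ord y.1) (nat_of_ord y.2) => r s r' s' _ _.
  rewrite /vector_gen => /or4P[/and4P[g1 /eqP -> /eqP -> /eqP ->]|/and4P[g1 /eqP -> /eqP -> /eqP ->]|/and4P[/eqP -> /eqP -> /eqP -> /eqP ->]|/orP[/and4P[/eqP -> /eqP -> /eqP -> /eqP ->]|/and4P[/eqP -> /eqP -> /eqP -> /eqP ->]]];
    rewrite /vector_wexp /=.
  + by left; split=> //; lia.
  + by right; split; lia.
  + by left; split=> //; lia.
  + by right; split; lia.
  + by right; split; lia.
move=> x; rewrite De => e x2; pose r : nat := x.1.
have [r0 s2] : 0 < r <= n - 2 /\ x.2 = 2 :> nat by move: e x2; rewrite /vector_elem /r; lia.
have xE : x = cl r 2 by rewrite /r -s2 clE.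
have edge r1 s1 r' s' : vector_elem n r1 s1 -> vector_elem n r' s' -> vector_gen n r1 s1 r' s' ->
    poset_le (vector_poset n) (cl r1 s1) (cl r' s').
  move=> e1 e' g; have [rn sn] : r1 <= n /\ s1 <= n by move: e1; rewrite /vector_elem; lia.
  have [rn' sn'] : r' <= n /\ s' <= n by move: e'; rewrite /vector_elem; lia.
  have Dg z t' : gens (vector_poset n) z t' = vector_gen n z.1 z.2 t'.1 t'.2 by [].
  by apply: connect1; apply/and3P; rewrite !De Dg !cl1 // !cl2 // e1 e' g.
exists (cl r 1); rewrite De !cl1 ?cl2 ?s2 //; try lia; split=> //.
- by rewrite /vector_elem; lia.
- by rewrite /cl /r inord_val.
rewrite xE; clear e x2 s2 xE; have [m] : exists m, r + m = n - 2 by exists (n - 2 - r); lia.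
(* Induction on the distance to the fork: the chain runs along the first cells to row n and returns
   along the second ones. *)
elim: m (r) r0 => [|m IHm] {}r r0 rm.
  apply: (connect_trans (y := cl n 1)); apply: edge; rewrite /vector_elem /vector_gen; lia.
apply: (connect_trans (y := cl r.+1 1)); first by apply: edge; rewrite /vector_elem /vector_gen; lia.
apply: (connect_trans (y := cl r.+1 2)); first by apply: IHm; lia.
by apply: edge; rewrite /vector_elem /vector_gen; lia.
Qed.

Lemma compatible_minuscule : minuscule k -> compatible k (minuscule_poset k) rowlab v.
Proof.
move=> kmin; have kn := ltn_ord k; case: (minuscule_cases kmin) => kE.
- have -> : minuscule_poset k = vector_poset n by rewrite /minuscule_poset kE eqxx.
  exact: compatible_vect.
- have -> : minuscule_poset k = spin_poset n.
    by rewrite /minuscule_poset kE eqxx; case: eqP => //; lia.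
  apply: compatible_spin => [|x|//|//|x]; [by rewrite kE eqxx | by rewrite inE |].
  by rewrite kE; case: eqP => //; lia.
have -> : minuscule_poset k = spin_poset' n.
  by rewrite /minuscule_poset; case: eqP => [|_]; [lia|case: eqP => //; lia].
apply: compatible_spin => [|x|//|//|x]; [by rewrite kE eqxx orbT | by rewrite inE |].
by rewrite kE eqxx.
Qed.

End Instances.

(** * The induction on the dimension vector *)

Local Open Scope ring_scope.

Section Final.
Variables (n : nat) (k : 'I_n).
Hypothesis n4 : (4 <= n)%N.
Hypothesis kmin : minuscule k.

Lemma vertexN_zero (M N : nat) (d : 'X_{1..n}) :
  vertexN qv hv k (wtexp k) M N.+1 (fun=> 0%N) d = (1 : fps n Qqh) d.
Proof.
pose f0 : {ffun 'I_n * 'I_M -> 'I_N.+1} := [ffun=> ord0].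
have ok0 f : node_ok (fun=> 0%N) d f -> f = f0 /\ d = 0%MM.
  case/andP=> /forallP f1 /forallP f2.
  have fz i j : f (i, j) = 0%N :> nat by apply/eqP; exact: (forallP (f1 i) j).
  split; first by apply/ffunP => -[i j]; rewrite ffunE; apply/val_inj/fz.
  by apply/mnmP=> i; rewrite mnm0E -(eqP (f2 i)) big1 // => j _; rewrite fz.
rewrite fps_coef1 /vertexN /node_sum; case: (eqVneq d 0%MM) => [d0|d0]; last first.
  by rewrite big_pred0 ?mulr0 // => f; apply/negbTE/negP => /ok0[_] e; rewrite e eqxx in d0.
rewrite (big_pred1 f0) => [|f]; last first.
  apply/idP/eqP => [/ok0[]//|->]; apply/andP; split.
    by apply/forallP=> i; apply/forallP=> j; rewrite ffunE.
  by apply/forallP=> i; rewrite d0 mnm0E big1 // => j _; rewrite ffunE.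
have -> : Nexp k (fun=> 0%N) d = 0.
  by rewrite /Nexp big1 // => i _; rewrite d0 mnm0E mulr0.
rewrite expr0z mul1r /node_wt big_ord0 big1 => [|e _]; last by rewrite big_ord0.
by rewrite big1 => [|i _]; [rewrite !mulr1 | rewrite big_ord0].
Qed.

(** The threshold [N0] depends on d: the recursion leads to finitely many other degrees [dd j],
    possibly larger than d, and the box must suit all of them. *)
Lemma vertexN_root_prod (v : 'I_n -> nat) : admissible k v ->
  forall d : 'X_{1..n}, exists N0, forall N M, (N0 <= N)%N -> (forall i, (v i <= M)%N) ->
  vertexN qv hv k (wtexp k) M N.+1 v d = root_prod k v d.
Proof.
have [s] : exists s, (\sum_i v i < s)%N by exists (\sum_i v i).+1%N.
have n1 : (1 < n)%N by lia.
elim: s v => // s IHs v vs av d.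
have [[i0 vi0]|v0] := pselect (exists i, v i != 0%N); last first.
  have -> : v = fun=> 0%N.
    by apply/funext=> i; apply/eqP/negbNE/negP => vi; apply: v0; exists i.
  by exists 0%N => N M _ _; rewrite vertexN_zero root_prod0.
have [i hi] := descent n4 kmin av (ex_intro _ i0 vi0).
pose v' := upd v i (v i).-1.
have v'i : v' i = (v i).-1 by rewrite /v' /upd eqxx.
have vE : v = upd v' i (v' i).+1.
  apply/funext=> j; rewrite /upd v'i; case: eqVneq => [->|ji]; first by lia.
  by rewrite /v' /upd (negPf ji).
have nb : nbrdeg i v' = nbrdeg i v.
  by have [e1 e2] := nbr_upd i v (v i).-1; rewrite /nbrdeg e1 e2.
(* Since (mu_v', alpha_i) = 1, removing the vertex leaves [qform] unchanged. *)
have av' : admissible k v'.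
  move: av; rewrite !admissibleE vE qform_upd nb v'i; case: (i == k) hi => hi; lia.
have mu1 : pairing (weight_mu k v') (simple_root i) = 1.
  rewrite weight_mu_pairing // nb v'i -natrD.
  have -> : ((i == k) + nbrdeg i v = ((v i).-1 * 2).+1)%N by lia.
  by rewrite -natr1 natrM mulr_natr addrAC subrr add0r.
have sv' : (\sum_j v' j < s)%N.
  move: vs; rewrite (bigD1 i) //= [in X in _ -> X](bigD1 i) //= v'i.
  rewrite [X in _ -> (_ + X < _)%N](eq_bigr v) => [|j /negPf ji]; last by rewrite /v' /upd ji.
  lia.
have [N0 hN0] := choice (IHs v' sv' av').
pose dd j : 'X_{1..n} := [multinom upd d i (nbrdeg i d + j - d i)%N l | l < n].
exists (\max_(j < (d i).+1) N0 (dd j) + (nbrdeg i d + d i))%N => N M NM vM.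
have loc p : exists A B, perm_eq (ylist k (wtexp k) v' i p) (nbrs (wtexp k i) (v' i) A B).
  by apply: (local_structure n4 kmin _ av'); rewrite nb v'i; lia.
have v'M j : (v' j <= M)%N.
  by apply: leq_trans (vM j); rewrite /v' /upd; case: eqP => [->|_] //; apply: leq_pred.
have viM : (v' i < M)%N by have := vM i; rewrite v'i; lia.
rewrite vE (vertexN_rec qv_neq0 hv_neq0 hqv_inj (ltn0Sn N) (wtexp_lt k n4 i) v'M viM loc); last by lia.
  rewrite (root_prod_rec n1 _ mu1); apply: eq_bigr => j _; congr (_ * _).
  have le : (N0 (dd j) <= N)%N.
    apply: leq_trans (leq_trans (leq_addr (nbrdeg i d + d i) _) NM).
    exact: (@leq_bigmax _ (fun j : 'I_(d i).+1 => N0 (dd j)) j).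
  rewrite -[RHS]/(root_prod k v' (dd j)) -(hN0 _ _ _ le v'M).
  by congr vertexN; apply/funext=> l; rewrite mnmE.
by lia.
Qed.

End Final.

Theorem theorem1p2 (R : realType) (n : nat) (k : 'I_n) (v : 'I_n -> nat) :
  (4 <= n)%N ->
  minuscule k ->
  quiver_variety_nonempty R[i] v (delta k) ->
  let mu := fund_weight k - \sum_i (v i)%:R *: simple_root i in
  vertex k v =
    \prod_(a <- positive_roots n | pairing mu a < 0)
       fps_comp Fprod (exp_root v a).
Proof.
move=> n4 kmin [p [mp sp]] mu.
have av : admissible k v.
  rewrite /admissible; apply: leq_trans (quiver_dim_le mp sp) _.
  rewrite leq_add2l (bigD1 k) //= /delta eqxx muln1 big1 ?addn0 // => i /negPf ->.
  by rewrite muln0.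
have n1 : (1 < n)%N by lia.
rewrite (big_root_prod k v); apply/funext=> d.
have [N0 hN0] := vertexN_root_prod n4 kmin av d.
have vM i : (v i <= \sum_j v j)%N by rewrite (bigD1 i) //= leq_addr.
rewrite (vertex_vertexN (compatible_minuscule n4 av kmin) vM (leq_maxr N0 (mdeg d))).
by apply: hN0 => //; apply: leq_maxl.
Qed.
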